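(* Let $A$ be a separable $C^{\ast}$-algebra. The following are equivalent: (i) The spectrum $\widehat{A}$ is discrete. (ii) The Banach space dual $A^{\ast}$ has the weak$^{\ast}$ fixed point property. (iii) $A^{\ast}$ has the weak$^{\ast}$ fixed point property for left reversible semigroups.
   Context: The spectrum $\widehat{A}$ of a $C^{\ast}$-algebra $A$ is the set of unitary equivalence classes of irreducible $\ast$-representations of $A$, endowed with the inverse image of the Jacobson (hull-kernel) topology on the set of primitive ideals under the map $\pi\mapsto\ker\pi$. $A^{\ast}$ is the Banach space dual of $A$, and its weak$^{\ast}$ topology is $\sigma(A^{\ast},A)$. A non-empty bounded closed convex subset $K$ of a Banach space $E$ has the fixed point property if every non-expansive map $T:K\to K$ (i.e. $\|Tx-Ty\|\le\|x-y\|$ for all $x,y\in K$) has a fixed point. A dual Banach space $E$ has the weak$^{\ast}$ fixed point property if every non-empty weak$^{\ast}$ compact convex subset of $E$ has the fixed point property. A semitopological semigroup is a semigroup $\mathcal{S}$ with a Hausdorff topology such that for each $a\in\mathcal{S}$ the maps $s\mapsto as$ and $s\mapsto sa$ are continuous; it is left reversible if any two non-empty closed right ideals of $\mathcal{S}$ have non-empty intersection. An action of $\mathcal{S}$ on $K$ is a map $\mathcal{S}\times K\to K$, $(s,x)\mapsto s\cdot x$, with $(st)\cdot x=s\cdot(t\cdot x)$; it is by non-expansive mappings if $\|s\cdot x-s\cdot y\|\le\|x-y\|$ for all $s\in\mathcal{S}$, $x,y\in K$, and separately continuous if it is continuous in each variable when the other is fixed ($K$ carrying the norm topology). A dual Banach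 space $E$ has the weak$^{\ast}$ fixed point property for left reversible semigroups if, whenever a left reversible semitopological semigroup $\mathcal{S}$ acts separately continuously by non-expansive mappings on a non-empty weak$^{\ast}$ compact convex set $K\subset E$, there is a common fixed point in $K$, i.e. some $x\in K$ with $s\cdot x=x$ for all $s\in\mathcal{S}$. *)

(* Defs.v *)
From HB Require Import structures.
From mathcomp Require Import all_boot all_order all_algebra.
From mathcomp Require Import complex.
From mathcomp Require Import all_classical all_reals all_analysis.

Set Implicit Arguments.
Unset Strict Implicit.
Unset Printing Implicit Defensive.

Import Order.TTheory GRing.Theory Num.Theory numFieldNormedType.Exports.

Local Open Scope classical_set_scope.
Local Open Scope ring_scope.

Section dual_space.
Context {R : realType} (X : normedModType R[i]).

Definition bounded_functional : {pred X -> R[i]^o} :=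
  fun f => `[< linear f /\ continuous f >].

Lemma bounded_functional_submod : submod_closed bounded_functional.
Proof.
split; first by apply/asboolP; split=> [a x y|x]; [rewrite scaler0 addr0|exact: cvg_cst].
move=> a f g /asboolP[lf cf] /asboolP[lg cg]; apply/asboolP; split.
  move=> b x y; rewrite /= !fctE; rewrite lf lg /=.
  rewrite !scalerDr !scalerA (mulrC a b) addrACA; congr (_ + _).
by move=> x; apply: cvgD; [apply: cvgZr; exact: cf|exact: cg].
Qed.

HB.instance Definition _ := GRing.isSubmodClosed.Build R[i] (X -> R[i]^o)
  bounded_functional bounded_functional_submod.

Record dual := Dual {
  dual_fun :> X -> R[i]^o;
  dual_funP : dual_fun \in bounded_functional }.

HB.instance Definition _ := [isSub for dual_fun].
HB.instance Definition _ := [Choice of dual by <:].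
HB.instance Definition _ := [SubChoice_isSubLmodule of dual by <:].

Implicit Types f g : dual.

Lemma dual_linear (f : dual) : linear f.
Proof. by case: f => f /= /asboolP[]. Qed.

Lemma dual_continuous (f : dual) : continuous f.
Proof. by case: f => f /= /asboolP[]. Qed.

HB.instance Definition _ (f : dual) :=
  GRing.isLinear.Build R[i] X R[i]^o *:%R f (@dual_linear f).

Definition dual_norm (f : dual) : R[i] :=
  (sup [set complex.Re `|f x| | x in [set x | `|x| <= 1]])%:C%C.

Let ReK (z : R[i]) : (complex.Re `|z|)%:C%C = `|z|.
Proof. by rewrite RRe_real// normr_real. Qed.

Let S (f : dual) := [set complex.Re `|f x| | x in [set x | `|x| <= 1]].

Let S0 f : S f !=set0.
Proof. by exists (complex.Re `|f 0|), 0 => //=; rewrite normr0. Qed.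

Let Sub f : has_ubound (S f).
Proof.
have /linear_bounded_continuous/linear_boundedP := @dual_continuous f.
move=> [M [Mr]] /(_ (M + 1)) H.
have {}H x : `|f x| <= (M + 1) * `|x| by apply: H; rewrite ltrDl.
have M1r : M + 1 \is Num.real by rewrite realD ?real1.
exists (Num.max 0 (complex.Re (M + 1))) => _ [x /= x1 <-].
rewrite -lecR ReK; apply: le_trans (H x) _.
have -> : M + 1 = (complex.Re (M + 1))%:C%C by rewrite RRe_real.
set m := complex.Re _.
apply: (@le_trans _ _ ((Num.max 0 m)%:C%C * `|x|)).
  by rewrite ler_wpM2r// lecR le_max lexx orbT.
by rewrite ler_piMr// ler0c le_max lexx.
Qed.

Let le_dual_norm1 f x : `|x| <= 1 -> `|f x| <= dual_norm f.
Proof. by move=> x1; rewrite -ReK lecR; apply: (ub_le_sup (@Sub f)); exists x. Qed.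

Let dual_norm_le f (M : R[i]) :
  M \is Num.real -> (forall x, `|x| <= 1 -> `|f x| <= M) -> dual_norm f <= M.
Proof.
move=> Mr H; rewrite -(RRe_real Mr) lecR; apply: (ge_sup (@S0 f)) => _ [x /= x1 <-].
by rewrite -lecR ReK RRe_real// H.
Qed.

Let dual_norm_ge0 f : 0 <= dual_norm f.
Proof. by apply: le_trans (@le_dual_norm1 f 0 _); rewrite ?normr0. Qed.

Lemma le_dual_norm f x : `|f x| <= dual_norm f * `|x|.
Proof.
have [->|x0] := eqVneq x 0; first by rewrite linear0 !normr0 mulr0.
have nx : 0 < `|x| by rewrite normr_gt0.
rewrite -ler_pdivrMr// mulrC -[X in X * _]ger0_norm ?invr_ge0// -normrZ -linearZ.
by apply: le_dual_norm1; rewrite normrZ ger0_norm ?invr_ge0// mulVf ?gt_eqF.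
Qed.

Let dual_normD f g : dual_norm (f + g) <= dual_norm f + dual_norm g.
Proof.
apply: dual_norm_le => [|x x1]; first by rewrite realD ?ger0_real.
by rewrite (le_trans (ler_normD _ _))// lerD// le_dual_norm1.
Qed.

Let dual_normZ_le (a : R[i]) f : dual_norm (a *: f) <= `|a| * dual_norm f.
Proof.
apply: dual_norm_le => [|x x1]; first by rewrite realM ?ger0_real.
by rewrite normrM ler_wpM2l// le_dual_norm1.
Qed.

Let dual_normZ (a : R[i]) f : dual_norm (a *: f) = `|a| * dual_norm f.
Proof.
apply/eqP; rewrite eq_le dual_normZ_le/=.
have [->|a0] := eqVneq a 0; first by rewrite normr0 mul0r.
rewrite -ler_pdivlMl ?normr_gt0// -normfV; apply: le_trans (dual_normZ_le _ _).
by rewrite scalerA mulVf// scale1r.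
Qed.

Let dual_norm_eq0 f : dual_norm f = 0 -> f = 0.
Proof.
move=> f0; apply/val_inj/funext => x /=.
apply/normr0_eq0/le_anti; rewrite normr_ge0 andbT.
by rewrite (le_trans (le_dual_norm f x))// f0 mul0r.
Qed.

HB.instance Definition _ :=
  Lmodule_isNormed.Build R[i] dual dual_normD dual_normZ dual_norm_eq0.

(* sigma(X^*, X): the topology of pointwise convergence. *)
Definition weak_star : Type :=
  initial_topology (dual_fun : dual -> {ptws X -> R[i]^o}).

HB.instance Definition _ := Topological.on weak_star.

End dual_space.

Definition nonexpansive_on (K : numDomainType) (E : normedModType K)
    (C : set E) (T : E -> E) :=
  forall x y, C x -> C y -> `|T x - T y| <= `|x - y|.

(* A self-map of C is given by a map on E that preserves C. *)
Definition fixed_point_property (K : numDomainType) (E : normedModType K)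
    (C : set E) :=
  forall T : E -> E, {homo T : x / C x} -> nonexpansive_on C T ->
    exists x, C x /\ T x = x.

Section weak_star_fixed_points.
Context {R : realType} (X : normedModType R[i]).

Definition weak_star_compact_convex (C : set (dual X)) :=
  [/\ C !=set0, compact (C : set (weak_star X)) & convex_set C].

Definition weak_star_fpp :=
  forall C : set (dual X), weak_star_compact_convex C -> fixed_point_property C.

End weak_star_fixed_points.

HB.mixin Record isSemitopologicalSemigroup S of Semigroup S & Topological S := {
  semitop_hausdorff : hausdorff_space S;
  semitop_mull : forall a : S, continuous (fun s : S => monoid.mul a s);
  semitop_mulr : forall a : S, continuous (fun s : S => monoid.mul s a)
}.

#[short(type="semitopologicalSemigroupType")]
HB.structure Definition SemitopologicalSemigroup :=
  {S of isSemitopologicalSemigroup S & Semigroup S & Topological S}.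

Definition right_ideal (S : semitopologicalSemigroupType) (I : set S) :=
  forall a s, I a -> I (monoid.mul a s).

Definition left_reversible (S : semitopologicalSemigroupType) :=
  forall I J : set S,
    I !=set0 -> closed I -> right_ideal I ->
    J !=set0 -> closed J -> right_ideal J -> I `&` J !=set0.

Section actions.
Context {R : realType} {E : normedModType R[i]}.
Context {S : semitopologicalSemigroupType}.

Definition acts_on (C : set E) (act : S -> E -> E) :=
  (forall s x, C x -> C (act s x)) /\
  (forall s t x, C x -> act (monoid.mul s t) x = act s (act t x)).

Definition separately_continuous_on (C : set E) (act : S -> E -> E) :=
  (forall s, {within C, continuous (act s)}) /\
  (forall x, C x -> continuous (fun s => act s x)).

End actions.

Definition weak_star_fpp_left_reversible
    (R : realType) (X : normedModType R[i]) :=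
  forall (S : semitopologicalSemigroupType) (C : set (dual X))
    (act : S -> dual X -> dual X),
    left_reversible S -> weak_star_compact_convex C ->
    acts_on C act -> separately_continuous_on C act ->
    (forall s, nonexpansive_on C (act s)) ->
    exists x, C x /\ forall s, act s x = x.

(* C*-algebras need not be unital, so cmul is not a MathComp ring product. *)
HB.mixin Record isCStarAlgebra (R : realType) A of CompleteNormedModule R[i] A := {
  cmul : A -> A -> A;
  cstar : A -> A;
  cmulA : associative cmul;
  cmul_linearl : forall y, linear (cmul^~ y);
  cmul_linearr : forall x, linear (cmul x);
  cnormM : forall x y, `|cmul x y| <= `|x| * `|y|;
  cstarK : involutive cstar;
  cstarM : forall x y, cstar (cmul x y) = cmul (cstar y) (cstar x);
  cstar_antilinear : forall (a : R[i]) x y,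
    cstar (a *: x + y) = a^* *: cstar x + cstar y;
  cnorm_starM : forall x, `|cmul (cstar x) x| = `|x| ^+ 2
}.

#[short(type="cStarAlgType")]
HB.structure Definition CStarAlgebra (R : realType) :=
  {A of isCStarAlgebra R A & CompleteNormedModule R[i] A}.

HB.mixin Record isHilbert (R : realType) H of CompleteNormedModule R[i] H := {
  inner : {dot H for (@Num.conj R[i])};
  inner_norm : forall x : H, `|x| ^+ 2 = inner x x
}.

#[short(type="hilbertType")]
HB.structure Definition Hilbert (R : realType) :=
  {H of isHilbert R H & CompleteNormedModule R[i] H}.

Definition separable_space (T : topologicalType) :=
  exists2 D : set T, countable D & dense D.

Section representations.
Context {R : realType} (A : cStarAlgType R).

Record representation := Representation {
  rep_space : hilbertType R;
  rep_op :> A -> rep_space -> rep_space;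
  rep_op_linear : forall a, linear (rep_op a);
  rep_op_continuous : forall a, continuous (rep_op a);
  rep_linear : forall v, linear (rep_op^~ v);
  repM : forall a b v, rep_op (cmul a b) v = rep_op a (rep_op b v);
  rep_star : forall a u v,
    inner (rep_op a u) v = inner u (rep_op (cstar a) v) }.

Implicit Types pi rho : representation.

Definition closed_subspace (H : hilbertType R) (V : set H) :=
  [/\ closed V, V 0 & forall (c : R[i]) u v, V u -> V v -> V (c *: u + v)].

(* The first clause excludes the zero space and the null representation on a
   one-dimensional space. *)
Definition irreducible pi :=
  (exists a v, pi a v != 0) /\
  forall V : set (rep_space pi), closed_subspace V ->
    (forall a v, V v -> V (pi a v)) -> V = [set 0] \/ V = setT.

Record irrep := Irrep {
  irrep_rep :> representation;
  irrepP : irreducible irrep_rep }.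

Definition unitarily_equivalent pi rho :=
  exists U : rep_space pi -> rep_space rho,
    [/\ linear U, forall y, exists x, U x = y,
        forall x y, inner (U x) (U y) = inner x y
      & forall a x, U (pi a x) = rho a (U x)].

Definition rep_ker pi : set A := [set a | forall v, pi a v = 0].

Definition primitive (P : set A) := exists pi : irrep, P = rep_ker pi.

Record prim := Prim {
  prim_ideal :> set A;
  primP : primitive prim_ideal }.

HB.instance Definition _ := gen_eqMixin prim.
HB.instance Definition _ := gen_choiceMixin prim.

Definition kernel (F : set prim) : set A := \bigcap_(P in F) prim_ideal P.

Definition hull (I : set A) : set prim := [set P | I `<=` prim_ideal P].

(* F is closed when F = hull (kernel F), the closure of F; O is open when its
   complement is closed. *)
Definition hull_kernel_open : set (set prim) :=
  [set O | hull (kernel (~` O)) `<=` ~` O].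

Let inner_eq0 (H : hilbertType R) (u : H) :
  (forall v, inner u v = 0) -> u = 0.
Proof.
move=> /(_ u); rewrite -inner_norm => /eqP; rewrite expf_eq0/= normr_eq0.
by move=> /eqP.
Qed.

Let lin0 (H : hilbertType R) (T : H -> H) : linear T -> T 0 = 0.
Proof. by move=> /(_ (-1) 0 0); rewrite scaler0 addr0 scaleN1r addNr. Qed.

Let annihilator_subspace (H : hilbertType R) (B : set (H -> H)) :
  (forall T, B T -> linear T /\ continuous T) ->
  closed_subspace [set v | forall T, B T -> T v = 0].
Proof.
move=> BT; split => [||c u v /= Hu Hv T TB].
- rewrite (_ : [set v | _] = \bigcap_(T in B) T @^-1` [set 0]) //.
  apply: closed_bigI => T TB; apply: preimage_closed.
    by move=> x _; have [_ cT] := BT T TB; exact: cT.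
  exact/accessible_closed_set1/hausdorff_accessible/norm_hausdorff.
- by move=> T /BT[lT _]; exact: lin0.
- by have [lT _] := BT T TB; rewrite lT Hu// Hv// scaler0 addr0.
Qed.

Let nondegenerate (pi : irrep) v : (forall a, pi a v = 0) -> v = 0.
Proof.
move=> H; have [[a [w aw0]] irr] := irrepP pi.
have := irr [set v | forall T, (exists a, T = pi a) -> T v = 0].
case.
- apply: annihilator_subspace => _ [b ->].
  by split; [exact: rep_op_linear|exact: rep_op_continuous].
- by move=> b u Hu _ [c ->]; rewrite -repM; apply: Hu; exists (cmul c b).
- by move=> V0; have : [set 0] v by rewrite -V0 => _ [b ->]; exact: H.
- move=> VT; have : setT w by [].
  by rewrite -VT => /(_ (pi a)) /= E; move: aw0; rewrite E ?eqxx//; exists a.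
Qed.

Lemma rep_ker_prime (pi : irrep) x y :
  (forall a, rep_ker pi (cmul x (cmul a y))) -> rep_ker pi x \/ rep_ker pi y.
Proof.
move=> H; apply: contrapT => /not_orP[nx ny].
have [w yw0] : exists w, pi y w != 0.
  by apply: contrapT => /forallNP yw; apply: ny => w; have /negP/negPn/eqP := yw w.
have {}H a : pi x (pi a (pi y w)) = 0 by have /= := H a w; rewrite !repM.
have [_ irr] := irrepP pi.
have xb0 b v : pi x (pi b v) = 0.
  have := irr [set v | forall T, (exists a, T = pi x \o pi a) -> T v = 0].
  case.
  - apply: annihilator_subspace => _ [c ->]; split.
      by move=> k u t /=; rewrite !rep_op_linear.
    by move=> u; apply: continuous_comp; exact: rep_op_continuous.
  - move=> c u Hu _ [d ->] /=; rewrite -(repM d).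
    by apply: (Hu (pi x \o pi (cmul d c))); exists (cmul d c).
  - move=> V0; have : [set 0] (pi y w) by rewrite -V0 => _ [c ->]; exact: H.
    by move=> /= E; rewrite E eqxx in yw0.
  - move=> VT; have : setT v by [].
    by rewrite -VT => /(_ (pi x \o pi b)) /=; apply; exists b.
apply: nx => v; apply: inner_eq0 => u.
rewrite rep_star (_ : pi _ u = 0) ?linear0r//.
apply: nondegenerate => b; apply: inner_eq0 => t.
by rewrite !rep_star cstarK xb0 linear0r.
Qed.

Let prim_idealMl (P : prim) a b : prim_ideal P b -> prim_ideal P (cmul a b).
Proof.
case: P => Q [pi QE] /=; rewrite QE => Pb v; rewrite repM Pb; exact/lin0/rep_op_linear.
Qed.

Let prim_idealMr (P : prim) a b : prim_ideal P a -> prim_ideal P (cmul a b).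
Proof. by case: P => Q [pi QE] /=; rewrite QE => Pa v; rewrite repM Pa. Qed.

Let prim_prime (P : prim) x y :
  (forall a, prim_ideal P (cmul x (cmul a y))) ->
  prim_ideal P x \/ prim_ideal P y.
Proof. by case: P => Q [pi QE] /=; rewrite QE; exact: rep_ker_prime. Qed.

Let prim_proper (P : prim) : exists a, ~ prim_ideal P a.
Proof.
case: P => Q [pi QE] /=; rewrite QE; have [[a [v av0]] _] := irrepP pi.
by exists a => /(_ v) E; rewrite E eqxx in av0.
Qed.

Let hull_kernel_openT : hull_kernel_open setT.
Proof.
move=> P HP _; have [a] := prim_proper P; apply; apply: HP.
by move=> Q /(_ I).
Qed.

Let hull_kernel_openI : setI_closed hull_kernel_open.
Proof.
move=> U V oU oV P HP [UP VP].
have [x [xU xP]] : exists x, kernel (~` U) x /\ ~ prim_ideal P x.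
  apply: contrapT => /forallNP H; apply: (oU P) => // x xU.
  by apply: contrapT => xP; exact: (H x).
have [y [yV yP]] : exists y, kernel (~` V) y /\ ~ prim_ideal P y.
  apply: contrapT => /forallNP H; apply: (oV P) => // y yV.
  by apply: contrapT => yP; exact: (H y).
have [a|//|//] := @prim_prime P x y.
apply: HP => Q /not_andP[nU|nV].
  by apply: prim_idealMr; exact: xU.
by do 2 apply: prim_idealMl; exact: yV.
Qed.

Let hull_kernel_open_bigU (I : Type) (f : I -> set prim) :
  (forall i, hull_kernel_open (f i)) -> hull_kernel_open (\bigcup_i f i).
Proof.
move=> of_ P HP [i _ fiP]; apply: (of_ i P) => // a Ha; apply: HP => Q nQ.
by apply: Ha => fiQ; apply: nQ; exists i.
Qed.

HB.instance Definition _ := isOpenTopological.Build prim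
  hull_kernel_openT hull_kernel_openI hull_kernel_open_bigU.

Lemma rep_ker_unitary pi rho :
  unitarily_equivalent pi rho -> rep_ker pi = rep_ker rho.
Proof.
move=> [U [lU sU iU UE]]; apply/seteqP; split=> a /= Ha v.
  have [w <-] := sU v; rewrite -UE Ha.
  by have := lU (-1) 0 0; rewrite scaler0 addr0 scaleN1r addNr.
apply: inner_eq0 => w; rewrite -iU UE Ha linear0l//.
Qed.

Lemma unitarily_equivalent_refl pi : unitarily_equivalent pi pi.
Proof. by exists id; split=> // y; exists y. Qed.

(* The spectrum is a set of classes of irreducible representations on arbitrary
   Hilbert spaces. It therefore lives in a strictly larger universe than the
   carriers of MathComp structures and cannot be a topologicalType: its topology,
   the inverse image of the hull-kernel topology, is given by spectrum_open. The space prim of primitive ideals is small and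
   carries the hull-kernel topology as a topologicalType. *)
Definition spectrum : Type :=
  {c : irrep -> Prop |
    exists pi : irrep, c = (fun rho : irrep => unitarily_equivalent pi rho)}.

(* The common kernel of the members of a class. *)
Definition spectrum_ker (c : spectrum) : set A :=
  [set a | forall pi : irrep, sval c pi -> rep_ker pi a].

Lemma spectrum_kerE (c : spectrum) (pi : irrep) :
  sval c pi -> spectrum_ker c = rep_ker pi.
Proof.
case: c => c [rho cE]; rewrite /spectrum_ker /= cE => rhopi.
apply/seteqP; split=> a /=; first exact.
move=> pia sigma rhosigma.
by rewrite -(rep_ker_unitary rhosigma) (rep_ker_unitary rhopi).
Qed.

Lemma spectrum_ker_primitive (c : spectrum) : primitive (spectrum_ker c).
Proof.
have [pi cpi] : exists pi : irrep, sval c pi.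
  by case: c => c [pi cE]; exists pi; rewrite /= cE; exact: unitarily_equivalent_refl.
by exists pi; exact: spectrum_kerE.
Qed.

Definition spectrum_prim (c : spectrum) : prim := Prim (spectrum_ker_primitive c).

Definition spectrum_open (U : spectrum -> Prop) :=
  exists2 O : set prim, open O & forall c, U c <-> O (spectrum_prim c).

Definition spectrum_discrete := forall U : spectrum -> Prop, spectrum_open U.

End representations.

(* Main.v *)
(* Everything goes through the condition that [A] is the closed span of its minimal
   projections [p], those with [p A p = C p] (below: [atomic]).

   If [A] is atomic, finite sums of orthogonal minimal projections approximate [A], and
   compressing functionals by them gives a uniform Kadec-Klee inequality for the dual norm
   and the weak-* topology. The asymptotic radius of an orbit is then constant on a
   minimal invariant weak-* compact convex set and must vanish, which gives common fixed
   points for left reversible semigroups; the semigroup of natural numbers gives those of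
   single maps. An irreducible representation is moreover determined by any minimal
   projection that it does not annihilate, so the spectrum is discrete.

   If [A] is not atomic, functional calculus provides orthogonal elements [c_n] and
   contractions [a_n] that act as units on the later [c_m] and annihilate the earlier
   ones. States [psi_n] concentrated on [c_n] have, by separability, a weak-* convergent
   subsequence with limit [phi], and [phi], [psi_n] span an isometric copy of [l^1], which
   contains a weak-* compact convex set with a fixed point free isometry.

   If [A] is not atomic, the spectrum is not discrete either. Either some hereditary
   subalgebra contains no minimal projection, and splitting it repeatedly gives a dyadic
   tree whose uncountably many branches are orthogonal in too few representations; or the
   closed span of the minimal projections is a proper ideal whose annihilating irreducible
   representations are not isolated, since every nonzero positive element dominates a
   minimal projection. *)

(* Spectra of elements never appear: positivity in the unitization is the inequality
   [un (t - x) <= t], square roots come from an iteration, and absolute values, positive parts and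
   truncations are built from square roots.

   On the fixed point side the obstacle is that minimality can be exploited only for weak-* compact
   sets, whereas the points of asymptotic radius at most [rho] have no evident reason to form a
   weak-* closed set. Pythagorean inequalities for compressions by a projection and its complement,
   from either side, yield both this closedness and the Kadec-Klee inequality.

   For the converse, the limit [phi] has value one at every [a_n], whereas [psi_m] vanishes at [a_n]
   for [n >= m]. A signed sum of finitely many [c_i] and one late [a_n] therefore norms every real
   combination of the [psi_i] and [phi], the coefficient of [phi] included.

   Weak-* limits are taken along ultrafilters. Separability enters where such a limit is replaced by
   that of a subsequence, where an extremal set of states is cut down to a pure state, and where the
   branches of the tree are counted. *)
From HB Require Import structures.
Require Import Defs.
From mathcomp Require Import all_boot all_order all_algebra.
From mathcomp Require Import complex ring lra.
From mathcomp Require Import all_classical all_reals all_analysis.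

Set Implicit Arguments.
Unset Strict Implicit.
Unset Printing Implicit Defensive.

Import Order.TTheory GRing.Theory Num.Theory numFieldNormedType.Exports.

Local Open Scope classical_set_scope.
Local Open Scope ring_scope.

(** * Modules over the complex numbers *)

(* The trivial extension of a module is a commutative ring, in which [ring]
   decides the linear identities of the module. *)
Definition triv_ext (K : comNzRingType) (V : lmodType K) : Type := (K * V)%type.

Section triv_ext.
Context {K : comNzRingType} {V : lmodType K}.
Local Notation T := (triv_ext V).
Implicit Types (x y z : T) (k : K) (v : V).

HB.instance Definition _ := GRing.Zmodule.copy T (K * V)%type.

Let tone : T := (1, 0).
Let tmul x y : T := (x.1 * y.1, x.1 *: y.2 + y.1 *: x.2).

Let text x y : x.1 = y.1 -> x.2 = y.2 -> x = y.
Proof. by case: x y => ? ? [? ?] /= -> ->. Qed.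

Let tmulA : associative tmul.
Proof.
move=> x y z; apply: text => /=; first by rewrite mulrA.
by rewrite !scalerDr !scalerA addrA !(mulrC z.1).
Qed.

Let tmulC : commutative tmul.
Proof. by move=> x y; rewrite /tmul mulrC addrC. Qed.

Let tmul1 : left_id tone tmul.
Proof. by move=> x; apply: text; rewrite /= ?mul1r// scale1r scaler0 addr0. Qed.

Let tmulDl : left_distributive tmul +%R.
Proof.
move=> x y z; apply: text => /=; first by rewrite mulrDl.
by rewrite scalerDl scalerDr addrACA.
Qed.

Let tone_neq0 : tone != 0.
Proof. by apply/eqP => /(congr1 fst)/= /eqP; rewrite oner_eq0. Qed.

HB.instance Definition _ := GRing.Zmodule_isComNzRing.Build T
  tmulA tmulC tmul1 tmulDl tone_neq0.

Definition tvec v : T := (0, v).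
Definition tsc k : T := (k, 0).

Let tvec_additive : zmod_morphism tvec.
Proof. by move=> u v; apply: text; rewrite //= subrr. Qed.

HB.instance Definition _ := GRing.isZmodMorphism.Build V T tvec tvec_additive.

Let tsc_additive : zmod_morphism tsc.
Proof. by move=> u v; apply: text; rewrite //= subrr. Qed.

HB.instance Definition _ := GRing.isZmodMorphism.Build K T tsc tsc_additive.

Let tsc_multiplicative : monoid_morphism tsc.
Proof. by split=> // u v; apply: text; rewrite //= !scaler0 addr0. Qed.

HB.instance Definition _ := GRing.isMonoidMorphism.Build K T tsc tsc_multiplicative.

Lemma tvecZ k v : tvec (k *: v) = tsc k * tvec v.
Proof. by apply: text; rewrite /= ?mulr0// scale0r addr0. Qed.

Lemma tvecD u v : tvec (u + v) = tvec u + tvec v.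
Proof. exact: (raddfD tvec). Qed.

Lemma tvecN u : tvec (- u) = - tvec u.
Proof. exact: (raddfN tvec). Qed.

Lemma tvec0 : tvec 0 = 0.
Proof. by []. Qed.

Lemma tvec_inj u v : tvec u = tvec v -> u = v.
Proof. by case. Qed.

End triv_ext.

Ltac lmod := apply: tvec_inj; do ?[rewrite (tvecD, tvecN, tvec0, tvecZ)]; ring.

Lemma scale_mull (K : comNzRingType) (V : algType K) (k : K) (u v : V) :
  (k *: u) * v = k *: (u * v).
Proof. by rewrite scalerAl. Qed.

Lemma scale_mulr (K : comNzRingType) (V : algType K) (k : K) (u v : V) :
  u * (k *: v) = k *: (u * v).
Proof. by rewrite scalerAr. Qed.

(** Multiplying out leaves noncommutative monomials, which [lmod] then treats as atoms of the
    module. *)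
Ltac expand := do ?[rewrite (mulrDl, mulrDr, mulrN, mulNr, mul1r, mulr1, mul0r,
  mulr0, scale_mull, scale_mulr)]; rewrite ?mulrA.
Ltac ualg := expand; lmod.

(** * Real-valued norms and sequential completeness *)

Section real_norm.
Context {R : realType}.

(** Norms over [R[i]] are [R[i]]-valued; suprema, infima and [lra] call for the underlying real
    number. *)
Definition nr (V : normedZmodType R[i]) (x : V) : R := complex.Re `|x|.

Section normed.
Context {V : normedZmodType R[i]}.
Implicit Types x y : V.

Lemma nrE x : `|x| = (nr x)%:C%C.
Proof. by rewrite /nr RRe_real// normr_real. Qed.

Lemma nr_ge0 x : 0 <= nr x.
Proof. by rewrite -ler0c -nrE. Qed.

Lemma nr_le x (t : R) : (nr x <= t) = (`|x| <= t%:C%C).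
Proof. by rewrite nrE lecR. Qed.

Lemma nr0 : nr (0 : V) = 0.
Proof. by rewrite /nr normr0. Qed.

Lemma nrN x : nr (- x) = nr x.
Proof. by rewrite /nr normrN. Qed.

Lemma nr_sub x y : nr (x - y) = nr (y - x).
Proof. by rewrite -nrN opprB. Qed.

Lemma nr0_eq0 x : nr x = 0 -> x = 0.
Proof. by move=> x0; apply: normr0_eq0; rewrite nrE x0. Qed.

Lemma nrD x y : nr (x + y) <= nr x + nr y.
Proof. by rewrite nr_le rmorphD/= -!nrE ler_normD. Qed.

Lemma nrB x y : nr (x - y) <= nr x + nr y.
Proof. by rewrite -(nrN y) nrD. Qed.

Lemma nr_tri y x z : nr (x - z) <= nr (x - y) + nr (y - z).
Proof. by rewrite (le_trans _ (nrD _ _))// addrA subrK. Qed.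

Lemma nr_dist x y : nr x <= nr y + nr (x - y).
Proof. by rewrite (le_trans _ (nrD _ _))// addrC subrK. Qed.

Lemma nr_small x : (forall e, 0 < e -> nr x <= e) -> x = 0.
Proof.
move=> H; apply: nr0_eq0; apply/eqP; rewrite eq_le nr_ge0 andbT.
by apply/ler_addgt0Pr => e e0; rewrite add0r H.
Qed.

Lemma nr_sum (I : Type) (r : seq I) (P : pred I) (F : I -> V) :
  nr (\sum_(i <- r | P i) F i) <= \sum_(i <- r | P i) nr (F i).
Proof.
elim/big_ind2 : _ => [|a b c d ab cd|//]; first by rewrite nr0.
by rewrite (le_trans (nrD _ _))// lerD.
Qed.

End normed.

Lemma nrM (a b : R[i]) : nr (a * b) = nr a * nr b.
Proof. by rewrite {1}/nr normrM !nrE -rmorphM. Qed.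

Lemma nr1 : nr (1 : R[i]) = 1.
Proof. by rewrite /nr normr1. Qed.

Lemma nrR (t : R) : nr t%:C%C = `|t|.
Proof. by rewrite /nr normc_def /= expr0n addr0 sqrtr_sqr. Qed.

Lemma nr_conj (a : R[i]) : nr a^* = nr a.
Proof. by rewrite /nr norm_conjC. Qed.

Lemma nri : nr ('i : R[i]) = 1.
Proof. by rewrite /nr normCi. Qed.

Lemma Re_nr (a : R[i]) : `|complex.Re a| <= nr a.
Proof. by rewrite -lecR -nrE normc_ge_Re. Qed.

Lemma gt0C (t : R) : (0 < t%:C%C :> R[i]) = (0 < t).
Proof. by rewrite -ltcR. Qed.

Lemma iE : 'i = Complex 0 1 :> R[i].
Proof. by []. Qed.

Lemma conjR (t : R) : (t%:C%C : R[i])^* = t%:C%C.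
Proof. exact: conjc_real. Qed.

Section normed_module.
Context {V : normedModType R[i]}.
Implicit Types x y : V.

Lemma nrZ (a : R[i]) x : nr (a *: x) = nr a * nr x.
Proof. by rewrite {1}/nr normrZ !nrE -rmorphM. Qed.

Lemma nrZR (t : R) x : nr (t%:C%C *: x) = `|t| * nr x.
Proof. by rewrite nrZ nrR. Qed.

End normed_module.

(** Phrased for real double sequences so as to apply also to the norm [un] of the unitization, which
    is kept as a plain function. *)
Definition ncauchy (u : nat -> nat -> R) :=
  forall e, 0 < e -> exists M, forall m n, (M <= m)%N -> (M <= n)%N -> u m n <= e.

Definition nnull (u : nat -> R) :=
  forall e, 0 < e -> exists M, forall n, (M <= n)%N -> u n <= e.

Lemma real_complete (u : nat -> R) :
  ncauchy (fun m n => `|u m - u n|) -> exists l, nnull (fun n => `|u n - l|).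
Proof.
move=> cu.
have : cvg (u @ \oo).
  apply: cauchy_cvg; apply/cauchy_ballP => e e0.
  have [M HM] := cu (e / 2) ltac:(by rewrite divr_gt0).
  rewrite !near_map2; exists ([set n | M <= n]%N, [set n | M <= n]%N).
    by split; exists M.
  move=> [m n] [/= Mm Mn]; rewrite -ball_normE /=.
  by rewrite (le_lt_trans (HM _ _ Mm Mn))// ltr_pdivrMr// ltr_pMr// ltr1n.
move=> /cvg_ex[l ul]; exists l => e e0.
have := (cvgrPdist_le _ _).1 ul e e0.
by move=> [M _ HM]; exists M => n Mn; rewrite distrC; exact: HM.
Qed.

Lemma nr_ReIm (a : R[i]) : nr a <= `|complex.Re a| + `|complex.Im a|.
Proof.
rewrite {1}(complexE a) (le_trans (nrD _ _))// nrM !nrR.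
by rewrite (_ : nr _ = 1) ?mul1r// -iE nri.
Qed.

Lemma Im_nr (a : R[i]) : `|complex.Im a| <= nr a.
Proof.
by rewrite -normrN -ReiNIm (le_trans (Re_nr _))// nrM (_ : nr 'i%C = 1) ?mulr1 ?nri.
Qed.

Lemma complex_complete (u : nat -> R[i]) :
  ncauchy (fun m n => nr (u m - u n)) -> exists l, nnull (fun n => nr (u n - l)).
Proof.
move=> cu.
have [x Hx] : exists l, nnull (fun n => `|complex.Re (u n) - l|).
  apply: real_complete => e /cu[M HM]; exists M => m n Mm Mn.
  by rewrite -raddfB (le_trans (Re_nr _))// HM.
have [y Hy] : exists l, nnull (fun n => `|complex.Im (u n) - l|).
  apply: real_complete => e /cu[M HM]; exists M => m n Mm Mn.
  by rewrite -raddfB (le_trans (Im_nr _))// HM.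
exists (Complex x y) => e e0.
have [M1 HM1] := Hx (e / 2) ltac:(by rewrite divr_gt0).
have [M2 HM2] := Hy (e / 2) ltac:(by rewrite divr_gt0).
exists (maxn M1 M2) => n; rewrite geq_max => /andP[n1 n2].
rewrite (le_trans (nr_ReIm _))// (splitr e) !raddfB lerD//.
  exact: HM1.
exact: HM2.
Qed.

Lemma nr_complete (V : completeNormedModType R[i]) (u : nat -> V) :
  ncauchy (fun m n => nr (u m - u n)) ->
  exists l, nnull (fun n => nr (u n - l)).
Proof.
move=> cu.
have : cvg (u @ \oo).
  apply: cauchy_cvg; apply/cauchy_ballP => e e0.
  have er : e = (complex.Re e)%:C%C by rewrite RRe_real// gtr0_real.
  have r0 : 0 < complex.Re e by rewrite -gt0C -er.
  have [M HM] := cu (complex.Re e / 2) ltac:(by rewrite divr_gt0).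
  rewrite !near_map2; exists ([set n | M <= n]%N, [set n | M <= n]%N).
    by split; exists M.
  move=> [m n] [/= Mm Mn]; rewrite -ball_normE /= er nrE ltcR.
  by rewrite (le_lt_trans (HM _ _ Mm Mn))// ltr_pdivrMr// ltr_pMr// ltr1n.
move=> /cvg_ex[l ul]; exists l => e e0.
have := (cvgrPdist_le _ _).1 ul e%:C%C ltac:(by rewrite gt0C).
move=> [M _ HM]; exists M => n Mn; rewrite nr_sub nr_le; exact: HM.
Qed.

End real_norm.

(** * The unitization *)

Section cstar_algebra.
Context {R : realType} {A : cStarAlgType R}.
Implicit Types (a b c : A) (k : R[i]).

Lemma cmulDl a b c : cmul (a + b) c = cmul a c + cmul b c.
Proof. by have := cmul_linearl c 1 a b; rewrite !scale1r. Qed.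

Lemma cmulDr a b c : cmul a (b + c) = cmul a b + cmul a c.
Proof. by have := cmul_linearr a 1 b c; rewrite !scale1r. Qed.

Lemma cmul0a a : cmul 0 a = 0.
Proof. by apply: (addrI (cmul 0 a)); rewrite -cmulDl !addr0. Qed.

Lemma cmula0 a : cmul a 0 = 0.
Proof. by apply: (addrI (cmul a 0)); rewrite -cmulDr !addr0. Qed.

Lemma cmulZl k a b : cmul (k *: a) b = k *: cmul a b.
Proof. by have := cmul_linearl b k a 0; rewrite !addr0 cmul0a addr0. Qed.

Lemma cmulZr k a b : cmul a (k *: b) = k *: cmul a b.
Proof. by have := cmul_linearr a k b 0; rewrite !addr0 cmula0 addr0. Qed.

Lemma cstarD a b : cstar (a + b) = cstar a + cstar b.
Proof. by have := @cstar_antilinear _ A 1 a b; rewrite rmorph1 !scale1r. Qed.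

Lemma cstar0 : cstar (0 : A) = 0.
Proof. by apply: (addrI (cstar 0)); rewrite -cstarD !addr0. Qed.

Lemma cstarZ k a : cstar (k *: a) = k^* *: cstar a.
Proof. by have := @cstar_antilinear _ A k a 0; rewrite !addr0 cstar0 addr0. Qed.

Lemma nr_cmul a b : nr (cmul a b) <= nr a * nr b.
Proof. by rewrite nr_le rmorphM/= -!nrE cnormM. Qed.

Lemma nr_starM a : nr (cmul (cstar a) a) = nr a ^+ 2.
Proof. by rewrite {1}/nr cnorm_starM nrE -rmorphXn. Qed.

Lemma nr_star a : nr (cstar a) = nr a.
Proof.
suff H b : nr b <= nr (cstar b).
  by apply/eqP; rewrite eq_le H -{2}(cstarK a) H.
have [b0|b0] := eqVneq (nr b) 0; first by rewrite b0 nr_ge0.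
have b1 : 0 < nr b by rewrite lt_def b0 nr_ge0.
by rewrite -(ler_pM2r b1) -expr2 -nr_starM nr_cmul.
Qed.

End cstar_algebra.

(* Also for unital [A] a new unit is adjoined; the norm [un] below stays a
   C*-norm because it dominates the scalar part. *)
Definition unitization (R : realType) (A : cStarAlgType R) : Type :=
  (R[i]^o * A)%type.

Section unitization.
Context {R : realType} {A : cStarAlgType R}.
Local Notation U := (unitization A).

HB.instance Definition _ := GRing.Lmodule.copy U (R[i]^o * A)%type.

Definition umul (x y : U) : U :=
  (x.1 * y.1, x.1 *: y.2 + y.1 *: x.2 + cmul x.2 y.2).

Definition uone : U := (1, 0).

Lemma uext (x y : U) : x.1 = y.1 -> x.2 = y.2 -> x = y.
Proof. by case: x y => ? ? [? ?] /= -> ->. Qed.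

Let umulA : associative umul.
Proof.
move=> x y z; apply: uext => /=; first by rewrite mulrA.
rewrite !(cmulDl, cmulDr, cmulZl, cmulZr, scalerDr, scalerA) cmulA.
by rewrite !(mulrC z.1) [LHS](AC (4*3) (1*(2*4*6)*(3*5*7))).
Qed.

Let umul1x : left_id uone umul.
Proof.
by move=> x; apply: uext => /=; rewrite ?mul1r// scale1r cmul0a scaler0 !addr0.
Qed.

Let umulx1 : right_id uone umul.
Proof.
by move=> x; apply: uext => /=; rewrite ?mulr1// scale1r cmula0 scaler0 add0r addr0.
Qed.

Let umulDl : left_distributive umul +%R.
Proof.
move=> x y z; apply: uext => /=; first by rewrite mulrDl.
by rewrite scalerDl scalerDr cmulDl [LHS](AC (2*2*2) ((1*3*5)*(2*4*6))).
Qed.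

Let umulDr : right_distributive umul +%R.
Proof.
move=> x y z; apply: uext => /=; first by rewrite mulrDr.
by rewrite scalerDl scalerDr cmulDr [LHS](AC (2*2*2) ((1*3*5)*(2*4*6))).
Qed.

Let uone_neq0 : uone != 0.
Proof. by apply/eqP => /(congr1 fst)/= /eqP; rewrite oner_eq0. Qed.

HB.instance Definition _ := GRing.Zmodule_isNzRing.Build U
  umulA umul1x umulx1 umulDl umulDr uone_neq0.

Let uscaleAl (k : R[i]) (u v : U) : k *: (u * v) = (k *: u) * v.
Proof.
apply: uext => /=; first by rewrite scalerAl.
by rewrite !scalerDr !scalerA cmulZl (mulrC k v.1).
Qed.

HB.instance Definition _ := GRing.Lmodule_isLalgebra.Build R[i] U uscaleAl.

Let uscaleAr (k : R[i]) (u v : U) : k *: (u * v) = u * (k *: v).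
Proof.
apply: uext => /=; first by rewrite scalerAr.
by rewrite !scalerDr !scalerA cmulZr (mulrC k u.1).
Qed.

HB.instance Definition _ := GRing.Lalgebra_isAlgebra.Build R[i] U uscaleAr.

Definition ustar (x : U) : U := (x.1^*, cstar x.2).

Definition uin (a : A) : U := (0, a).

Definition uact (x : U) (b : A) : A := x.1 *: b + cmul x.2 b.

Definition un (x : U) : R :=
  Num.max (nr x.1) (sup [set nr (uact x b) | b in [set b | nr b <= 1]]).

Implicit Types (x y z : U) (a b : A) (k : R[i]).

Lemma ustarK : involutive ustar.
Proof. by move=> x; apply: uext; rewrite /= ?conjCK ?cstarK. Qed.

Lemma ustarD x y : ustar (x + y) = ustar x + ustar y.
Proof. by apply: uext; rewrite /= ?rmorphD ?cstarD. Qed.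

Lemma ustarZ k x : ustar (k *: x) = k^* *: ustar x.
Proof. by apply: uext; rewrite /= ?rmorphM ?cstarZ. Qed.

Lemma ustarN x : ustar (- x) = - ustar x.
Proof. by rewrite -scaleN1r ustarZ rmorphN1 scaleN1r. Qed.

Lemma ustarB x y : ustar (x - y) = ustar x - ustar y.
Proof. by rewrite ustarD ustarN. Qed.

Lemma ustarM x y : ustar (x * y) = ustar y * ustar x.
Proof.
apply: uext => /=; first by rewrite rmorphM mulrC.
by rewrite !cstarD !cstarZ cstarM (addrC (x.1^* *: _)).
Qed.

Lemma ustar1 : ustar 1 = 1.
Proof. by apply: uext; rewrite /= ?rmorph1 ?cstar0. Qed.

Lemma ustar0 : ustar 0 = 0.
Proof. by apply: uext; rewrite /= ?rmorph0 ?cstar0. Qed.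

Lemma uscalarE k : k *: 1 = (k, 0) :> U.
Proof. by apply: uext => /=; rewrite ?scaler0// [LHS]mulr1. Qed.

Lemma uinD a b : uin (a + b) = uin a + uin b.
Proof. by apply: uext; rewrite //= addr0. Qed.

Lemma uinZ k a : uin (k *: a) = k *: uin a.
Proof. by apply: uext; rewrite /= ?scaler0. Qed.

Lemma uinM a b : uin (cmul a b) = uin a * uin b.
Proof. by apply: uext; rewrite /= ?mulr0// !scale0r !add0r. Qed.

Lemma uin_star a : uin (cstar a) = ustar (uin a).
Proof. by apply: uext; rewrite /= ?rmorph0. Qed.

Lemma uinP x : x.1 = 0 -> x = uin x.2.
Proof. by move=> x0; apply: uext. Qed.

Lemma uactM x y b : uact (x * y) b = uact x (uact y b).
Proof.
rewrite /uact /= !(cmulDl, cmulDr, cmulZl, cmulZr, scalerDr, scalerDl, scalerA).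
by rewrite cmulA -!addrA; congr (_ + _); rewrite addrA.
Qed.

Lemma uactD x y b : uact (x + y) b = uact x b + uact y b.
Proof. by rewrite /uact /= scalerDl cmulDl addrACA. Qed.

Lemma uactZ k x b : uact (k *: x) b = k *: uact x b.
Proof. by rewrite /uact /= cmulZl scalerDr scalerA. Qed.

Lemma uact_scale k x b : uact x (k *: b) = k *: uact x b.
Proof. by rewrite /uact /= cmulZr scalerDr !scalerA mulrC. Qed.

Lemma uact_star x b c :
  cmul (cstar (uact x b)) c = cmul (cstar b) (uact (ustar x) c).
Proof.
by rewrite /uact /= cstarD cstarZ cstarM cmulDl cmulDr cmulZl cmulZr cmulA.
Qed.

Let uset x := [set nr (uact x b) | b in [set b | nr b <= 1]].

Let uset0 x : uset x !=set0.
Proof. by exists (nr (uact x 0)), 0 => //=; rewrite nr0. Qed.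

Let uset_bound x b : nr (uact x b) <= (nr x.1 + nr x.2) * nr b.
Proof.
by rewrite mulrDl (le_trans (nrD _ _))// nrZ lerD2l nr_cmul.
Qed.

Let uset_ub x : has_ubound (uset x).
Proof.
exists (nr x.1 + nr x.2) => _ [b /= b1 <-].
by rewrite (le_trans (uset_bound _ _))// ler_piMr// addr_ge0// nr_ge0.
Qed.

Let un_act1 x b : nr b <= 1 -> nr (uact x b) <= un x.
Proof.
by move=> b1; rewrite le_max (ub_le_sup (uset_ub x)) ?orbT//; exists b.
Qed.

Lemma un_scalar x : nr x.1 <= un x.
Proof. by rewrite le_max lexx. Qed.

Lemma un_ge0 x : 0 <= un x.
Proof. exact: le_trans (nr_ge0 _) (un_scalar x). Qed.

Lemma un_act x b : nr (uact x b) <= un x * nr b.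
Proof.
have [->|b0] := eqVneq b 0.
  by rewrite /uact scaler0 cmula0 addr0 nr0 mulr0.
have nb : 0 < nr b by rewrite lt_def nr_ge0 andbT; apply: contra_neq b0 => /nr0_eq0.
rewrite -ler_pdivrMr// mulrC.
have -> : (nr b)^-1 * nr (uact x b) = nr (uact x ((nr b)^-1%:C%C *: b)).
  by rewrite uact_scale nrZR gtr0_norm// invr_gt0.
by apply: un_act1; rewrite nrZR gtr0_norm ?invr_gt0// mulVf// gt_eqF.
Qed.

Lemma un_le x (t : R) :
  nr x.1 <= t -> (forall b, nr (uact x b) <= t * nr b) -> un x <= t.
Proof.
move=> x1 xb; rewrite ge_max x1 (ge_sup (uset0 x))// => _ [b /= b1 <-].
by rewrite (le_trans (xb _))// ler_piMr// (le_trans _ x1)// nr_ge0.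
Qed.

Lemma unD x y : un (x + y) <= un x + un y.
Proof.
apply: un_le => [|b]; first by rewrite (le_trans (nrD _ _))// lerD// un_scalar.
by rewrite uactD (le_trans (nrD _ _))// mulrDl lerD// un_act.
Qed.

Lemma unM x y : un (x * y) <= un x * un y.
Proof.
apply: un_le => [|b].
  by rewrite nrM ler_pM ?nr_ge0 ?un_scalar.
rewrite uactM (le_trans (un_act _ _))// -mulrA ler_wpM2l ?un_ge0//.
exact: un_act.
Qed.

Let unZ_le k x : un (k *: x) <= nr k * un x.
Proof.
apply: un_le => [|b]; first by rewrite nrM ler_wpM2l ?nr_ge0 ?un_scalar.
by rewrite uactZ nrZ -mulrA ler_wpM2l ?nr_ge0// un_act.
Qed.

Lemma unZ k x : un (k *: x) = nr k * un x.
Proof.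
apply/eqP; rewrite eq_le unZ_le/=.
have [->|k0] := eqVneq k 0; first by rewrite nr0 mul0r un_ge0.
have nk : 0 < nr k by rewrite lt_def nr_ge0 andbT; apply: contra_neq k0 => /nr0_eq0.
rewrite -ler_pdivlMl//.
have -> : (nr k)^-1 = nr k^-1.
  have nk0 : nr k != 0 by rewrite gt_eqF.
  by apply: (mulfI nk0); rewrite mulfV// -nrM mulfV// nr1.
by apply: le_trans (unZ_le _ _); rewrite scalerA mulVf// scale1r.
Qed.

Lemma unN x : un (- x) = un x.
Proof. by rewrite -scaleN1r unZ nrN nr1 mul1r. Qed.

Lemma unB x y : un (x - y) <= un x + un y.
Proof. by rewrite -(unN y) unD. Qed.

Lemma un_sub x y : un (x - y) = un (y - x).
Proof. by rewrite -unN opprB. Qed.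

Lemma un0 : un 0 = 0.
Proof. by rewrite -(scale0r 0) unZ nr0 mul0r. Qed.

Lemma un_uin a : un (uin a) = nr a.
Proof.
apply/eqP; rewrite eq_le; apply/andP; split.
  apply: un_le => [|b]; rewrite /= ?nr0 ?nr_ge0//.
  by rewrite /uact /= scale0r add0r nr_cmul.
have := un_act (uin a) (cstar a).
rewrite /uact /= scale0r add0r -{1 2}(cstarK a) cstarK nr_star.
have -> : nr (cmul a (cstar a)) = nr a ^+ 2.
  by rewrite -{1}(cstarK a) nr_starM nr_star.
have [-> _|a0] := eqVneq (nr a) 0; first exact: un_ge0.
by rewrite expr2 ler_pM2r// lt_def a0 nr_ge0.
Qed.

(** For the operator part, [nr (uact x b) ^+ 2] is the norm of [cstar b] times the action of
    [ustar x * x] on [b]; for the scalar part, that of [ustar x * x] has modulus [nr x.1 ^+ 2]. *)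
Let un_starM_le x : un x ^+ 2 <= un (ustar x * x).
Proof.
set t := un (ustar x * x).
have t0 : 0 <= t by exact: un_ge0.
have sq (s r : R) : 0 <= r -> 0 <= s -> s ^+ 2 <= t * r ^+ 2 -> s <= Num.sqrt t * r.
  move=> r0 s0; rewrite -{1}(sqr_sqrtr t0) -exprMn ler_sqr ?nnegrE//.
  by rewrite mulr_ge0// sqrtr_ge0.
rewrite -(sqr_sqrtr t0) ler_sqr ?nnegrE ?un_ge0 ?sqrtr_ge0//.
apply: un_le => [|b].
  rewrite -[leRHS]mulr1; apply: sq; rewrite ?nr_ge0// expr1n mulr1.
  rewrite expr2 -{1}(nr_conj x.1) -nrM; exact: (un_scalar (ustar x * x)).
apply: sq; rewrite ?nr_ge0//.
rewrite -nr_starM uact_star -uactM (le_trans (nr_cmul _ _))// nr_star mulrC.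
by rewrite expr2 mulrA ler_wpM2r ?nr_ge0// un_act.
Qed.

Lemma un_star x : un (ustar x) = un x.
Proof.
suff H y : un y <= un (ustar y) by apply/eqP; rewrite eq_le H -{2}(ustarK x) H.
have [y0|y0] := eqVneq (un y) 0; first by rewrite y0 un_ge0.
have y1 : 0 < un y by rewrite lt_def y0 un_ge0.
by rewrite -(ler_pM2r y1) -expr2 (le_trans (un_starM_le _))// unM.
Qed.

Lemma un_starM x : un (ustar x * x) = un x ^+ 2.
Proof.
by apply/eqP; rewrite eq_le un_starM_le andbT (le_trans (unM _ _))// un_star.
Qed.

Lemma un0_eq0 x : un x = 0 -> x = 0.
Proof.
move=> x0; have x1 : x.1 = 0.
  by apply: nr0_eq0; apply/eqP; rewrite eq_le nr_ge0 andbT -x0 un_scalar.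
by move: x0; rewrite (uinP x1) un_uin => /nr0_eq0 ->.
Qed.

Lemma un1 : un 1 = 1.
Proof.
apply/eqP; rewrite eq_le; apply/andP; split; last first.
  by rewrite -[leLHS](@nr1 R); exact: (un_scalar 1).
apply: un_le => [|b]; first by rewrite /= nr1.
by rewrite /uact /= scale1r cmul0a addr0 mul1r.
Qed.

Lemma un_complete (u : nat -> U) :
  ncauchy (fun m n => un (u m - u n)) ->
  exists l, nnull (fun n => un (u n - l)).
Proof.
move=> cu.
have [l1 H1] : exists l, nnull (fun n => nr ((u n).1 - l)).
  apply: complex_complete => e /cu[M HM]; exists M => m n Mm Mn.
  exact: le_trans (un_scalar (u m - u n)) (HM _ _ Mm Mn).
have un2 x : nr x.2 <= 2 * un x.
  rewrite -un_uin; have -> : uin x.2 = x - x.1 *: 1.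
    by rewrite uscalarE; apply: uext; rewrite /= ?subrr// subr0.
  by rewrite (le_trans (unB _ _))// unZ un1 mulr1 mulr2n mulrDl mul1r lerD2l un_scalar.
have [l2 H2] : exists l, nnull (fun n => nr ((u n).2 - l)).
  apply: nr_complete => e e0.
  have [M HM] := cu (e / 2) ltac:(by rewrite divr_gt0).
  exists M => m n Mm Mn.
  by rewrite (le_trans (un2 (u m - u n)))// -ler_pdivlMl// mulrC HM.
exists (l1, l2) => e e0.
have [M1 HM1] := H1 (e / 2) ltac:(by rewrite divr_gt0).
have [M2 HM2] := H2 (e / 2) ltac:(by rewrite divr_gt0).
exists (maxn M1 M2) => n; rewrite geq_max => /andP[n1 n2].
have -> : u n - (l1, l2) = ((u n).1 - l1) *: 1 + uin ((u n).2 - l2).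
  by rewrite uscalarE; apply: uext; rewrite /= ?addr0// add0r.
rewrite (le_trans (unD _ _))// unZ un1 mulr1 un_uin (splitr e) lerD//.
  exact: HM1.
exact: HM2.
Qed.

End unitization.

(** * Self-adjoint elements and square roots *)

Section order.
Context {R : realType} {A : cStarAlgType R}.
Local Notation U := (unitization A).
Local Notation "t %:u" := (t%:C%C *: (1 : U)) (at level 2, format "t %:u").
Implicit Types (x y z s h w : U) (t : R) (k : R[i]).

Definition usa x := ustar x = x.

Lemma usmall x : (forall e, 0 < e -> un x <= e) -> x = 0.
Proof.
move=> H; apply: un0_eq0; apply/eqP; rewrite eq_le un_ge0 andbT.
by apply/ler_addgt0Pr => e e0; rewrite add0r H.
Qed.

Lemma unZR t x : un (t%:C%C *: x) = `|t| * un x.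
Proof. by rewrite unZ nrR. Qed.

Lemma unr t : un (t%:u) = `|t|.
Proof. by rewrite unZR un1 mulr1. Qed.

Lemma unX2 h : usa h -> un (h * h) = un h ^+ 2.
Proof. by move=> sh; rewrite -{1}sh un_starM. Qed.

Lemma usq0 h : usa h -> h * h = 0 -> h = 0.
Proof.
move=> sh hh; apply: un0_eq0; apply/eqP.
by rewrite -sqrf_eq0 -unX2// hh un0.
Qed.

Lemma ustar_sq0 y : ustar y * y = 0 -> y = 0.
Proof.
by move=> yy; apply: un0_eq0; apply/eqP; rewrite -sqrf_eq0 -un_starM yy un0.
Qed.

Lemma ustarZR t x : ustar (t%:C%C *: x) = t%:C%C *: ustar x.
Proof. by rewrite ustarZ conjR. Qed.

Lemma usaD x y : usa x -> usa y -> usa (x + y).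
Proof. by rewrite /usa ustarD => -> ->. Qed.

Lemma usaN x : usa x -> usa (- x).
Proof. by rewrite /usa ustarN => ->. Qed.

Lemma usaB x y : usa x -> usa y -> usa (x - y).
Proof. by move=> sx sy; apply: usaD => //; apply: usaN. Qed.

Lemma usaZ t x : usa x -> usa (t%:C%C *: x).
Proof. by rewrite /usa ustarZR => ->. Qed.

Lemma usa1 : usa 1.
Proof. exact: ustar1. Qed.

Lemma usar t : usa (t%:u).
Proof. exact/usaZ/usa1. Qed.

Lemma usaX x : usa x -> usa (x * x).
Proof. by rewrite /usa ustarM => ->. Qed.

Lemma usaM x y : usa x -> usa y -> x * y = y * x -> usa (x * y).
Proof. by rewrite /usa ustarM => -> ->. Qed.

Lemma usa_conj x y : usa x -> usa (ustar y * x * y).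
Proof. by rewrite /usa !ustarM ustarK => ->; rewrite mulrA. Qed.

Lemma usa_starM y : usa (ustar y * y).
Proof. by rewrite /usa ustarM ustarK. Qed.

Lemma halfK : 2%:R * (2^-1)%:C%C = 1 :> R[i].
Proof. by rewrite -[2%:R](rmorph_nat (real_complex R)) -rmorphM mulfV. Qed.

Section square_root.
Variable z : U.

(* The iterates converge to [1 - sqrt (1 - z)]; those of the scalar case [z = 1] dominate
   their increments in norm. *)
Fixpoint sqrt_iter n : U :=
  if n is m.+1 then (2^-1)%:C%C *: (z + sqrt_iter m * sqrt_iter m) else 0.

Fixpoint sqrt_bound n : R :=
  if n is m.+1 then 2^-1 * (1 + sqrt_bound m * sqrt_bound m) else 0.

Local Notation w := sqrt_iter.
Local Notation v := sqrt_bound.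

Let v01 n : 0 <= v n <= 1.
Proof.
elim: n => [|n /andP[v0 v1]] /=; first by rewrite lexx ler01.
have := mulr_ge0 v0 v0; have : v n * v n <= 1 by rewrite mulr_ile1.
by move=> *; apply/andP; split; lra.
Qed.

Let v_incr n : v n <= v n.+1.
Proof. by rewrite /=; have := sqr_ge0 (1 - v n); rewrite expr2; nra. Qed.

Let v_mono m n : (m <= n)%N -> v m <= v n.
Proof.
elim: n => [|n IH]; first by rewrite leqn0 => /eqP->.
by rewrite leq_eqVlt => /predU1P[->//|/IH/le_trans]; apply.
Qed.

Let v_cauchy : ncauchy (fun m n => `|v m - v n|).
Proof.
move=> e e0; set S := [set v n | n in setT].
have hS : has_sup S.
  split; first by exists (v 0%N), 0%N.
  by exists 1 => _ [n _ <-]; case/andP: (v01 n).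
have [_ [M _ <-] HM] := sup_adherent e0 hS.
have H n : (M <= n)%N -> sup S - e < v n <= sup S.
  move=> Mn; rewrite (lt_le_trans HM) ?v_mono//=.
  by apply: (ub_le_sup hS.2); exists n.
exists M => m n /H/andP[a b] /H/andP[c d].
by rewrite ler_norml; apply/andP; split; lra.
Qed.

Hypotheses (sz : usa z) (z1 : un z <= 1).

Let w_le n : un (w n) <= v n.
Proof.
elim: n => [|n IH]; first by rewrite /= un0.
rewrite /= unZR ger0_norm ?invr_ge0// ler_wpM2l ?invr_ge0//.
rewrite (le_trans (unD _ _))// lerD// (le_trans (unM _ _))//.
by rewrite ler_pM ?un_ge0.
Qed.

Let w_step n : un (w n.+1 - w n) <= v n.+1 - v n.
Proof.
elim: n => [|n IH].
  rewrite /= mul0r mulr0 subr0 !addr0 subr0 mulr1 unZR ger0_norm ?invr_ge0//.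
  by rewrite ler_piMr ?invr_ge0.
have -> : w n.+2 - w n.+1 = (2^-1)%:C%C *:
   (w n.+1 * (w n.+1 - w n) + (w n.+1 - w n) * w n).
  have H (a b : U) : (2^-1)%:C%C *: (z + a * a) - (2^-1)%:C%C *: (z + b * b) =
    (2^-1)%:C%C *: (a * (a - b) + (a - b) * b).
    rewrite -scalerBr; congr (_ *: _).
    by rewrite opprD addrACA subrr add0r mulrBr mulrBl addrA subrK.
  exact: (H (w n.+1) (w n)).
have -> : v n.+2 - v n.+1 = 2^-1 * (v n.+1 * (v n.+1 - v n) + (v n.+1 - v n) * v n).
  have H (a b : R) : 2^-1 * (1 + a * a) - 2^-1 * (1 + b * b) =
    2^-1 * (a * (a - b) + (a - b) * b) by ring.
  exact: (H (v n.+1) (v n)).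
rewrite unZR ger0_norm ?invr_ge0// ler_wpM2l ?invr_ge0//.
by rewrite (le_trans (unD _ _))// lerD// (le_trans (unM _ _))// ler_pM ?un_ge0.
Qed.

Let w_dist m n : (m <= n)%N -> un (w n - w m) <= v n - v m.
Proof.
elim: n => [|n IH]; first by rewrite leqn0 => /eqP->; rewrite !subrr un0.
rewrite leq_eqVlt => /predU1P[->|/IH H]; first by rewrite !subrr un0.
have -> : w n.+1 - w m = (w n.+1 - w n) + (w n - w m) by rewrite addrA subrK.
have -> : v n.+1 - v m = (v n.+1 - v n) + (v n - v m) by rewrite addrA subrK.
by rewrite (le_trans (unD _ _))// lerD ?w_step.
Qed.

(** The limit satisfies [2 w = z + w^2], which is [(1 - w)^2 = 1 - z]. The iterates are polynomials
    in [z], whence the commutation clause. *)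
Lemma usqrt1B : exists w, [/\ usa w, un w <= 1, (1 - w) * (1 - w) = 1 - z
  & forall y, y * z = z * y -> y * w = w * y].
Proof.
have [l Hl] : exists l : U, nnull (fun n => un (w n - l)).
  apply: un_complete => e /v_cauchy[M HM]; exists M => m n Mm Mn.
  wlog mn : m n Mm Mn / (m <= n)%N => [H|].
    have [/H|/ltnW/H] := leqP m n; first exact.
    by rewrite un_sub; exact.
  rewrite un_sub (le_trans (w_dist mn))// (le_trans (ler_norm _))//.
  exact: HM.
have l1 : un l <= 1.
  apply/ler_addgt0Pr => e /Hl[M HM]; have := HM M (leqnn _).
  rewrite un_sub => H; rewrite -(subrK (w M) l) (le_trans (unD _ _))// addrC.
  by rewrite lerD// (le_trans (w_le _))//; case/andP: (v01 M).
exists l; split=> //.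
- apply/eqP; rewrite -subr_eq0; apply/eqP/usmall => e e0.
  have [M HM] := Hl (e / 2) ltac:(by rewrite divr_gt0).
  have ws n : ustar (w n) = w n.
    elim: n => [|n IH] /=; first by rewrite ustar0.
    by rewrite ustarZR ustarD ustarM IH sz.
  have -> : ustar l - l = ustar (l - w M) + (w M - l).
    by rewrite ustarB ws addrA subrK.
  rewrite (le_trans (unD _ _))// un_star (splitr e) lerD ?HM//.
  by rewrite un_sub HM.
- apply/eqP; rewrite -subr_eq0; apply/eqP/usmall => e e0.
  have [M HM] := Hl (e / 4) ltac:(by rewrite divr_gt0).
  have E : w M * w M = 2%:R *: w M.+1 - z.
    by rewrite /= scalerA halfK scale1r (addrC z) addrK.
  have -> : (1 - l) * (1 - l) - (1 - z) =
     2%:R *: (w M.+1 - l) + (l * (l - w M) + (l - w M) * w M).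
    have -> : l * (l - w M) + (l - w M) * w M = l * l - w M * w M.
      by rewrite mulrBr mulrBl addrA subrK.
    by rewrite E mulrBl mul1r mulrBr mulr1; lmod.
  rewrite (le_trans (unD _ _))// unZ (_ : nr 2%:R = 2); last first.
    by rewrite -[2%:R](rmorph_nat (real_complex R)) nrR ger0_norm.
  have -> : e = 2 * (e / 4) + (1 * (e / 4) + (e / 4) * 1) by field.
  apply: lerD; first by rewrite ler_wpM2l// HM.
  rewrite (le_trans (unD _ _))// lerD// (le_trans (unM _ _))//.
    by rewrite ler_pM ?un_ge0// un_sub HM.
  rewrite ler_pM ?un_ge0//; first by rewrite un_sub HM.
  by rewrite (le_trans (w_le _))//; case/andP: (v01 M).
- move=> y yz; have yw n : y * w n = w n * y.
    elim: n => [|n IH] /=; first by rewrite mulr0 mul0r.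
    by rewrite -scalerAr -scalerAl mulrDr mulrDl yz mulrA IH -mulrA IH mulrA.
  apply/eqP; rewrite -subr_eq0; apply/eqP/usmall => e e0.
  have y1 : 0 < un y + 1 by rewrite ltr_wpDl ?un_ge0.
  have [M HM] := Hl (e / 2 / (un y + 1)) ltac:(by rewrite !divr_gt0).
  have -> : y * l - l * y = y * (l - w M) + (w M - l) * y.
    by rewrite mulrBr mulrBl yw addrA subrK.
  have H (a : R) : 0 <= a -> a <= e / 2 / (un y + 1) -> un y * a <= e / 2.
    move=> a0 ae; rewrite (@le_trans _ _ ((un y + 1) * a))//.
      by rewrite ler_wpM2r// lerDl.
    by rewrite mulrC -ler_pdivlMr.
  rewrite (le_trans (unD _ _))// (splitr e) lerD// (le_trans (unM _ _))//.
    by rewrite H ?un_ge0// un_sub HM.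
  by rewrite mulrC H ?un_ge0// HM.
Qed.

End square_root.
End order.

(** * Positive elements *)

Section positivity.
Context {R : realType} {A : cStarAlgType R}.
Local Notation U := (unitization A).
Local Notation "t %:u" := (t%:C%C *: (1 : U)) (at level 2, format "t %:u").
Implicit Types (x y z s h w : U) (t : R) (k : R[i]).

(** Positivity without the spectrum: for self-adjoint [x] the spectrum lies in [[0, 2t]] exactly
    when this inequality holds. In this form sums of positive elements are positive by the triangle
    inequality. *)
Definition upos x := usa x /\ exists t, un (t%:u - x) <= t.

Lemma upos_sa x : upos x -> usa x.
Proof. by case. Qed.

Lemma uposD x y : upos x -> upos y -> upos (x + y).
Proof.
move=> [sx [t xt]] [sy [t' yt]]; split; first exact: usaD.
exists (t + t'); have -> : (t + t')%:u - (x + y) = (t%:u - x) + (t'%:u - y).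
  by rewrite rmorphD; lmod.
by rewrite (le_trans (unD _ _))// lerD.
Qed.

Lemma uposZ t x : 0 <= t -> upos x -> upos (t%:C%C *: x).
Proof.
move=> t0 [sx [t' xt]]; split; first exact: usaZ.
exists (t * t'); have -> : (t * t')%:u - t%:C%C *: x = t%:C%C *: (t'%:u - x).
  by rewrite rmorphM; lmod.
by rewrite unZR ger0_norm// ler_wpM2l.
Qed.

Lemma uposr t : 0 <= t -> upos (t%:u).
Proof.
by move=> t0; apply: uposZ => //; split; [exact: usa1|exists 1; rewrite scale1r subrr un0].
Qed.

Lemma upos0 : upos 0.
Proof. by rewrite -(scale0r 1); exact: (@uposr 0). Qed.

Lemma upos_ge0 t : upos (t%:u) -> 0 <= t.
Proof.
move=> [_ [t' H]]; move: H; rewrite -scalerBl -rmorphB unr ler_norml.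
by move=> /andP[_]; lra.
Qed.

Lemma upos_norm_sub h : usa h -> upos ((un h)%:u - h).
Proof.
move=> sh; split; first by apply: usaB => //; exact: usar.
by exists (un h); rewrite opprB addrC subrK.
Qed.

(** Rescaling gives [x / t = 1 - z] with [un z <= 1], the case of [usqrt1B]. The witness [t0] is
    raised by one so that it can be inverted. *)
Lemma upos_sqrt x : upos x -> exists s, [/\ upos s, s * s = x
  & forall y, y * x = x * y -> y * s = s * y].
Proof.
move=> [sx [t0 xt0]]; pose t := t0 + 1.
have t00 : 0 <= t0 by rewrite (le_trans _ xt0)// un_ge0.
have tp : 0 < t by rewrite /t ltr_wpDl.
have xt : un (t%:u - x) <= t.
  have -> : t%:u - x = (t0%:u - x) + 1 by rewrite /t rmorphD; lmod.
  by rewrite (le_trans (unD _ _))// un1 lerD.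
pose z := 1 - (t^-1)%:C%C *: x.
have zE : (t^-1)%:C%C *: (t%:u - x) = z.
  by rewrite scalerBr scalerA -rmorphM mulVf ?gt_eqF// scale1r.
have sz : usa z by apply: usaB; [exact: usa1|exact: usaZ].
have z1 : un z <= 1.
  by rewrite -zE unZR gtr0_norm ?invr_gt0// ler_pdivrMl// mulr1.
have [w [sw w1 ww cw]] := usqrt1B sz z1.
exists ((Num.sqrt t)%:C%C *: (1 - w)); split.
- apply: uposZ; first exact: sqrtr_ge0.
  split; first by apply: usaB => //; exact: usa1.
  by exists 1; rewrite scale1r opprB addrC subrK.
- rewrite scale_mull scale_mulr ww scalerA -rmorphM -expr2 sqr_sqrtr ?ltW//.
  by rewrite /z opprB addrC subrK scalerA -rmorphM mulfV ?gt_eqF// scale1r.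
- move=> y yx; rewrite scale_mull scale_mulr; congr (_ *: _).
  have yw : y * w = w * y.
    by apply: cw; rewrite /z; expand; rewrite yx.
  by expand; rewrite yw.
Qed.

Lemma mul_ii : 'i * 'i = -1 :> R[i].
Proof. by rewrite -expr2 sqrCi. Qed.

Lemma halfD (V : lmodType R[i]) (v : V) : (2^-1)%:C%C *: (v + v) = v.
Proof.
by rewrite scalerDr -scalerDl -rmorphD (_ : 2^-1 + 2^-1 = 1 :> R) ?scale1r//; field.
Qed.

(** For commuting [s] and [t] the C*-identity turns the norm of a sum of two squares into that of
    [s + 'i *: t], which dominates the norms of [s] and [t]. This takes the place of spectral
    arguments in the lemmas that follow. *)
Lemma ustarM_cart (s t : U) : usa s -> usa t -> s * t = t * s ->
  ustar (s + 'i *: t) * (s + 'i *: t) = s * s + t * t.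
Proof.
move=> ss st c; rewrite ustarD ustarZ ss st; expand; rewrite c.
by rewrite conjCi !scaleNr scalerA mul_ii scaleN1r; lmod.
Qed.

Lemma un_cart_le (s t : U) : usa s -> usa t -> un s <= un (s + 'i *: t).
Proof.
move=> ss st.
rewrite {1}(_ : s = (2^-1)%:C%C *: ((s + 'i *: t) + ustar (s + 'i *: t))); last first.
  by rewrite ustarD ustarZ ss st conjCi scaleNr addrACA subrr addr0 halfD.
rewrite unZR ger0_norm ?invr_ge0// ler_pdivrMl// mulr_natl mulr2n.
by rewrite (le_trans (unD _ _))// un_star.
Qed.

Lemma un_cart_le2 (s t : U) : usa s -> usa t -> un t <= un (s + 'i *: t).
Proof.
move=> ss st.
have -> : s + 'i *: t = 'i *: (t + 'i *: (- s)).
  by rewrite scalerDr scalerA mul_ii scaleN1r opprK addrC.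
rewrite unZ nri mul1r; apply: un_cart_le => //; exact: usaN.
Qed.

Lemma usum_sq0 (s t : U) : usa s -> usa t -> s * t = t * s -> s * s + t * t = 0 ->
  s = 0 /\ t = 0.
Proof.
move=> ss st c; rewrite -ustarM_cart// => /ustar_sq0 E.
split; apply: un0_eq0; apply/eqP; rewrite eq_le un_ge0 andbT.
  by rewrite (le_trans (un_cart_le ss st))// E un0.
by rewrite (le_trans (un_cart_le2 ss st))// E un0.
Qed.

(** With [s] the square root of [1 - h * h], the element [h + 'i *: s] has norm one, so
    [un s <= 1]. *)
Lemma un_sub_sq h : usa h -> un h <= 1 -> un (1 - h * h) <= 1.
Proof.
move=> sh h1.
have [w [sw w1 ww cw]] := usqrt1B (usaX sh) ltac:(by rewrite unX2// expr_le1// un_ge0).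
pose s := 1 - w; have ss : usa s by apply: usaB => //; exact: usa1.
have hs : h * s = s * h by rewrite /s; expand; rewrite cw// mulrA.
have : un (h + 'i *: s) ^+ 2 = 1.
  by rewrite -un_starM ustarM_cart// ww addrC subrK un1.
move=> /eqP; rewrite sqrf_eq1 => /orP[|] /eqP u1; last first.
  by have := un_ge0 (h + 'i *: s); rewrite u1; lra.
rewrite -ww unX2// expr_le1 ?un_ge0//.
by rewrite -u1 un_cart_le2.
Qed.

Lemma upos_sq h : usa h -> upos (h * h).
Proof.
move=> sh; pose t := un h + 1; have t0 : 0 < t by rewrite ltr_wpDl ?un_ge0.
have h1 : un ((t^-1)%:C%C *: h) <= 1.
  by rewrite unZR gtr0_norm ?invr_gt0// ler_pdivrMl// mulr1 lerDl.
have H := un_sub_sq (usaZ _ sh) h1; split; first exact: usaX.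
exists (t ^+ 2); rewrite -[leRHS]mulr1 -ler_pdivrMl ?exprn_gt0//.
have -> : (t ^+ 2)^-1 * un ((t ^+ 2)%:u - h * h) =
    un ((t ^- 2)%:C%C *: ((t ^+ 2)%:u - h * h)).
  by rewrite unZR ger0_norm// invr_ge0 exprn_ge0 ?ltW.
rewrite scalerBr scalerA -rmorphM mulVf ?expf_neq0 ?gt_eqF// scale1r.
by move: H; rewrite scale_mull scale_mulr scalerA -rmorphM -invfM expr2.
Qed.

(** Square roots [s] of [x] and [t] of [- x] commute and satisfy [s * s + t * t = 0]. *)
Lemma upos_anti x : upos x -> upos (- x) -> x = 0.
Proof.
move=> px px'; have [s [ps sx cs]] := upos_sqrt px.
have [t [pt tx ct]] := upos_sqrt px'.
have xt : x * t = t * x by apply: ct; rewrite mulrN mulNr.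
have st : s * t = t * s by rewrite cs.
have [s0 _] := usum_sq0 (upos_sa ps) (upos_sa pt) st ltac:(by rewrite sx tx subrr).
by rewrite -sx s0 mulr0.
Qed.

Lemma upos_add0 x y : upos x -> upos y -> x + y = 0 -> x = 0.
Proof.
by move=> px py /eqP; rewrite addr_eq0 => /eqP E; apply: upos_anti => //; rewrite E opprK.
Qed.

(** With [y = a + 'i *: b] in Cartesian form this is twice [a * a + b * b]. *)
Lemma upos_sumM y : upos (ustar y * y + y * ustar y).
Proof.
have -> : ustar y * y + y * ustar y = (2^-1)%:C%C *:
  ((y + ustar y) * (y + ustar y) + ('i *: (y - ustar y)) * ('i *: (y - ustar y))).
  rewrite scale_mull scale_mulr scalerA mul_ii scaleN1r.
  by rewrite -[LHS]halfD; congr (_ *: _); ualg.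
apply: uposZ; rewrite ?invr_ge0//; apply: uposD; apply: upos_sq.
  by rewrite /usa ustarD ustarK addrC.
by rewrite /usa ustarZ ustarB ustarK conjCi scaleNr -scalerN opprB.
Qed.

(** The last clause expresses that the absolute value is built from [x] alone; it lets the positive
    and negative parts commute with whatever commutes with [x]. [get] turns an existence statement
    into a function. *)
Definition uabs x : U := get [set m | [/\ upos m, m * m = x * x
  & forall y, y * x = x * y -> y * m = m * y]].

Section jordan.
Variables (x : U) (sx : usa x).

Lemma uabsP : [/\ upos (uabs x), uabs x * uabs x = x * x
  & forall y, y * x = x * y -> y * uabs x = uabs x * y].
Proof.
apply: (@getPex _ [set m | [/\ upos m, m * m = x * x
  & forall y, y * x = x * y -> y * m = m * y]]).
have [m [pm mm cm]] := upos_sqrt (upos_sq sx).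
exists m; split=> // y yx; apply: cm.
by rewrite mulrA yx -mulrA yx mulrA.
Qed.

End jordan.

Definition upp x : U := (2^-1)%:C%C *: (uabs x + x).
Definition unp x : U := (2^-1)%:C%C *: (uabs x - x).

Section jordan_alg.
Variables (x : U) (sx : usa x).
Local Notation m := (uabs x).
Local Notation p := (upp x).
Local Notation n := (unp x).

Let mx : m * x = x * m.
Proof. by have [_ _ H] := uabsP sx; rewrite H. Qed.

Let mm : m * m = x * x.
Proof. by have [] := uabsP sx. Qed.

Let pm : upos m.
Proof. by have [] := uabsP sx. Qed.

Lemma uppB : x = p - n.
Proof.
by rewrite /upp /unp -scalerBr (_ : m + x - (m - x) = x + x) ?halfD//; lmod.
Qed.

Lemma uppD : m = p + n.
Proof.
by rewrite /upp /unp -scalerDr (_ : m + x + (m - x) = m + m) ?halfD//; lmod.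
Qed.

Lemma upp_sa : usa p.
Proof. by apply: usaZ; apply: usaD => //; exact: upos_sa. Qed.

Lemma unp_sa : usa n.
Proof. by apply: usaZ; apply: usaB => //; exact: upos_sa. Qed.

Lemma upp_unp : p * n = 0.
Proof. by rewrite /upp /unp; expand; rewrite mm mx; lmod. Qed.

Lemma unp_upp : n * p = 0.
Proof. by rewrite /upp /unp; expand; rewrite mm mx; lmod. Qed.

Lemma unp_comm y : y * x = x * y -> y * n = n * y.
Proof. by have [_ _ H] := uabsP sx; move=> yx; rewrite /unp; expand; rewrite yx H. Qed.

Lemma mul_unp : x * n = - (n * n).
Proof. by rewrite {1}uppB mulrBl upp_unp sub0r. Qed.

Lemma unp_mul : n * x = - (n * n).
Proof. by rewrite {2}uppB mulrBr unp_upp sub0r. Qed.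

Lemma upp_mul : p * x = p * p.
Proof. by rewrite {2}uppB mulrBr upp_unp subr0. Qed.

(** Since [m * n = n * n], the cube is the square of [s * n] with [s] the square root of [m]. It
    stands in for the positivity of [n], which is available only later. *)
Lemma unp_cube : exists2 k, usa k & n * n * n = k * k.
Proof.
have [s [ps ss cs]] := upos_sqrt pm.
have sn : s * n = n * s.
  by apply: unp_comm; rewrite -cs// mx.
exists (s * n); first by apply: usaM => //; [exact: upos_sa|exact: unp_sa].
have -> : s * n * (s * n) = m * n * n.
  by rewrite mulrA -(mulrA s n s) -sn !mulrA ss.
by have -> : m * n = n * n by rewrite {1}uppD mulrDl upp_unp add0r.
Qed.

End jordan_alg.

(** With [n] the negative part of [h = ustar y * y], the element [v = y * n] has [ustar v * v] equal
    to minus the cube of [n], that is to [- (k * k)]. Showing [v = 0] gives [n = 0]. *)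
Lemma upos_starM y : upos (ustar y * y).
Proof.
set h := ustar y * y; have sh : usa h by exact: usa_starM.
have [k sk kE] := unp_cube sh.
set n := unp h in kE; pose v := y * n.
have sn : usa n by exact: unp_sa.
have vv : ustar v * v = - (k * k).
  rewrite /v ustarM sn mulrA -(mulrA n) -/h -mulrA mul_unp// mulrN mulrA.
  by rewrite -kE.
have pv : upos (v * ustar v).
  have -> : v * ustar v = (ustar v * v + v * ustar v) + k * k.
    by rewrite vv addrAC addNr add0r.
  by apply: uposD; [exact: upos_sumM|exact: upos_sq].
have [s [ps ss _]] := upos_sqrt pv.
(* In place of a comparison of the spectra of [ustar v * v] and [v * ustar v]: both products of [w]
   with [ustar w] are negatives of fourth powers, while their sum is positive. *)
pose w := v * k.
have ww : ustar w * w = - ((k * k) * (k * k)).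
  by rewrite /w ustarM sk mulrA -(mulrA k) vv; expand.
have ww' : w * ustar w = - ((s * s) * (s * s)).
  rewrite /w ustarM sk mulrA -(mulrA v) -{1}[k * k]opprK -vv mulrN mulNr.
  by rewrite ss !mulrA.
have p1 : upos ((k * k) * (k * k)) by apply/upos_sq/usaX.
have p2 : upos ((s * s) * (s * s)) by apply/upos_sq/usaX/upos_sa.
have E : k * k * (k * k) + s * s * (s * s) = 0.
  apply: upos_anti; first exact: uposD.
  by have := upos_sumM w; rewrite ww ww' opprD.
have k0 : k * k = 0.
  by apply: usq0; [exact: usaX|exact: upos_add0 E].
have v0 : v = 0 by apply: ustar_sq0; rewrite vv k0 oppr0.
have n0 : n = 0.
  apply: usq0 => //; apply/eqP; rewrite -oppr_eq0 -mul_unp//.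
  by rewrite /h -mulrA -/v v0 mulr0.
rewrite (uppB h) -/n n0 subr0.
have := uppD h; rewrite -/n n0 addr0 => <-.
by have [] := uabsP sh.
Qed.

Lemma upos_conj x y : upos x -> upos (ustar y * x * y).
Proof.
move=> /upos_sqrt[s [ps <- _]].
have -> : ustar y * (s * s) * y = ustar (s * y) * (s * y).
  by rewrite ustarM (upos_sa ps) !mulrA.
exact: upos_starM.
Qed.

(** With [s] and [r] the square roots of [x] and [t - x], the element [s + 'i *: r] has squared norm
    [t] and dominates [s]. *)
Lemma un_le_pos x t : upos x -> upos (t%:u - x) -> un x <= t.
Proof.
move=> px pt; have t0 : 0 <= t.
  by apply: upos_ge0; rewrite -(subrK x t%:u); exact: uposD.
have [s [ps sx cs]] := upos_sqrt px.
have [r [pr rx cr]] := upos_sqrt pt.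
have sr : s * r = r * s.
  apply: cr; expand; congr (_ - _).
  by rewrite -{2}sx -{1}sx mulrA.
have := @ustarM_cart s r (upos_sa ps) (upos_sa pr) sr.
rewrite sx rx (addrC x) subrK => /(congr1 un); rewrite un_starM unr ger0_norm// => <-.
rewrite -sx unX2; last exact: upos_sa.
rewrite ler_sqr ?nnegrE ?un_ge0//.
by apply: un_cart_le; exact: upos_sa.
Qed.

Lemma un_mono x y : upos x -> upos (y - x) -> un x <= un y.
Proof.
move=> px pxy; apply: un_le_pos => //.
have sy : usa y by rewrite -(subrK x y); apply: usaD; exact: upos_sa.
rewrite -(subrK y (un y)%:u) -addrA; apply: uposD => //.
exact: upos_norm_sub.
Qed.

Lemma un_sub_pos x : upos x -> un x <= 1 -> un (1 - x) <= 1.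
Proof.
move=> px x1; apply: un_le_pos.
  split; first by apply: usaB; [exact: usa1|exact: upos_sa].
  by exists 1; rewrite scale1r opprB addrC subrK.
by rewrite scale1r opprB addrC subrK.
Qed.

(** For [y] the negative part, [y * x^3 * y = - y^5] is positive, and so is [y^5]; hence [y = 0]. *)
Lemma upos_cube x : usa x -> upos (x * x * x) -> upos x.
Proof.
move=> sx p3; pose y := unp x.
have sy : usa y by exact: unp_sa.
have [k sk kE] := unp_cube sx.
have yx : y * x = - (y * y) by exact: unp_mul.
have p5 : upos (y * (y * y * y) * y) by rewrite -{1}sy; apply: upos_conj; rewrite kE; exact: upos_sq.
have : upos (- (y * (y * y * y) * y)).
  have -> : - (y * (y * y * y) * y) = y * (x * x * x) * y.
    have yx' v : v * y * x = - (v * y * y) by rewrite -mulrA yx mulrN mulrA.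
    by rewrite !mulrA yx !mulNr yx' !mulNr opprK yx' !mulNr.
  by rewrite -{1}sy; exact: upos_conj.
move=> /(upos_anti p5) y5.
have y0 : y = 0.
  apply: usq0 => //; apply: usq0; first exact: usaX.
  have y3 : y * y * y = 0.
    apply: usq0; first by rewrite /usa !ustarM sy mulrA.
    by move: y5; rewrite !mulrA => y5; rewrite y5 mul0r.
  by rewrite mulrA y3 mul0r.
have := uppB x; rewrite -/y y0 subr0 => xE.
have := uppD x; rewrite -/y y0 addr0 -xE => <-.
by have [] := uabsP sx.
Qed.

(** The defect [z = y * uabs x - |t| y] satisfies [z * uabs x + |t| z = 0]. Multiplied by [ustar z]
    this is a vanishing sum of two positive elements. The case [t = 0] is computed separately. *)
Lemma uabs_eig y x t : usa x -> y * x = t%:C%C *: y ->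
  y * uabs x = `|t|%:C%C *: y.
Proof.
move=> sx yx; have [pm mm cm] := uabsP sx.
pose z := y * uabs x - `|t|%:C%C *: y.
have zE : z * uabs x + `|t|%:C%C *: z = 0.
  rewrite /z mulrBl -mulrA mm mulrA yx scale_mull yx scale_mull.
  rewrite scalerBr !scalerA -!rmorphM -!expr2 real_normK ?num_real//.
  by rewrite addrA subrK subrr.
have := congr1 (fun v => v * ustar z) zE; rewrite mulrDl mul0r scale_mull => E.
have p1 : upos (z * uabs x * ustar z) by rewrite -{1}(ustarK z); exact: upos_conj.
have p2 : upos (`|t|%:C%C *: (z * ustar z)).
  by apply: uposZ => //; rewrite -{1}(ustarK z); exact: upos_starM.
suff : z = 0 by move=> /eqP; rewrite subr_eq0 => /eqP.
have [t0|t0] := eqVneq t 0.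
  rewrite /z t0 normr0 scale0r subr0.
  suff : ustar (ustar (y * uabs x)) * ustar (y * uabs x) = 0.
    by move=> /ustar_sq0/(congr1 ustar); rewrite ustarK ustar0.
  rewrite ustarK ustarM (upos_sa pm) mulrA -(mulrA y) mm mulrA yx t0 scale0r.
  by rewrite !mul0r.
have : ustar (ustar z) * ustar z = 0.
  rewrite addrC in E; have := upos_add0 p2 p1 E.
  move=> /eqP; rewrite scaler_eq0 ustarK => /orP[|/eqP//].
  by rewrite -(rmorph0 (real_complex R)) (inj_eq (@complexI _)) normr_eq0 (negbTE t0).
by move=> /ustar_sq0/(congr1 ustar); rewrite ustarK ustar0.
Qed.

Lemma upp_eig y x t : usa x -> y * x = t%:C%C *: y ->
  y * upp x = (Num.max t 0)%:C%C *: y.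
Proof.
move=> sx yx; rewrite /upp scale_mulr mulrDr (uabs_eig sx yx) yx.
rewrite -scalerDl scalerA -rmorphD -rmorphM; congr (_%:C%C *: _).
by rewrite maxr_absE subr0 addr0 addrC mulrC.
Qed.

Lemma upp_pos x : usa x -> upos (upp x).
Proof.
move=> sx; apply: upos_cube; first exact: upp_sa.
have [pm _ cm] := uabsP sx.
have -> : upp x * upp x * upp x = upp x * uabs x * upp x.
  rewrite (uppD x) mulrDr upp_unp// addr0 //.
by rewrite -{1}(upp_sa sx); exact: upos_conj.
Qed.

Lemma unpE x : unp x = upp (- x).
Proof. by rewrite /unp /upp /uabs mulrNN; congr (_ *: (get _ - x)); apply/seteqP; split=> m [pm mm cm]; split=> // y; rewrite ?mulrN ?mulNr => H; apply: cm => //; rewrite ?mulrN ?mulNr ?H //; apply: oppr_inj. Qed.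

Lemma unp_pos x : usa x -> upos (unp x).
Proof. by move=> sx; rewrite unpE; apply/upp_pos/usaN. Qed.

(** For [v] the positive part, [v^3 = v * x * v] is at most [t v^2], and [un v ^+ 3] is at most the
    norm of [v^3]. *)
Lemma un_upp x t : usa x -> 0 <= t -> upos (t%:u - x) -> un (upp x) <= t.
Proof.
move=> sx t0 pt; set v := upp x.
have sv : usa v by exact: upp_sa.
have pv : upos v by exact: upp_pos.
have p3 : upos (v * v * v) by rewrite -{1}sv; exact: upos_conj.
have H : un (v * v * v) <= un (t%:C%C *: (v * v)).
  apply: un_mono => //.
  have -> : t%:C%C *: (v * v) - v * v * v = ustar v * (t%:u - x) * v.
    have vx : v * x = v * v by exact: upp_mul.
    by rewrite sv; clearbody v; expand; rewrite vx.
  exact: upos_conj.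
have v3 : un v ^+ 3 <= un (v * v * v).
  have [->|v0] := eqVneq (un v) 0; first by rewrite expr0n un_ge0.
  have v1 : 0 < un v by rewrite lt_def v0 un_ge0.
  rewrite -(ler_pM2r v1) -exprSr (_ : un v ^+ 4 = un ((v * v) * (v * v))).
    by rewrite mulrA unM.
  by rewrite (unX2 (usaX sv)) (unX2 sv) -exprM.
rewrite leNgt; apply/negP => tv; have v1 : 0 < un v by exact: le_lt_trans tv.
move: H; rewrite unZR ger0_norm// unX2// => /(le_trans v3).
by rewrite exprS ler_pM2r ?exprn_gt0// leNgt tv.
Qed.

End positivity.

(** * Minimal projections *)

Section nodes.
Context {R : realType} {A : cStarAlgType R}.
Local Notation U := (unitization A).
Local Notation "t %:u" := (t%:C%C *: (1 : U)) (at level 2, format "t %:u").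
Implicit Types (a b c p q u v x y k : U) (t : R).

Definition inA x := x.1 = 0.

Lemma inAD x y : inA x -> inA y -> inA (x + y).
Proof. by rewrite /inA /= => -> ->; rewrite addr0. Qed.

Lemma inAN x : inA x -> inA (- x).
Proof. by rewrite /inA /= => ->; rewrite oppr0. Qed.

Lemma inAB x y : inA x -> inA y -> inA (x - y).
Proof. by move=> Ax Ay; apply: inAD => //; exact: inAN. Qed.

Lemma inAZ (l : R[i]) x : inA x -> inA (l *: x).
Proof. by rewrite /inA /= => ->; exact: mulr0. Qed.

Lemma inAMl x y : inA y -> inA (x * y).
Proof. by rewrite /inA /= => ->; rewrite mulr0. Qed.

Lemma inAMr x y : inA x -> inA (x * y).
Proof. by rewrite /inA /= => ->; rewrite mul0r. Qed.

Lemma inA_star x : inA x -> inA (ustar x).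
Proof. by rewrite /inA /= => ->; rewrite rmorph0. Qed.

Lemma inA_uin (a : A) : inA (uin a).
Proof. by []. Qed.

Lemma upos_scalar x : upos x -> 0 <= x.1.
Proof.
move=> /upos_sqrt[s [[ss _] <- _]] /=; rewrite -expr2 real_exprn_even_ge0//.
by rewrite CrealE; apply/eqP; exact: (congr1 fst ss).
Qed.

Lemma uabs_scalar x : usa x -> (uabs x).1 = `|x.1|.
Proof.
move=> sx; have [pm mm _] := uabsP sx.
rewrite -(ger0_norm (upos_scalar pm)).
have /eqP := congr1 fst mm; rewrite /= -!expr2 eqf_sqr => /orP[] /eqP ->//.
by rewrite normrN.
Qed.

(** The scalar part is a character of the unitization, so that of [uabs x] is [t] and cancels
    against that of [x]. *)
Lemma inA_upp x t : usa x -> 0 <= t -> x.1 = - t%:C%C -> inA (upp x).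
Proof.
move=> sx t0 xt; rewrite /inA /= uabs_scalar// xt normrN ger0_norm ?ler0c//.
by rewrite subrr; exact: mulr0.
Qed.

Lemma inA_unp x : usa x -> inA x -> inA (unp x).
Proof.
move=> sx Ax; rewrite unpE; apply: (@inA_upp _ 0) => //; first exact: usaN.
by rewrite /= Ax.
Qed.

(* [trunc k t] is [min (k / t) 1]. *)
Definition trunc k t : U := (t^-1)%:C%C *: (k - upp (k - t%:u)).

Section truncation.
Variables (k : U) (t : R) (Ak : inA k) (pk : upos k) (t0 : 0 < t).
Local Notation x := (k - t%:u).
Local Notation p := (upp x).
Local Notation n := (unp x).
Local Notation c := (trunc k t).

Lemma usa_shift : usa x.
Proof. by apply: usaB; [exact: upos_sa|exact: usar]. Qed.

Let sx := usa_shift.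

Lemma inA_shift : inA p.
Proof.
apply: (inA_upp sx (ltW t0)); rewrite /= Ak add0r; congr (- _).
exact: mulr1.
Qed.

Lemma trunc_inA : inA c.
Proof. by apply/inAZ/inAB => //; exact: inA_shift. Qed.

Lemma trunc_usa : usa c.
Proof. by apply/usaZ/usaB; [exact: upos_sa|exact: upp_sa]. Qed.

Let kE : k = t%:u + p - n.
Proof. by rewrite -addrA -uppB addrC subrK. Qed.

Lemma truncE : c = 1 - (t^-1)%:C%C *: n.
Proof.
rewrite /trunc; have -> : k - p = t%:u - n by rewrite {1}kE; lmod.
by rewrite scalerBr scalerA -rmorphM mulVf ?gt_eqF// scale1r.
Qed.

Let un_n : un n <= t.
Proof.
rewrite unpE; apply: un_upp; [exact: usaN|exact: ltW|].
by rewrite opprK addrC subrK.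
Qed.

Let pn : upos ((t^-1)%:C%C *: n).
Proof. by apply: uposZ; [rewrite invr_ge0 ltW|exact: unp_pos]. Qed.

Lemma trunc_un : un c <= 1.
Proof.
rewrite truncE; apply: un_sub_pos => //.
by rewrite unZR gtr0_norm ?invr_gt0// ler_pdivrMl// mulr1.
Qed.

Lemma trunc_fix : c * p = p.
Proof. by rewrite truncE mulrBl mul1r scale_mull unp_upp// scaler0 subr0. Qed.

Lemma trunc_dist : un (k - p) <= t.
Proof.
have -> : k - p = t%:C%C *: c.
  by rewrite /trunc scalerA -rmorphM mulfV ?gt_eqF// scale1r.
by rewrite unZR gtr0_norm// ler_piMr ?trunc_un// ltW.
Qed.

Lemma shift_neq0 : t < un k -> p != 0.
Proof.
move=> tk; apply/eqP => p0; suff : un k <= t by rewrite leNgt tk.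
apply: un_le_pos => //.
by have -> : t%:u - k = n; [rewrite {1}kE p0; lmod|exact: unp_pos].
Qed.

Lemma shift_annihil y : y * k = 0 -> y * p = 0.
Proof.
move=> yk; rewrite (@upp_eig _ _ y x (- t))//.
  by rewrite max_r ?scale0r// oppr_le0 ltW.
by rewrite mulrBr yk sub0r scale_mulr mulr1 rmorphN scaleNr.
Qed.

Lemma shift_annihil_neg y : y * k = 0 -> y * n = t%:C%C *: y.
Proof.
move=> yk; rewrite unpE (@upp_eig _ _ y (- x) t) ?max_l ?ltW//; first exact: usaN.
by rewrite opprB mulrBr yk subr0 scale_mulr mulr1.
Qed.

Lemma trunc_annihil y : y * k = 0 -> y * c = 0.
Proof.
by move=> yk; rewrite /trunc scale_mulr mulrBr yk shift_annihil// subrr scaler0.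
Qed.

(** Where [c] acts as a unit, [k] is at least [t]: [q * k * q] is the sum of the positive elements
    [t q] and [q * p * q]. *)
Lemma trunc_proj q : usa q -> q * q = q -> c * q = q -> q * k * q = 0 -> q = 0.
Proof.
move=> sq qq cq qkq.
have kE' : k = t%:C%C *: c + p.
  by rewrite /trunc scalerA -rmorphM mulfV ?gt_eqF// scale1r subrK.
have qE : q * k * q = t%:C%C *: q + ustar q * p * q.
  by rewrite {1}kE' mulrDr mulrDl scale_mulr scale_mull -mulrA cq qq sq.
have pq : upos q by rewrite -qq -{1}sq; exact: upos_starM.
have := @upos_add0 _ _ (t%:C%C *: q) (ustar q * p * q).
move=> /(_ (uposZ (ltW t0) pq) (upos_conj _ (upp_pos sx))).
rewrite -qE => /(_ qkq)/eqP; rewrite scaler_eq0 => /orP[|/eqP//].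
by rewrite -(rmorph0 (real_complex R)) (inj_eq (@complexI _)) gt_eqF.
Qed.

End truncation.

(** Takes the place of a nonzero projection, of which an algebra may have none: [c] is a left unit
    on a nonzero right ideal. A node [c'] with [c * c' = c'] is thought of as lying below [c]. *)
Definition node c :=
  [/\ inA c, usa c, un c <= 1 & exists b, [/\ inA b, b != 0 & c * b = b]].

Definition minproj p :=
  [/\ inA p, usa p, p * p = p, p != 0
    & forall x, inA x -> exists l : R[i], p * x * p = l *: p].

Lemma un_neq0 x : x != 0 -> 0 < un x.
Proof.
by move=> x0; rewrite lt_def un_ge0 andbT; apply: contra_neq x0 => /un0_eq0.
Qed.

(** Truncation at half the norm. The second clause transports relations [y * k = 0] to [c]; the
    third ensures that projections found below [c] are not annihilated by [k]. *)
Lemma node_below k : inA k -> upos k -> k != 0 -> exists c,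
  [/\ node c, (forall y, y * k = 0 -> y * c = 0)
    & forall q, usa q -> q * q = q -> c * q = q -> q * k * q = 0 -> q = 0].
Proof.
move=> Ak pk k0; have t0 : 0 < un k / 2 by rewrite divr_gt0// un_neq0.
exists (trunc k (un k / 2)); split.
- split; [exact: trunc_inA|exact: trunc_usa|exact: trunc_un|].
  exists (upp (k - (un k / 2)%:u)); split; [exact: inA_shift| |exact: trunc_fix].
  by apply: shift_neq0 => //; rewrite gtr_pMr ?un_neq0// invf_lt1// ltr1n.
- by move=> y; exact: trunc_annihil.
- by move=> q; exact: trunc_proj.
Qed.

Definition splits a := exists c : U * U, [/\ node c.1, node c.2, a * c.1 = c.1,
  a * c.2 = c.2 & c.1 * c.2 = 0].

Lemma proj_un q : usa q -> q * q = q -> un q <= 1.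
Proof.
move=> sq qq; have := unX2 sq; rewrite qq => E.
have [->//|q0] := eqVneq (un q) 0.
have : 0 < un q by rewrite lt_def q0 un_ge0.
by move=> q1; rewrite -(ler_pM2r q1) mul1r -expr2 -E.
Qed.

Section unsplittable.
Variables (a : U) (Na : node a) (nS : ~ splits a).

Let below x : a * x = x <-> (a - 1) * x = 0.
Proof.
by rewrite mulrBl mul1r; split => [->|/eqP]; rewrite ?subrr// subr_eq0 => /eqP.
Qed.

(** For [t < 1] let [p] and [n] be the positive and negative parts of [k - t]. Nodes under [p] and
    under [n * k * n] would split [a], so [n * k * n = 0] and [k * (k - t) = k * p] has norm at most
    [1 - t]. Then [t] tends to one. *)
Lemma unsplittable_proj k : inA k -> upos k -> un k = 1 -> a * k = k -> k * k = k.
Proof.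
move=> Ak pk k1 ak; have sk := upos_sa pk.
have key t : 0 < t < 1 -> un (k * (k - 1)) <= 2 * (1 - t).
  move=> /andP[t0 t1]; set x := k - t%:u.
  have sx : usa x by exact: usa_shift.
  set p := upp x; set n := unp x.
  have p0 : p != 0 by apply: shift_neq0; rewrite ?k1.
  have Ap : inA p by exact: inA_shift.
  have pp : upos p by exact: upp_pos.
  have sn : usa n by exact: unp_sa.
  have pn : p * n = 0 by exact: upp_unp.
  have kn : k * n = 0.
    have [k''0|k''0] := eqVneq (n * k * n) 0.
      have [s [ps ss _]] := upos_sqrt pk.
      have : ustar (s * n) * (s * n) = 0.
        by rewrite ustarM sn (upos_sa ps) mulrA -(mulrA n) ss.
      by move=> /ustar_sq0 sn0; rewrite -ss -mulrA sn0 mulr0.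
    exfalso; apply: nS.
    have [c0 [Nc0 c0k _]] := node_below Ap pp p0.
    (* [n] has scalar part [t]; compressing [k] by it gives an element of [A] that is still fixed by
       [a] from the left. *)
    have [c1 [Nc1 c1k _]] : exists c, [/\ node c,
        (forall y, y * (n * k * n) = 0 -> y * c = 0)
        & forall q, usa q -> q * q = q -> c * q = q -> q * (n * k * n) * q = 0 -> q = 0].
      apply: node_below => //; first by rewrite -mulrA; apply/inAMl/inAMr.
      by rewrite -{1}sn; exact: upos_conj.
    have a1k : (a - 1) * k = 0 by apply/below.
    have sc0 : usa c0 by case: Nc0.
    have sc1 : usa c1 by case: Nc1.
    exists (c0, c1); split=> //=.
    - by apply/below/c0k; exact: shift_annihil.
    - apply/below/c1k; rewrite mulrA mulrA (shift_annihil_neg pk t0 a1k).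
      by rewrite scale_mull a1k scaler0 mul0r.
    - have : p * c1 = 0 by apply: c1k; rewrite !mulrA pn !mul0r.
      move=> /(congr1 ustar); rewrite ustarM ustar0 sc1 (upos_sa pp).
      by move=> /c0k/(congr1 ustar); rewrite ustarM ustar0 sc1 sc0.
  have -> : k * (k - 1) = k * p - (1 - t)%:C%C *: k.
    have -> : k * p = k * x by rewrite (uppB x) mulrBr kn subr0.
    by rewrite /x rmorphB; ualg.
  rewrite (le_trans (unB _ _))// mulr2n mulrDl mul1r lerD//; last first.
    by rewrite unZR k1 mulr1 ger0_norm// subr_ge0 ltW.
  rewrite (le_trans (unM _ _))// k1 mul1r un_upp ?subr_ge0 ?(ltW t1)//.
  have -> : (1 - t)%:u - x = (un k)%:u - k by rewrite /x k1 rmorphB; lmod.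
  exact: upos_norm_sub.
apply/eqP; rewrite -subr_eq0 -[X in _ - X]mulr1 -mulrBr; apply/eqP/usmall => e e0.
pose d := Num.min (e / 2) (1 / 2).
have d0 : 0 < d by rewrite lt_min !divr_gt0.
have d1 : d <= 1 / 2 by rewrite ge_min lexx orbT.
have de : d <= e / 2 by rewrite ge_min lexx.
by apply: le_trans (key (1 - d) _) _; [apply/andP; split; lra|lra].
Qed.

(** Normalised, [b * ustar b] is a projection [p]. A positive norm-one [z] with [p * z = z] is a
    projection as well and equals [p], for otherwise [z] and [p - z] would split [a]; hence [p A p]
    is one-dimensional. *)
Lemma unsplittable_minproj : exists p, minproj p /\ a * p = p.
Proof.
have [Aa sa a1 [b [Ab b0 ab]]] := Na.
pose k := b * ustar b.
have pk : upos k by rewrite /k -{1}(ustarK b); exact: upos_starM.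
have k0 : k != 0.
  apply: contra_neq b0 => k0; rewrite -(ustarK b).
  by rewrite (@ustar_sq0 _ _ (ustar b)) ?ustar0// ustarK.
have nk := un_neq0 k0.
pose p := ((un k)^-1)%:C%C *: k.
have un_p : un p = 1 by rewrite unZR gtr0_norm ?invr_gt0// mulVf// gt_eqF.
have ap : a * p = p by rewrite scale_mulr /k mulrA ab.
have Ap : inA p by apply/inAZ/inAMr.
have pp : upos p by apply: uposZ => //; rewrite invr_ge0 ltW.
have sp := upos_sa pp.
have p2 : p * p = p by exact: unsplittable_proj.
have p0 : p != 0 by apply/eqP => p0; move: un_p; rewrite p0 un0 => /eqP; rewrite eq_sym oner_eq0.
clearbody p => {k pk k0 nk}.
have corner z : inA z -> upos z -> un z = 1 -> p * z = z -> z = p.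
  move=> Az pz z1 pz'; have sz := upos_sa pz.
  have zp : z * p = z by have := congr1 ustar pz'; rewrite ustarM sp sz.
  have z2 : z * z = z by apply: unsplittable_proj => //; rewrite -pz' mulrA ap.
  have z0 : z != 0 by apply/eqP => z0; move: z1; rewrite z0 un0 => /eqP; rewrite eq_sym oner_eq0.
  have [/eqP|q0] := eqVneq (p - z) 0; first by rewrite subr_eq0 => /eqP.
  exfalso; apply: nS; exists (z, p - z); split => /=.
  - by split=> //; [rewrite z1|exists z].
  - have q2 : (p - z) * (p - z) = p - z.
      by rewrite mulrBl !mulrBr p2 pz' zp z2 subrr subr0.
    split; [exact: inAB|exact: usaB|apply: proj_un => //; exact: usaB|].
    by exists (p - z); split=> //; exact: inAB.
  - by rewrite -pz' mulrA ap.
  - by rewrite mulrBr ap -{1}pz' mulrA ap pz'.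
  - by rewrite mulrBr zp z2 subrr.
(* Adding [un y] times [p] makes the corner element [y] positive, hence zero or, after
   normalisation, equal to [p]. *)
have sacase x : inA x -> usa x -> exists t, p * x * p = t%:C%C *: p.
  move=> Ax sx; set y := p * x * p; have sy : usa y.
    by have := @usa_conj _ _ x p sx; rewrite sp.
  have py : p * y = y by rewrite /y !mulrA p2.
  have yp : y * p = y by rewrite /y -!mulrA p2.
  pose z := (un y)%:C%C *: p + y.
  have pz : upos z.
    have -> : z = ustar p * ((un y)%:u + y) * p.
      by rewrite sp mulrDr mulrDl scale_mulr scale_mull mulr1 p2 py yp.
    apply: upos_conj; have := upos_norm_sub (usaN sy).
    by rewrite unN opprK.
  have Az : inA z by apply: inAD; [exact: inAZ|apply/inAMr/inAMr].
  have pz' : p * z = z by rewrite mulrDr scale_mulr p2 py.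
  have [z0|z0] := eqVneq z 0.
    exists (- un y); rewrite rmorphN scaleNr; apply/eqP.
    by rewrite -addr_eq0 addrC; exact/eqP.
  have nz := un_neq0 z0.
  have : ((un z)^-1)%:C%C *: z = p.
    apply: corner; [exact: inAZ| | |by rewrite scale_mulr pz'].
      by apply: uposZ => //; rewrite invr_ge0 ltW.
    by rewrite unZR gtr0_norm ?invr_gt0// mulVf// gt_eqF.
  move=> /(congr1 (fun v => (un z)%:C%C *: v)).
  rewrite scalerA -rmorphM mulfV ?gt_eqF// scale1r => zE.
  by exists (un z - un y); rewrite rmorphB scalerBl -zE /z addrC addKr.
exists p; split=> //; split=> // x Ax.
have [t Ht] := sacase (x + ustar x) ltac:(by apply: inAD => //; exact: inA_star)
  ltac:(by rewrite /usa ustarD ustarK addrC).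
have [r Hr] := sacase ('i *: (x - ustar x))
  ltac:(by apply/inAZ/inAB => //; exact: inA_star)
  ltac:(by rewrite /usa ustarZ ustarB ustarK conjCi scaleNr -scalerN opprB).
exists ((2^-1)%:C%C * (t%:C%C - 'i * r%:C%C)).
have -> : x = (2^-1)%:C%C *: ((x + ustar x) - 'i *: ('i *: (x - ustar x))).
  by rewrite scalerA mul_ii scaleN1r opprK -[LHS]halfD; congr (_ *: _); lmod.
rewrite scale_mulr scale_mull mulrBr mulrBl Ht scale_mulr scale_mull Hr.
by rewrite -scalerA; congr (_ *: _); lmod.
Qed.

End unsplittable.
End nodes.

(** * Orthogonal sequences in algebras that are not atomic *)

Section combs.
Context {R : realType} {A : cStarAlgType R}.
Local Notation U := (unitization A).
Local Notation "t %:u" := (t%:C%C *: (1 : U)) (at level 2, format "t %:u").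
Implicit Types (a b c p q u v x y k : U) (t : R).

(** The whole ideal generated by the minimal projections, so that it absorbs the multiplications by
    projections in [minproj_seq]. *)
Inductive minspan : U -> Prop :=
| minspan0 : minspan 0
| minspan_add y u p v : minspan y -> minproj p -> minspan (y + u * p * v).

Lemma minspanD x y : minspan x -> minspan y -> minspan (x + y).
Proof.
move=> mx; elim=> [|{}y u p v my IH mp]; first by rewrite addr0.
by rewrite addrA; exact: minspan_add.
Qed.

Lemma minspanMl u x : minspan x -> minspan (u * x).
Proof.
elim=> [|{}x w p v mx IH mp]; first by rewrite mulr0; exact: minspan0.
by rewrite mulrDr !mulrA; exact: minspan_add.
Qed.

Lemma minspanMr u x : minspan x -> minspan (x * u).
Proof.
elim=> [|{}x w p v mx IH mp]; first by rewrite mul0r; exact: minspan0.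
by rewrite mulrDl -mulrA; exact: minspan_add.
Qed.

Lemma minspanZ (l : R[i]) x : minspan x -> minspan (l *: x).
Proof. by move=> mx; rewrite -[x]mul1r -scale_mull; exact: minspanMl. Qed.

Lemma minspanB x y : minspan x -> minspan y -> minspan (x - y).
Proof. by move=> mx my; apply: minspanD => //; rewrite -scaleN1r; exact: minspanZ. Qed.

Lemma minspan_proj p : minproj p -> minspan p.
Proof.
move=> mp; rewrite -[p]mulr1 -{1}[p]mul1r -[X in minspan X]add0r.
by apply: minspan_add => //; exact: minspan0.
Qed.

Definition approx x := forall e, 0 < e -> exists2 y, minspan y & un (x - y) <= e.

Lemma approxD x y : approx x -> approx y -> approx (x + y).
Proof.
move=> ax ay e e0; have e2 : 0 < e / 2 by rewrite divr_gt0.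
have [x' mx xx] := ax _ e2; have [y' my yy] := ay _ e2.
exists (x' + y'); first exact: minspanD.
by rewrite opprD addrACA (splitr e) (le_trans (unD _ _))// lerD.
Qed.

Lemma approxZ (l : R[i]) x : approx x -> approx (l *: x).
Proof.
move=> ax e e0; have l0 : 0 < nr l + 1 by rewrite ltr_wpDl ?nr_ge0.
have [y my xy] := ax (e / (nr l + 1)) ltac:(by rewrite divr_gt0).
exists (l *: y); first exact: minspanZ.
rewrite -scalerBr unZ (@le_trans _ _ ((nr l + 1) * un (x - y)))//.
  by rewrite ler_wpM2r ?un_ge0// lerDl.
by rewrite mulrC -ler_pdivlMr.
Qed.

Definition scattered := forall a, node a -> exists p, minproj p /\ a * p = p.

Definition atomic := forall x, inA x -> approx x.

Definition comb (a c : nat -> U) :=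
  [/\ forall n, [/\ inA (a n), usa (a n) & un (a n) <= 1],
      forall n, node (c n),
      forall m n, m != n -> c m * c n = 0,
      forall m n, (m < n)%N -> a m * c n = c n
    & forall m n, (m <= n)%N -> a n * c m = 0].

Definition bad a := node a /\ ~ exists p, minproj p /\ a * p = p.

(** A node that does not split dominates a minimal projection, so a bad one splits; a minimal
    projection below a half would be below the whole, so the halves are bad again. *)
Lemma bad_split : exists f : U -> U * U, forall a, bad a ->
  [/\ bad (f a).1, bad (f a).2, a * (f a).1 = (f a).1, a * (f a).2 = (f a).2
    & (f a).1 * (f a).2 = 0].
Proof.
suff /choice[f Hf] : forall a, exists c : U * U, bad a ->
  [/\ bad c.1, bad c.2, a * c.1 = c.1, a * c.2 = c.2 & c.1 * c.2 = 0].
  by exists f.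
move=> a.
have [[Na nb]|] := pselect (bad a); last by move=> nb; exists (0, 0).
have [[c [N1 N2 a1 a2 c12]]|nS] := pselect (splits a); last first.
  by case: nb; exact: unsplittable_minproj.
exists c => _; split=> //; split=> // -[p [mp cp]]; apply: nb; exists p; split=> //.
  by rewrite -cp mulrA a1.
by rewrite -cp mulrA a2.
Qed.

(** Descend through the first halves and keep the second halves as [c]. The shift in [b n = s n.+1]
    makes [b n] annihilate [c n] itself. *)
Lemma comb_of_bad a : bad a -> exists b c : nat -> U, comb b c.
Proof.
move=> ba; have [f Hf] := bad_split.
pose s n := iter n (fun x => (f x).1) a.
have bs n : bad (s n) by elim: n => // n IH; have [] := Hf _ IH.
have sn n : usa (s n) by case: (bs n) => -[].
pose b n := s n.+1; pose c n := (f (s n)).2.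
have bc n : bad (c n) by have [] := Hf _ (bs n).
have cn n : usa (c n) by case: (bc n) => -[].
have ss m n : (m <= n)%N -> s m * s n.+1 = s n.+1.
  elim: n => [|n IH]; first by rewrite leqn0 => /eqP->; have [] := Hf _ (bs 0%N).
  rewrite leq_eqVlt => /predU1P[->|]; first by have [] := Hf _ (bs n.+1).
  rewrite ltnS => /IH; have [_ _ E _ _] := Hf _ (bs n.+1).
  by rewrite -[s n.+2]E mulrA => ->.
have sc m n : (m <= n)%N -> s m * c n = c n.
  case: n => [|n]; first by rewrite leqn0 => /eqP->; have [] := Hf _ (bs 0%N).
  have [_ _ _ E _] := Hf _ (bs n.+1).
  rewrite leq_eqVlt => /predU1P[->//|mn].
  by rewrite -[c _]E mulrA ss.
have bc0 m n : (m <= n)%N -> s n.+1 * c m = 0.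
  move=> mn; have [_ _ _ _ E] := Hf _ (bs m).
  have := ss m.+1 n; move: mn; rewrite leq_eqVlt => /predU1P[<- _//|mn /(_ mn) E2].
  have : s n.+1 * s m.+1 = s n.+1.
    by have := congr1 ustar E2; rewrite ustarM !sn.
  by move=> <-; rewrite -mulrA E mulr0.
have cc m n : (m < n)%N -> c m * c n = 0.
  case: n => // n mn; rewrite -(sc n.+1 n.+1 (leqnn _)) mulrA.
  have := congr1 ustar (bc0 m n mn); rewrite ustarM ustar0 sn cn => ->.
  by rewrite mul0r.
exists b, c; split.
- by move=> n; have [[]] := bs n.+1.
- by move=> n; have [] := bc n.
- move=> m n; rewrite neq_ltn => /orP[/cc//|/cc/(congr1 ustar)].
  by rewrite ustarM ustar0 !cn.
- by move=> m n mn; exact: sc.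
- by move=> m n mn; exact: bc0.
Qed.

Lemma not_atomic_pos : ~ atomic -> exists k, [/\ inA k, upos k & ~ approx k].
Proof.
move=> nA; apply: contrapT => nk; apply: nA => x Ax.
have H y : inA y -> upos y -> approx y.
  by move=> Ay py; apply: contrapT => ny; apply: nk; exists y.
have sacase y : inA y -> usa y -> approx y.
  move=> Ay sy; rewrite (uppB y) -scaleN1r; apply: approxD.
    by apply: H; [apply: (@inA_upp _ _ _ 0) => //; rewrite Ay rmorph0 oppr0|exact: upp_pos].
  by apply/approxZ/H; [exact: inA_unp|exact: unp_pos].
have -> : x = (2^-1)%:C%C *: ((x + ustar x) + (- 'i) *: ('i *: (x - ustar x))).
  rewrite scalerA mulNr mul_ii opprK scale1r -[LHS]halfD; congr (_ *: _); lmod.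
apply/approxZ/approxD.
  by apply: sacase; [apply: inAD => //; exact: inA_star|rewrite /usa ustarD ustarK addrC].
apply/approxZ/sacase; first by apply/inAZ/inAB => //; exact: inA_star.
by rewrite /usa ustarZ ustarB ustarK conjCi scaleNr -scalerN opprB.
Qed.

(** The shifted positive part [k'] of an element without approximations is not in [minspan], and the
    truncation [a] is a unit for it. If [Q] is a projection in [minspan], then
    [(1 - Q) * k' * (1 - Q)] cannot vanish, so a minimal projection orthogonal to [Q] lies below
    it. *)
Lemma minproj_seq : scattered -> ~ atomic -> exists a (p : nat -> U),
  [/\ [/\ inA a, usa a & un a <= 1], forall n, minproj (p n),
      forall n, a * p n = p n & forall m n, m != n -> p m * p n = 0].
Proof.
move=> sc /not_atomic_pos[k [Ak pk /existsNP[e /not_implyP[e0 He]]]].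
have e20 : 0 < e / 2 by rewrite divr_gt0.
pose k' := upp (k - (e / 2)%:u); pose a := trunc k (e / 2).
have sk' : usa k' by apply: upp_sa; exact: usa_shift.
have pk' : upos k' by apply: upp_pos; exact: usa_shift.
have Ak' : inA k' by exact: inA_shift.
have nk' : ~ minspan k'.
  move=> mk'; apply: He; exists k' => //.
  by rewrite (le_trans (trunc_dist _ _))// ler_pdivrMr// ler_pMr// ler1n.
have Aa : inA a by exact: trunc_inA.
have sa : usa a by exact: trunc_usa.
have a1 : un a <= 1 by exact: trunc_un.
have ak' : a * k' = k' by exact: trunc_fix.
pose good Q := [/\ usa Q, Q * Q = Q, minspan Q, a * Q = Q & inA Q].
have [f Hf] : exists f : U -> U, forall Q, good Q ->
    [/\ minproj (f Q), a * f Q = f Q & Q * f Q = 0].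
  suff /choice[f Hf] : forall Q, exists p, good Q ->
    [/\ minproj p, a * p = p & Q * p = 0] by exists f.
  move=> Q.
  have [[sQ QQ mQ aQ AQ]|] := pselect (good Q); last by move=> nb; exists 0.
  pose r := 1 - Q; have sr : usa r by apply: usaB => //; exact: usa1.
  pose z := r * k' * r.
  have zE : z = k' - (Q * k' + k' * Q - Q * k' * Q) by rewrite /z /r; ualg.
  have z0 : z != 0.
    apply/eqP; rewrite zE => /eqP; rewrite subr_eq0 => /eqP E; apply: nk'; rewrite E.
    apply: minspanB; [apply: minspanD|].
    - exact: minspanMr.
    - exact: minspanMl.
    - by rewrite -mulrA; exact: minspanMr.
  have Az : inA z by apply/inAMr/inAMl.
  have pz : upos z by rewrite /z -{1}sr; exact: upos_conj.
  have [c [Nc zc _]] := node_below Az pz z0.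
  have [p [mp cp]] := sc c Nc.
  exists p => _; split=> //.
    rewrite -cp mulrA; congr (_ * _); apply/eqP; rewrite -subr_eq0 -{2}[c]mul1r -mulrBl.
    apply/eqP/zc; rewrite mulrBl mul1r zE !(mulrBr, mulrDr, mulrA) aQ ak'.
    by rewrite subrr.
  by rewrite -cp mulrA zc ?mul0r// zE !(mulrBr, mulrDr, mulrA) QQ; lmod.
have g0 : good 0 by split=> //; rewrite ?mulr0 ?ustar0//; [exact: ustar0|exact: minspan0].
have gS Q : good Q -> good (Q + f Q).
  move=> gQ; have [mp ap Qp] := Hf Q gQ; have [sQ QQ mQ aQ AQ] := gQ.
  have [Ap sp pp _ _] := mp.
  have pQ : f Q * Q = 0 by have := congr1 ustar Qp; rewrite ustarM ustar0 sQ sp.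
  split; [exact: usaD| | |by rewrite mulrDr aQ ap|exact: inAD].
    by rewrite mulrDl !mulrDr QQ Qp pQ pp addr0 add0r.
  by apply: minspanD => //; exact: minspan_proj.
pose Q n := iter n (fun Q => Q + f Q) 0.
have gQ n : good (Q n) by elim: n => // n IH; exact: gS.
have pQ i n : (i < n)%N -> f (Q i) * Q n = f (Q i).
  elim: n => // n IH; rewrite ltnS leq_eqVlt => /predU1P[->|/IH E].
    have [mp _ Qp] := Hf _ (gQ n); have [_ sp pp _ _] := mp.
    have [sQ _ _ _ _] := gQ n.
    rewrite [Q n.+1]/= mulrDr pp.
    by have := congr1 ustar Qp; rewrite ustarM ustar0 sQ sp => ->; rewrite add0r.
  have [_ _ Qp] := Hf _ (gQ n).
  by rewrite [Q n.+1]/= mulrDr E -{2}E -mulrA Qp mulr0 addr0.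
have pp i n : (i < n)%N -> f (Q i) * f (Q n) = 0.
  by move=> /pQ E; have [_ _ Qp] := Hf _ (gQ n); rewrite -E -mulrA Qp mulr0.
exists a, (fun n => f (Q n)); split=> // [n|n|m n].
- by have [] := Hf _ (gQ n).
- by have [] := Hf _ (gQ n).
- rewrite neq_ltn => /orP[/pp//|/pp/(congr1 ustar)].
  have [[_ sn _ _ _] _ _] := Hf _ (gQ n); have [[_ sm _ _ _] _ _] := Hf _ (gQ m).
  by rewrite ustarM ustar0 sn sm.
Qed.

Lemma not_atomic_comb : ~ atomic -> exists b c : nat -> U, comb b c.
Proof.
move=> nA; have [sc|nsc] := pselect scattered; last first.
  have [a /not_implyP[Na nb]] := (existsNP _).2 nsc.
  exact: (@comb_of_bad a).
have [a [p [[Aa sa a1] mp ap pp]]] := minproj_seq sc nA.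
have sp n : usa (p n) by have [] := mp n.
have pa n : p n * a = p n by have := congr1 ustar (ap n); rewrite ustarM sa sp.
pose Q n := \sum_(i < n.+1) p i.
have sQ n : usa (Q n).
  rewrite /Q; elim: n.+1 => [|m IH]; first by rewrite big_ord0; exact: ustar0.
  by rewrite big_ord_recr; exact: usaD.
have Qp m n : (n < m.+1)%N -> Q m * p n = p n.
  move=> nm; rewrite /Q mulr_suml (bigD1 (Ordinal nm))//= big1 ?addr0.
    by have [] := mp n.
  by move=> i /eqP ni; apply: pp; apply/eqP => E; apply: ni; exact: val_inj.
have Qp0 m n : (m < n)%N -> Q m * p n = 0.
  move=> mn; rewrite /Q mulr_suml big1// => i _; apply: pp.
  by rewrite neq_ltn (leq_ltn_trans _ mn)// -ltnS.
have QQ n : Q n * Q n = Q n.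
  by rewrite {2}/Q mulr_sumr; apply: eq_bigr => i _; apply: Qp.
have aQ n : a * Q n = Q n by rewrite /Q mulr_sumr; apply: eq_bigr.
have Qa n : Q n * a = Q n by rewrite /Q mulr_suml; apply: eq_bigr.
have AQ n : inA (Q n).
  rewrite /Q; elim: n.+1 => [|m IH]; first by rewrite big_ord0.
  by rewrite big_ord_recr; apply: inAD => //; have [] := mp m.
exists (fun n => a - Q n), p; split=> // [n|n|m n mn|m n mn].
- split; [exact: inAB|exact: usaB|].
  (* A difference of contractions need not be a contraction, but this compression of [a] is one. *)
  have -> : a - Q n = (1 - Q n) * a * (1 - Q n).
    by expand; rewrite aQ Qa QQ; lmod.
  have r1 : un (1 - Q n) <= 1.
    apply: proj_un; first by apply: usaB => //; exact: usa1.
    by expand; rewrite QQ; lmod.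
  rewrite (le_trans (unM _ _))// mulr_ile1 ?un_ge0// (le_trans (unM _ _))//.
  by rewrite mulr_ile1 ?un_ge0.
- have [Ap _ p2 p0 _] := mp n; split=> //; first exact: proj_un.
  by exists (p n).
- by rewrite mulrBl ap Qp0// subr0.
- by rewrite mulrBl ap Qp// subrr.
Qed.

End combs.

(** * The dual and its weak-* topology *)

Section weak_star_filters.
Context {R : realType} {X : normedModType R[i]}.
Implicit Types (f g : dual X) (x : X).

Lemma dualD f g x : (f + g) x = f x + g x. Proof. by []. Qed.
Lemma dualB f g x : (f - g) x = f x - g x. Proof. by []. Qed.
Lemma dualZ (k : R[i]) f x : (k *: f) x = k * f x. Proof. by []. Qed.
Lemma dual0 x : (0 : dual X) x = 0. Proof. by []. Qed.

Lemma dualP f (k : R[i]) x y : f (k *: x + y) = k * f x + f y.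
Proof. exact: linearP. Qed.

Lemma dual_ext f g : (forall x, f x = g x) -> f = g.
Proof. by move=> fg; apply: val_inj; apply: funext => x; exact: fg. Qed.

Lemma nr_dual f x : nr (f x) <= nr f * nr x.
Proof. by rewrite nr_le rmorphM/= -!nrE; exact: le_dual_norm. Qed.

Lemma dual_nr_le f (M : R) : 0 <= M -> (forall x, nr (f x) <= M * nr x) -> nr f <= M.
Proof.
move=> M0 H; rewrite /nr /=; apply: ge_sup.
  by exists (nr (f 0)), 0 => //=; rewrite normr0.
move=> _ [x /= x1 <-]; rewrite (le_trans (H x))// ler_piMr//.
by rewrite nr_le; exact: x1.
Qed.

Lemma bounded_dual (f : X -> R[i]) (M : R) :
  (forall (k : R[i]) x y, f (k *: x + y) = k * f x + f y) ->
  (forall x, nr (f x) <= M * nr x) -> exists g : dual X, forall x, g x = f x.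
Proof.
move=> lf bf; suff H : f \in @bounded_functional R X by exists (Dual H).
apply/asboolP; split; first by move=> k x y; rewrite lf.
move=> x; apply/cvgrPdist_le => e e0.
have er : e = (complex.Re e)%:C%C by rewrite RRe_real// gtr0_real.
have r0 : 0 < complex.Re e by rewrite -gt0C -er.
have M0 : 0 < `|M| + 1 by rewrite ltr_wpDl.
near=> y.
have fB : f x - f y = f (x - y).
  have -> : x - y = (-1) *: y + x by rewrite scaleN1r addrC.
  by rewrite lf mulN1r addrC.
rewrite fB er nrE lecR (le_trans (bf _))//.
rewrite (@le_trans _ _ ((`|M| + 1) * nr (x - y)))//.
  by rewrite ler_wpM2r ?nr_ge0// (le_trans (ler_norm _))// lerDl.
rewrite -ler_pdivlMl// nr_le; near: y.
apply: cvgr_dist_le; first exact: cvg_id.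
by rewrite gt0C mulr_gt0// invr_gt0.
Unshelve. all: by end_near. Qed.

Lemma weak_star_cvgP (F : set_system (weak_star X)) f : Filter F ->
  (F --> (f : weak_star X)) <->
  (forall x (e : R), 0 < e -> F [set g : dual X | nr (g x - f x) <= e]).
Proof.
move=> FF; split.
  move=> Ff x e e0; apply: Ff.
  have c : {for f, continuous (fun g : weak_star X => dual_fun g x)}.
    apply: (@continuous_comp (weak_star X) {ptws X -> R[i]^o} R[i]^o
      (@dual_fun R X) (@proj X (fun=> R[i]^o) x) f).
      exact: (@initial_continuous _ {ptws X -> R[i]^o}).
    exact: proj_continuous.
  have /cvgrPdist_le/(_ e%:C%C) := c.
  rewrite gt0C => /(_ e0); apply: filterS => g /=; rewrite nr_sub nr_le; exact.
move=> H A [_ [[W oW <-] Wf WA]].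
apply: filterS WA _.
have : {ptws, ((@dual_fun R X) @ F) --> (dual_fun f)}.
  apply/pointwise_cvgP => x; apply/cvgrPdist_le => e e0.
  have er : e = (complex.Re e)%:C%C by rewrite RRe_real// gtr0_real.
  have r0 : 0 < complex.Re e by rewrite -gt0C -er.
  change (F [set g : dual X | `|f x - g x| <= e]).
  by have := H x _ r0; apply: filterS => g /=; rewrite nr_sub nr_le -er.
by apply; exact: open_nbhs_nbhs.
Qed.

End weak_star_filters.

(** * The Hahn-Banach theorem for sublinear functionals *)

Section hahn_banach.
Context {R : realType} {V : lmodType R[i]}.
Implicit Types (x y h : V) (p q : V -> R) (t : R).

Definition sublinear p := (forall x y, p (x + y) <= p x + p y) /\
  (forall t x, 0 <= t -> p (t%:C%C *: x) = t * p x).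

Let sub0 p : sublinear p -> p 0 = 0.
Proof. by move=> [_ H]; have := H 0 0 (lexx 0); rewrite scale0r mul0r. Qed.

Let subN p x : sublinear p -> - p (- x) <= p x.
Proof.
by move=> sp; rewrite -subr_ge0 opprK -(sub0 sp) -(subrr x) sp.1.
Qed.

Let subZ_le p : (forall t x, 0 < t -> p (t%:C%C *: x) <= t * p x) -> p 0 = 0 ->
  forall t x, 0 <= t -> p (t%:C%C *: x) = t * p x.
Proof.
move=> H p0 t x; rewrite le_eqVlt => /predU1P[<-|t0].
  by rewrite scale0r p0 mul0r.
apply/eqP; rewrite eq_le H//=.
have := H t^-1 (t%:C%C *: x); rewrite invr_gt0 => /(_ t0).
by rewrite scalerA -rmorphM mulVf ?gt_eqF// scale1r ler_pdivlMl.
Qed.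

(** [q x] is the infimum of [p (x + t h) - t p h] over [t >= 0]; the value [t = 1] at [- h] gives
    the last clause. *)
Let shrink p h : sublinear p -> exists q, [/\ sublinear q, forall x, q x <= p x
  & q (- h) <= - p h].
Proof.
move=> sp; pose B x := [set p (x + t%:C%C *: h) - t * p h | t in [set t | 0 <= t]].
pose q x := inf (B x).
have B0 x : B x !=set0 by exists (p (x + 0%:C%C *: h) - 0 * p h), 0 => //=.
have Bl x : has_lbound (B x).
  exists (- p (- x)) => _ [t /= t0 <-].
  rewrite lerBrDl -(sp.2 t h t0) lerBlDl.
  by have := sp.1 (- x) (x + t%:C%C *: h); rewrite addrA addNr add0r addrC.
have qB x t : 0 <= t -> q x <= p (x + t%:C%C *: h) - t * p h.
  by move=> t0; apply: ge_inf => //; exists t.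
have qge x (m : R) : (forall t, 0 <= t -> m <= p (x + t%:C%C *: h) - t * p h) -> m <= q x.
  by move=> H; apply: lb_le_inf => // _ [t /= t0 <-]; exact: H.
have qp x : q x <= p x.
  by have := qB x 0 (lexx 0); rewrite scale0r addr0 mul0r subr0.
have q0 : q 0 = 0.
  apply/eqP; rewrite eq_le -{1}(sub0 sp) qp/=; apply: (qge) => t t0.
  by rewrite add0r (sp.2 t h t0) subrr.
exists q; split=> //.
- split.
    move=> x y; rewrite -lerBlDr; apply: (qge) => t t0.
    rewrite lerBlDr [leRHS]addrC -lerBlDr; apply: (qge) => s s0.
    rewrite lerBlDr; apply: le_trans (qB (x + y) (t + s) (addr_ge0 t0 s0)) _.
    have -> : x + y + (t + s)%:C%C *: h = (x + t%:C%C *: h) + (y + s%:C%C *: h).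
      by rewrite rmorphD; lmod.
    by have := sp.1 (x + t%:C%C *: h) (y + s%:C%C *: h); lra.
  apply: subZ_le => // t x t0; rewrite -ler_pdivrMl//; apply: (qge) => s s0.
  rewrite ler_pdivrMl//; apply: le_trans (qB (t%:C%C *: x) (t * s) _) _.
    by rewrite mulr_ge0// ltW.
  have -> : t%:C%C *: x + (t * s)%:C%C *: h = t%:C%C *: (x + s%:C%C *: h).
    by rewrite rmorphM; lmod.
  by rewrite (sp.2 t _ (ltW t0)) mulrBr mulrA.
- by have := qB (- h) 1 ler01; rewrite scale1r addNr (sub0 sp) mul1r sub0r.
Qed.

(** A minimal sublinear functional is odd, since [shrink] in any direction cannot change it, and
    therefore additive. Starting below [p1], already shrunk along [h], makes it agree with [p] at
    [h]. *)
Lemma hahn_banach p h : sublinear p -> exists g : V -> R,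
  [/\ forall x y, g (x + y) = g x + g y, forall t x, g (t%:C%C *: x) = t * g x,
      forall x, g x <= p x & g h = p h].
Proof.
move=> sp; have [p1 [sp1 p1p p1h]] := shrink h sp.
pose T := {q : V -> R | sublinear q}.
pose rl (q1 q2 : T) : bool := `[< forall x, sval q2 x <= sval q1 x >].
pose below (q : T) := forall x, sval q x <= p1 x.
pose T1 := {q : T | below q}.
have [[[q sq] qb] qmax] : exists q : T1, forall q' : T1,
    rl (sval q) (sval q') -> q' = q.
  apply: (@Zorn T1 (fun a b => rl (sval a) (sval b))).
  - by move=> a; apply/asboolP.
  - by move=> a b c /asboolP ab /asboolP bc; apply/asboolP => x; exact: le_trans (bc x) (ab x).
  - move=> [[a sa] ba] [[b sb] bb] /asboolP/= ab /asboolP/= ba'.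
    have E : a = b by apply: funext => x; apply/eqP; rewrite eq_le ba' ab.
    by move: sa ba ab ba'; rewrite E => sa ba _ _; apply: eq_exist => /=; apply: eq_exist.
  move=> C Ctot.
  have [[c0 Cc0]|C0] := pselect (exists c, C c); last first.
    have b1 : below (exist _ p1 sp1) by move=> x.
    by exists (exist _ _ b1) => s Cs; case: C0; exists s.
  pose B x := [set sval (sval c) x | c in C].
  have B0 x : B x !=set0 by exists (sval (sval c0) x), c0.
  have Bl x : has_lbound (B x).
    exists (- p1 (- x)) => _ [[[c sc] bc] Cc <-] /=.
    by apply: le_trans (subN _ sc); rewrite lerN2; exact: bc.
  pose m x := inf (B x).
  have mB x c : C c -> m x <= sval (sval c) x by move=> Cc; apply: ge_inf => //; exists c.
  have mge x (r : R) : (forall c, C c -> r <= sval (sval c) x) -> r <= m x.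
    by move=> H; apply: lb_le_inf => // _ [c Cc <-]; exact: H.
  have m0 : m 0 = 0.
    apply/eqP; rewrite eq_le; apply/andP; split.
      by rewrite (le_trans (mB 0 c0 Cc0))// (sub0 (svalP (sval c0))).
    by apply: (mge) => c Cc; rewrite (sub0 (svalP (sval c))).
  have sm : sublinear m.
    split.
      move=> x y; rewrite -lerBlDr; apply: (mge) => c Cc.
      rewrite lerBlDr [leRHS]addrC -lerBlDr; apply: (mge) => d Cd; rewrite lerBlDr.
      have [/asboolP cd|/asboolP dc] := Ctot _ _ Cc Cd.
        apply: le_trans (mB _ _ Cd) _; apply: le_trans ((svalP (sval d)).1 _ _) _.
        by rewrite addrC lerD2l; exact: cd.
      apply: le_trans (mB _ _ Cc) _; apply: le_trans ((svalP (sval c)).1 _ _) _.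
      by rewrite addrC lerD2r; exact: dc.
    apply: subZ_le => // t x t0; rewrite -ler_pdivrMl//; apply: (mge) => c Cc.
    rewrite ler_pdivrMl//; apply: le_trans (mB _ _ Cc) _.
    by rewrite (svalP (sval c)).2// ltW.
  have bm : below (exist _ m sm).
    by move=> x /=; apply: le_trans (mB _ _ Cc0) _; exact: (svalP c0).
  exists (exist _ _ bm) => c Cc; apply/asboolP => x /=; exact: mB.
rewrite /rl /= in qmax.
have qlin y : q (- y) = - q y.
  have [r [sr rq ry]] := shrink y sq.
  have rb : below (exist _ r sr) by move=> x /=; exact: le_trans (rq x) (qb x).
  have /(congr1 (fun z => sval (sval z)))/= E := qmax (exist _ _ rb) ltac:(by apply/asboolP).
  apply/eqP; rewrite eq_le -{1}E ry/=.
  by have := subN (- y) sq; rewrite opprK.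
exists q; split.
- move=> x y; apply/eqP; rewrite eq_le sq.1/=.
  by have := sq.1 (x + y) (- y); rewrite addrK qlin; lra.
- move=> t x; have [t0|/ltW t0] := leP 0 t; first exact: sq.2.
  rewrite -[t]opprK rmorphN scaleNr qlin sq.2 ?oppr_ge0//.
  by rewrite !mulNr.
- by move=> x; exact: le_trans (qb x) (p1p x).
- apply/eqP; rewrite eq_le (le_trans (qb h) (p1p h))/=.
  have H : q (- h) <= - p h := le_trans (qb (- h)) p1h.
  by move: H; rewrite qlin lerN2.
Qed.

End hahn_banach.

(** * States *)

Section cauchy_schwarz.
Context {R : realType} {V : lmodType R[i]}.
Variable B : V -> V -> R[i].
Hypotheses (Bl : forall k x y z, B (k *: x + y) z = k * B x z + B y z)
  (Bh : forall x y, B y x = (B x y)^*) (B0 : forall x, 0 <= B x x).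

Let Br k x y z : B z (k *: x + y) = k^* * B z x + B z y.
Proof. by rewrite Bh Bl rmorphD rmorphM/= -(Bh x z) -(Bh y z). Qed.

Lemma cauchy_schwarz x y :
  nr (B x y) ^+ 2 <= complex.Re (B x x) * complex.Re (B y y).
Proof.
set a := complex.Re (B x x); set b := complex.Re (B y y); set n := nr _ ^+ 2.
have rB z : B z z = (complex.Re (B z z))%:C%C by rewrite RRe_real// ger0_real.
have b0 : 0 <= b by rewrite -ler0c -rB.
have nE : B x y * B y x = n%:C%C.
  by rewrite (Bh x y) -normCK nrE -rmorphXn.
have H t : 0 <= a - 2 * t * n + t ^+ 2 * n * b.
  have := B0 (- (t%:C%C * B x y) *: y + x).
  rewrite Bl !Br rmorphN rmorphM/= conjR -(Bh x y) (rB y) (rB x) -/a -/b.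
  have -> : - (t%:C%C * B x y) * (- (t%:C%C * B y x) * b%:C%C + B y x) +
    (- (t%:C%C * B y x) * B x y + a%:C%C) =
    a%:C%C - 2 * t%:C%C * (B x y * B y x) + t%:C%C ^+ 2 * (B x y * B y x) * b%:C%C.
    by ring.
  rewrite nE -[2]/(2%:R) -(rmorph_nat (real_complex R)) -!rmorphXn -!rmorphM -rmorphB -rmorphD.
  by rewrite ler0c.
have n0 : 0 <= n by rewrite sqr_ge0.
move: b0; rewrite le_eqVlt => /predU1P[b0|b0]; last first.
  have := H b^-1; have -> : b^-1 ^+ 2 * n * b = b^-1 * n by field; rewrite gt_eqF.
  move=> H1; have : 0 <= a - b^-1 * n by lra.
  by rewrite subr_ge0 ler_pdivrMl// mulrC.
rewrite -b0 mulr0; move: n0; rewrite le_eqVlt => /predU1P[<-//|n0].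
(* With [b = 0] the inequality is linear in [t], and this [t] makes it read [0 <= -1]. *)
have := H ((a + 1) / (2 * n)); rewrite -b0 mulr0 addr0.
have -> : 2 * ((a + 1) / (2 * n)) * n = a + 1 by field; rewrite gt_eqF.
lra.
Qed.

End cauchy_schwarz.

Lemma double_inj (K : numDomainType) (z w : K) : z + z = w + w -> z = w.
Proof.
rewrite -[z + z]mulr2n -[w + w]mulr2n -[z *+ 2]mulr_natr -[w *+ 2]mulr_natr.
move=> /mulIf; apply.
by rewrite pnatr_eq0.
Qed.

Section states.
Context {R : realType} {A : cStarAlgType R}.
Local Notation U := (unitization A).
Local Notation "t %:u" := (t%:C%C *: (1 : U)) (at level 2, format "t %:u").
Implicit Types (x y : U) (f g : dual A).

Definition ext f x : R[i] := x.1 + f x.2.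

Lemma ext_lin f k x y : ext f (k *: x + y) = k * ext f x + ext f y.
Proof. by rewrite /ext /= linearP mulrDr addrACA. Qed.

Lemma extD f x y : ext f (x + y) = ext f x + ext f y.
Proof. by have := ext_lin f 1 x y; rewrite scale1r mul1r. Qed.

Lemma ext0 f : ext f 0 = 0.
Proof. by rewrite /ext /= linear0 addr0. Qed.

Lemma extZ f k x : ext f (k *: x) = k * ext f x.
Proof. by have := ext_lin f k x 0; rewrite !addr0 ext0 addr0. Qed.

Lemma extN f x : ext f (- x) = - ext f x.
Proof. by rewrite -scaleN1r extZ mulN1r. Qed.

Lemma extB f x y : ext f (x - y) = ext f x - ext f y.
Proof. by rewrite extD extN. Qed.

Lemma ext1 f : ext f 1 = 1.
Proof. by rewrite /ext /= linear0 addr0. Qed.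

Lemma ext_inA f x : inA x -> ext f x = f x.2.
Proof. by rewrite /ext => ->; rewrite add0r. Qed.

(* States of the unitization; besides the states of [A] this contains the
   positive functionals of norm less than one, in particular [0]. *)
Definition state f := forall x, 0 <= ext f (ustar x * x).

Section state.
Variables (f : dual A) (sf : state f).

Lemma state_pos x : upos x -> 0 <= ext f x.
Proof. by move=> /upos_sqrt[s [ps <- _]]; rewrite -{1}(upos_sa ps); exact: sf. Qed.

Lemma state_real x : usa x -> ext f x \is Num.real.
Proof.
move=> sx; rewrite (uppB x) extB realB// ger0_real// state_pos//.
  exact: upp_pos.
exact: unp_pos.
Qed.

Lemma state_star x : ext f (ustar x) = (ext f x)^*.
Proof.
have H y : usa y -> (ext f y)^* = ext f y by move=> /state_real/CrealP.
have : ext f (x + ustar x) \is Num.real.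
  by apply: state_real; rewrite /usa ustarD ustarK addrC.
have : ext f ('i *: (x - ustar x)) \is Num.real.
  by apply: state_real; rewrite /usa ustarZ ustarB ustarK conjCi scaleNr -scalerN opprB.
move=> /CrealP; rewrite extZ extB rmorphM rmorphB/= conjCi mulNr -mulrN opprB.
move=> /(mulfI (neq0Ci _)) E1 /CrealP; rewrite extD rmorphD => E2.
have : (ext f x)^* + (ext f x)^* = ext f (ustar x) + ext f (ustar x).
  have := congr2 (fun a b => b - a) E1 E2; rewrite opprB addrACA => /eqP.
  rewrite -subr_eq0 => /eqP E; apply/eqP; rewrite -subr_eq0 -E; apply/eqP.
  by ring.
by move=> /double_inj ->.
Qed.

Lemma state_CS x y : nr (ext f (ustar y * x)) ^+ 2 <=
  complex.Re (ext f (ustar x * x)) * complex.Re (ext f (ustar y * y)).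
Proof.
apply: (@cauchy_schwarz _ _ (fun x y => ext f (ustar y * x))).
- by move=> k u v w; rewrite mulrDr scale_mulr ext_lin.
- by move=> u v; rewrite -state_star ustarM ustarK.
- exact: sf.
Qed.

Lemma state_null x y : ext f (ustar x * x) = 0 -> ext f (y * x) = 0.
Proof.
move=> x0; have := state_CS x (ustar y); rewrite ustarK x0 mul0r.
move=> H; apply: nr0_eq0; apply/eqP; rewrite -sqrf_eq0 eq_le H/=.
exact: sqr_ge0.
Qed.

Lemma state_le x : nr (ext f x) <= un x.
Proof.
have := state_CS x 1; rewrite ustar1 !mul1r ext1 mulr1 => H.
rewrite -ler_sqr ?nnegrE ?nr_ge0 ?un_ge0// (le_trans H)//.
rewrite -lecR RRe_real; last exact/ger0_real/sf.
have := state_pos (upos_norm_sub (usa_starM x)).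
by rewrite extB extZ ext1 mulr1 subr_ge0 un_starM.
Qed.

Lemma state_norm : nr f <= 1.
Proof.
apply: dual_nr_le => // a; rewrite mul1r -un_uin.
by have := state_le (uin a); rewrite ext_inA.
Qed.

(** The value at the square of [1 - a] is that at [a * a] minus one, hence zero; so [1 - a] is in
    the left kernel of [f]. A state with value one at a node is thereby concentrated on it. *)
Lemma state_unit a y : usa a -> un a <= 1 -> ext f a = 1 ->
  ext f (y * a) = ext f y /\ ext f (a * y) = ext f y.
Proof.
move=> sa a1 fa; have H : ext f (ustar (1 - a) * (1 - a)) = 0.
  rewrite ustarB ustar1 sa; have -> : (1 - a) * (1 - a) = 1 - a - a + a * a by ualg.
  rewrite !(extD, extN) ext1 fa; apply/eqP; rewrite eq_le; apply/andP; split.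
    have := state_pos (upos_norm_sub (usaX sa)).
    rewrite extB extZ ext1 mulr1 subr_ge0 unX2// => /le_trans.
    move=> /(_ 1); rewrite -[1]/(1%:C%C) lecR expr_le1 ?un_ge0// => /(_ a1).
    by move=> H; rewrite subrr add0r addrC subr_le0.
  have := sf (1 - a); rewrite ustarB ustar1 sa.
  have -> : (1 - a) * (1 - a) = 1 - a - a + a * a by ualg.
  by rewrite !(extD, extN) ext1 fa.
have E z : ext f (z * a) = ext f z.
  have /eqP := state_null z H; rewrite mulrBr mulr1 extB subr_eq0.
  by move=> /eqP.
split; first exact: E.
have := E (ustar y); rewrite -{1}sa -ustarM !state_star.
by move=> /(congr1 Num.conj); rewrite !conjCK.
Qed.

End state.

(** [p x], the infimum of the [t] with [t - re x] positive, is sublinear and at least the norm on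
    positive elements. A real functional [g] below [p] and equal to it at [ustar b * b] is positive,
    unital and zero on skew-adjoint elements; [gc] is its complexification. *)
Lemma state_exists (b : U) : b != 0 -> exists f, state f /\ 0 < ext f (ustar b * b).
Proof.
move=> b0; pose re x : U := (2^-1)%:C%C *: (x + ustar x).
have sre x : usa (re x) by apply: usaZ; rewrite /usa ustarD ustarK addrC.
have reP x : usa x -> re x = x by move=> sx; rewrite /re sx halfD.
pose B x := [set t : R | upos (t%:u - re x)].
pose p x := inf (B x).
have B0 x : B x !=set0 by exists (un (re x)); exact: upos_norm_sub.
have Bge x t : B x t -> - un (re x) <= t.
  rewrite /B /= => H; rewrite -subr_ge0 opprK; apply: upos_ge0.
  suff : upos ((t + un (re x))%:u) by exact.
  have -> : (t + un (re x))%:u = (t%:u - re x) + ((un (re x))%:u - - re x).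
    by rewrite rmorphD; lmod.
  by apply: uposD => //; rewrite -unN; apply/upos_norm_sub/usaN.
have Bl x : has_lbound (B x) by exists (- un (re x)) => t; exact: Bge.
have pB x t : B x t -> p x <= t by move=> H; exact: ge_inf.
have pge x (m : R) : (forall t, B x t -> m <= t) -> m <= p x.
  by move=> H; exact: lb_le_inf.
have re0 : re 0 = 0 by rewrite /re ustar0 addr0 scaler0.
have p0 : p 0 = 0.
  apply/eqP; rewrite eq_le; apply/andP; split.
    by apply: pB; rewrite /B /= re0 subr0 scale0r; exact: upos0.
  by apply: (pge) => t; rewrite /B /= re0 subr0 => /upos_ge0.
have reD x y : re (x + y) = re x + re y by rewrite /re ustarD; lmod.
have reZ (t : R) x : re (t%:C%C *: x) = t%:C%C *: re x.
  by rewrite /re ustarZR; lmod.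
have sp : sublinear p.
  split.
    move=> x y; rewrite -lerBlDr; apply: (pge) => t Bt.
    rewrite lerBlDr -lerBlDl; apply: (pge) => s Bs; rewrite lerBlDl.
    apply: pB; rewrite /B /= reD.
    have -> : (t + s)%:u - (re x + re y) = (t%:u - re x) + (s%:u - re y).
      by rewrite rmorphD; lmod.
    exact: uposD.
  have Z t x : 0 < t -> p (t%:C%C *: x) <= t * p x.
    move=> t0; rewrite -ler_pdivrMl//; apply: (pge) => s Bs.
    rewrite ler_pdivrMl//; apply: pB; rewrite /B /= reZ.
    have -> : (t * s)%:u - t%:C%C *: re x = t%:C%C *: (s%:u - re x).
      by rewrite rmorphM; lmod.
    by apply: uposZ => //; exact: ltW.
  move=> t x; rewrite le_eqVlt => /predU1P[<-|t0].
    by rewrite scale0r p0 mul0r.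
  apply/eqP; rewrite eq_le Z//=.
  have := Z t^-1 (t%:C%C *: x); rewrite invr_gt0 => /(_ t0).
  by rewrite scalerA -rmorphM mulVf ?gt_eqF// scale1r ler_pdivlMl.
pose h := ustar b * b.
have ph : upos h by exact: upos_starM.
have [g [gD gZ gp gh]] := hahn_banach h sp.
have gN x : g (- x) = - g x by have := gZ (-1) x; rewrite rmorphN rmorph1 scaleN1r mulN1r.
have gskew x : re x = 0 -> g x = 0.
  move=> rx; have pskew y : re y = 0 -> p y <= 0.
    by move=> ry; apply: pB; rewrite /B /= ry subr0 scale0r; exact: upos0.
  apply/eqP; rewrite eq_le (le_trans (gp x)) ?pskew//=.
  rewrite -oppr_le0 -gN (le_trans (gp _))// pskew//.
  by rewrite -scaleN1r -(rmorphN1 (real_complex R)) reZ rx scaler0.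
have g1 : g 1 = 1.
  apply/eqP; rewrite eq_le (le_trans (gp 1)); last first.
    by apply: pB; rewrite /B /= reP ?scale1r ?subrr; [exact: upos0|exact: usa1].
  rewrite -lerN2 -gN (le_trans (gp _))//; apply: pB; rewrite /B /= reP.
    by rewrite opprK rmorphN rmorph1 scaleN1r addNr; exact: upos0.
  exact/usaN/usa1.
have gpos x : upos x -> 0 <= g x.
  move=> px; rewrite -oppr_le0 -gN (le_trans (gp _))//; apply: pB.
  by rewrite /B /= reP ?scale0r ?sub0r ?opprK//; exact/usaN/upos_sa.
have gun x : `|g x| <= un x.
  have H y : g y <= un y.
    rewrite (le_trans (gp y))// (@le_trans _ _ (un (re y)))//.
      by apply: pB; exact: upos_norm_sub.
    rewrite /re unZR gtr0_norm ?invr_gt0// ler_pdivrMl// mulr_natl mulr2n.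
    by rewrite (le_trans (unD _ _))// un_star.
  by rewrite ler_norml H andbT lerNl -gN -(unN x) H.
pose gc x : R[i] := (g x)%:C%C - 'i * (g ('i *: x))%:C%C.
have gcD x y : gc (x + y) = gc x + gc y.
  by rewrite /gc scalerDr !gD !rmorphD; ring.
have gcR (t : R) x : gc (t%:C%C *: x) = t%:C%C * gc x.
  by rewrite /gc scalerA (mulrC 'i t%:C%C) -scalerA !gZ !rmorphM; ring.
have gci x : gc ('i *: x) = 'i * gc x.
  rewrite /gc scalerA mul_ii scaleN1r gN rmorphN mulrN opprK mulrBr mulrA mul_ii.
  by rewrite mulN1r opprK addrC.
have gcZ k x : gc (k *: x) = k * gc x.
  rewrite {1}(complexE k) scalerDl gcD gcR -scalerA gci gcR mulrA -mulrDl.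
  by rewrite -complexE.
have [f Hf] : exists f : dual A, forall a, f a = gc (uin a).
  apply: (@bounded_dual _ _ _ 2) => [k x y|x].
    by rewrite uinD uinZ gcD gcZ.
  rewrite (le_trans (nrB _ _))// nrM nri mul1r !nrR mulr2n mulrDl mul1r lerD//.
    by rewrite -un_uin.
  by rewrite (le_trans (gun _))// unZ nri mul1r un_uin.
have fE x : ext f x = gc x.
  rewrite /ext Hf; have {3}-> : x = x.1 *: 1 + uin x.2.
    by rewrite uscalarE; apply: uext; rewrite /= ?addr0// add0r.
  rewrite gcD gcZ; congr (_ + _); rewrite {1}/gc g1 gskew ?rmorph0 ?mulr0 ?subr0 ?mulr1//.
  by rewrite /re ustarZ ustar1 conjCi scaleNr subrr scaler0.
have gsa x : upos x -> gc x = (g x)%:C%C.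
  move=> px; rewrite /gc (gskew ('i *: x)) ?rmorph0 ?mulr0 ?subr0//.
  by rewrite /re ustarZ (upos_sa px) conjCi scaleNr subrr scaler0.
exists f; split.
  by move=> x; rewrite fE gsa ?ler0c ?gpos//; exact: upos_starM.
rewrite fE gsa// gt0C gh.
apply: (@lt_le_trans _ _ (un h)); first by rewrite un_starM exprn_gt0// un_neq0.
apply: (pge) => t; rewrite /B /= reP; last exact: upos_sa.
exact: un_le_pos.
Qed.

End states.

(** * Limits along ultrafilters *)

Section ultralimits.
Context {R : realType} {T : Type}.
Implicit Types (F : set_system T) (M e : R).

Definition ulim F (h : T -> R[i]) (l : R[i]) :=
  forall e, 0 < e -> F [set t | nr (h t - l) <= e].

Definition ulimr F (h : T -> R) (l : R) :=
  forall e, 0 < e -> F [set t | `|h t - l| <= e].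

Lemma ulimr_ex F (h : T -> R) M : UltraFilter F -> F [set t | `|h t| <= M] ->
  exists l, ulimr F h l.
Proof.
move=> FU FM; pose B := [set r : R | F [set t | r <= h t]].
have FF : ProperFilter F by exact: ultra_proper.
have B0 : B (- M) by apply: filterS FM => t /=; rewrite ler_norml => /andP[].
have Bub r : B r -> r <= M.
  move=> Br; have [t /= [rt]] := filter_ex (filterI Br FM).
  by rewrite ler_norml => /andP[_]; exact: le_trans.
have hB : has_sup B by split; [exists (- M)|exists M => r; exact: Bub].
exists (sup B) => e e0.
have F1 : F [set t | sup B - e <= h t].
  have [r Br rB] := sup_adherent e0 hB.
  by apply: filterS Br => t /=; apply: le_trans; exact: ltW.
have F2 : F [set t | h t <= sup B + e].
  have [|H] := in_ultra_setVsetC [set t | h t <= sup B + e] FU; first by [].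
  have : B (sup B + e) by apply: filterS H => t /= /negP; rewrite -ltNge => /ltW.
  by move=> /(ub_le_sup hB.2); rewrite gerDl leNgt e0.
apply: filterS (filterI F1 F2) => t /= [t1 t2].
by rewrite ler_norml; apply/andP; split; lra.
Qed.

Lemma ulim_ex F (h : T -> R[i]) M : UltraFilter F -> F [set t | nr (h t) <= M] ->
  exists l, ulim F h l.
Proof.
move=> FU FM; have FF : ProperFilter F by exact: ultra_proper.
have [a Ha] : exists a, ulimr F (fun t => complex.Re (h t)) a.
  by apply: (@ulimr_ex _ _ M) => //; apply: filterS FM => t /=; exact/le_trans/Re_nr.
have [b Hb] : exists b, ulimr F (fun t => complex.Im (h t)) b.
  by apply: (@ulimr_ex _ _ M) => //; apply: filterS FM => t /=; exact/le_trans/Im_nr.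
exists (Complex a b) => e e0; have e2 : 0 < e / 2 by rewrite divr_gt0.
apply: filterS (filterI (Ha _ e2) (Hb _ e2)) => t /= [t1 t2].
by rewrite (le_trans (nr_ReIm _))// (splitr e) !raddfB lerD.
Qed.

Section proper.
Variables (F : set_system T) (FF : ProperFilter F).

Lemma ulim_uniq h l l' : ulim F h l -> ulim F h l' -> l = l'.
Proof.
move=> H H'; apply/eqP; rewrite -subr_eq0; apply/eqP/nr_small => e e0.
have e2 : 0 < e / 2 by rewrite divr_gt0.
have [t /= [t1 t2]] := filter_ex (filterI (H _ e2) (H' _ e2)).
by rewrite (le_trans (nr_tri (h t) _ _))// (splitr e) lerD// nr_sub.
Qed.

Lemma ulimD h h' l l' : ulim F h l -> ulim F h' l' ->
  ulim F (fun t => h t + h' t) (l + l').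
Proof.
move=> H H' e e0; have e2 : 0 < e / 2 by rewrite divr_gt0.
apply: filterS (filterI (H _ e2) (H' _ e2)) => t /= [t1 t2].
by rewrite opprD addrACA (le_trans (nrD _ _))// (splitr e) lerD.
Qed.

Lemma ulimZ k h l : ulim F h l -> ulim F (fun t => k * h t) (k * l).
Proof.
move=> H e e0; have k0 : 0 < nr k + 1 by rewrite ltr_wpDl ?nr_ge0.
apply: filterS (H (e / (nr k + 1)) _) => [t /= t1|]; last by rewrite divr_gt0.
rewrite -mulrBr nrM (@le_trans _ _ ((nr k + 1) * nr (h t - l)))//.
  by rewrite ler_wpM2r ?nr_ge0// lerDl.
by rewrite mulrC -ler_pdivlMr.
Qed.

Lemma ulim_cst k : ulim F (fun=> k) k.
Proof. by move=> e e0; apply: filterS filterT => t _ /=; rewrite subrr nr0 ltW. Qed.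

Lemma ulim_sum (n : nat) (h : nat -> T -> R[i]) (l : nat -> R[i]) :
  (forall i, (i < n)%N -> ulim F (h i) (l i)) ->
  ulim F (fun t => \sum_(i < n) h i t) (\sum_(i < n) l i).
Proof.
elim: n => [|n IH] H.
  by under eq_fun do rewrite big_ord0; rewrite big_ord0; exact: ulim_cst.
under eq_fun do rewrite big_ord_recr /=; rewrite big_ord_recr /=.
by apply: ulimD; [apply: IH => i /ltnW; exact: H|exact: H].
Qed.

Lemma ulim_le h l M : ulim F h l -> F [set t | nr (h t) <= M] -> nr l <= M.
Proof.
move=> H FM; apply/ler_addgt0Pr => e e0.
have [t /= [t1 t2]] := filter_ex (filterI FM (H _ e0)).
by rewrite (le_trans (nr_dist l (h t)))// lerD// nr_sub.
Qed.

Lemma ulim_ge0 h l : ulim F h l -> F [set t | 0 <= h t] -> 0 <= l.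
Proof.
move=> H F0.
have key e : 0 < e -> - e <= complex.Re l /\ `|complex.Im l| <= e.
  move=> e0; have [t /= [t1 t2]] := filter_ex (filterI F0 (H _ e0)).
  have ht : h t = (complex.Re (h t))%:C%C by rewrite RRe_real// ger0_real.
  have h0 : 0 <= complex.Re (h t) by rewrite -ler0c -ht.
  split.
    have := le_trans (Re_nr _) t2; rewrite raddfB ler_norml => /andP[_].
    by rewrite -[leLHS]/(complex.Re (h t) - complex.Re l); lra.
  have := le_trans (Im_nr _) t2; rewrite raddfB ht /=.
  by rewrite sub0r normrN.
rewrite lecE /=; apply/andP; split.
  rewrite -normr_le0; apply/ler_addgt0Pr => e e0; rewrite add0r.
  by have [] := key e e0.
by apply/ler_addgt0Pr => e e0; have [] := key e e0; lra.
Qed.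

Lemma ulim_eq h l k : ulim F h l -> F [set t | h t = k] -> l = k.
Proof.
move=> H Fk; apply: (ulim_uniq H) => e e0.
by apply: filterS Fk => t /= ->; rewrite subrr nr0 ltW.
Qed.

End proper.

(** Banach-Alaoglu: the pointwise ultralimit of a bounded family is linear with the same bound. *)
Lemma ultra_dual {X : normedModType R[i]} F (g : T -> dual X) M : UltraFilter F ->
  0 <= M -> F [set t | nr (g t) <= M] ->
  exists2 f : dual X, nr f <= M & forall x, ulim F (fun t => g t x) (f x).
Proof.
move=> FU M0 FM; have FF : ProperFilter F by exact: ultra_proper.
have bd x : F [set t | nr (g t x) <= M * nr x].
  apply: filterS FM => t /= gM; rewrite (le_trans (nr_dual _ _))//.
  by rewrite ler_wpM2r ?nr_ge0.
have [h Hh] := choice (fun x => ulim_ex FU (bd x)).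
have hM x : nr (h x) <= M * nr x by exact: ulim_le (Hh x) (bd x).
have [f Hf] : exists f : dual X, forall x, f x = h x.
  apply: (@bounded_dual _ _ _ M) => // k x y.
  apply: (ulim_uniq FF (Hh (k *: x + y))).
  have := ulimD FF (ulimZ FF k (Hh x)) (Hh y).
  by under eq_fun do rewrite -dualP.
exists f; first by apply: dual_nr_le => // x; rewrite Hf.
by move=> x; rewrite Hf.
Qed.

End ultralimits.

Section dual_complete.
Context {R : realType} {X : normedModType R[i]}.

Lemma dual_complete (u : nat -> dual X) : ncauchy (fun m n => nr (u m - u n)) ->
  exists f, nnull (fun n => nr (u n - f)).
Proof.
move=> cu.
have cx x : ncauchy (fun m n => nr (u m x - u n x)).
  move=> e e0; have k0 : 0 < nr x + 1 by rewrite ltr_wpDl ?nr_ge0.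
  have [M HM] := cu (e / (nr x + 1)) ltac:(by rewrite divr_gt0).
  exists M => m n Mm Mn; rewrite -dualB (le_trans (nr_dual _ _))//.
  rewrite (@le_trans _ _ (nr (u m - u n) * (nr x + 1)))//.
    by rewrite ler_wpM2l ?nr_ge0// lerDl.
  by rewrite -ler_pdivlMr// HM.
have [h Hh] := choice (fun x => complex_complete (cx x)).
have HM e : 0 < e -> exists M, forall n x, (M <= n)%N -> nr (u n x - h x) <= e * nr x.
  move=> e0; have [M HM] := cu e e0; exists M => n x Mn.
  apply/ler_addgt0Pr => d d0; have [N HN] := Hh x d d0.
  rewrite (le_trans (nr_tri (u (maxn M N) x) _ _))// lerD//.
    rewrite -dualB (le_trans (nr_dual _ _))// ler_wpM2r ?nr_ge0// HM//.
    exact: leq_maxl.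
  by rewrite HN// leq_maxr.
have [f Hf] : exists f : dual X, forall x, f x = h x.
  have [M H1] := HM 1 ltr01; apply: (@bounded_dual _ _ _ (nr (u M) + 1)) => [k x y|x].
    apply/eqP; rewrite -subr_eq0; apply/eqP/nr_small => e e0.
    pose K := nr (k *: x + y) + nr k * nr x + nr y + 1.
    have K0 : 0 < K by rewrite ltr_wpDl// !addr_ge0 ?mulr_ge0 ?nr_ge0.
    have [N HN] := HM (e / K) ltac:(by rewrite divr_gt0).
    have -> : h (k *: x + y) - (k * h x + h y) =
      - (u N (k *: x + y) - h (k *: x + y)) + k * (u N x - h x) + (u N y - h y).
      by rewrite dualP; ring.
    apply: (@le_trans _ _ (e / K * (nr (k *: x + y) + nr k * nr x + nr y))).
      rewrite !mulrDr (le_trans (nrD _ _))// lerD ?HN// (le_trans (nrD _ _))// lerD//.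
        by rewrite nrN HN.
      by rewrite -mulrDr nrM mulrCA ler_wpM2l ?nr_ge0 ?HN.
    rewrite -mulrA ler_piMr ?(ltW e0)// ler_pdivrMl// mulr1.
    by rewrite /K lerDl.
  rewrite (le_trans (nr_dist (h x) (u M x)))// mulrDl lerD ?nr_dual//.
  by rewrite nr_sub H1.
exists f => e e0; have [M H] := HM e e0; exists M => n Mn.
by apply: dual_nr_le => [|x]; [exact: ltW|rewrite dualB Hf H].
Qed.

End dual_complete.

(** * A weak-* compact convex set without the fixed point property *)

Section convexity.
Local Open Scope convex_scope.
Context {R : realType} {E : normedModType R[i]}.

Lemma convex_setE (C : set E) : convex_set C <-> forall (x y : E) (t : R),
  C x -> C y -> 0 <= t <= 1 -> C (t%:C%C *: x + (1 - t)%:C%C *: y).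
Proof.
split=> [cC x y t Cx Cy /andP[t0 t1]|H x y l /set_mem Cx /set_mem Cy].
  have T0 : 0 <= t%:C%C :> R[i] by rewrite ler0c.
  have T1 : t%:C%C <= 1 :> R[i] by rewrite -[1]/(1%:C%C) lecR.
  have /set_mem := cC x y (Itv01 T0 T1) (mem_set Cx) (mem_set Cy).
  by rewrite [X in _ -> X](_ : _ = C (t%:C%C *: x + (1 - t%:C%C) *: y))// rmorphB rmorph1.
have l0 : 0 <= l%:num by [].
have l1 : l%:num <= 1 by [].
have lE : l%:num = (complex.Re l%:num)%:C%C by rewrite RRe_real// ger0_real.
apply: mem_set; have -> : x <| l |> y =
  (complex.Re l%:num)%:C%C *: x + (1 - complex.Re l%:num)%:C%C *: y.
  suff -> : (1 - complex.Re l%:num)%:C%C = 1 - (complex.Re l%:num)%:C%C :> R[i].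
    by move: lE; move: (complex.Re _) => r <-.
  by rewrite rmorphB rmorph1.
apply: H => //; apply/andP; split; first by rewrite -ler0c -lE.
by rewrite -lecR -lE.
Qed.

End convexity.

Section shift_map.
Context {R : realType} {X : normedModType R[i]}.
Variables (psi : nat -> dual X) (phi : dual X).
Hypotheses (psi1 : forall n, nr (psi n) <= 1) (phi1 : nr phi <= 1)
  (psi_phi : forall x, nnull (fun n => nr (psi n x - phi x)))
  (l1 : forall N (t : nat -> R) (s : R),
    \sum_(i < N) `|t i| + `|s| <=
      nr (\sum_(i < N) (t i)%:C%C *: psi i + s%:C%C *: phi)).
Implicit Types (t : nat -> R) (f g : dual X).

(* By [l1] the map [t |-> phi + sum t_n (psi_n - phi)] carries the set [Delta] of
   subprobability sequences onto a weak-* compact convex set [C], isometrically when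
   [Delta] is augmented by the mass defect [1 - sum t]; the shift that moves this
   defect to the front is a fixed point free isometry. *)
Let psum t N := \sum_(i < N) t i.
Let Delta t := (forall n, 0 <= t n) /\ (forall N, psum t N <= 1).
Let P t N : dual X := phi + \sum_(i < N) (t i)%:C%C *: (psi i - phi).
Let rep t f := forall e, 0 < e -> exists M, forall n, (M <= n)%N -> nr (f - P t n) <= e.
Let S t := sup [set psum t N | N in setT].

Let psumS t N : psum t N.+1 = psum t N + t N.
Proof. by rewrite /psum big_ord_recr. Qed.

Let psum_mono t M N : Delta t -> (M <= N)%N -> psum t M <= psum t N.
Proof.
move=> [t0 _]; elim: N => [|N IH]; first by rewrite leqn0 => /eqP->.
rewrite leq_eqVlt => /predU1P[->//|/IH H].
by rewrite psumS (le_trans H)// lerDl.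
Qed.

Let S_ub t N : Delta t -> psum t N <= S t.
Proof.
move=> [t0 t1]; apply: ub_le_sup; last by exists N.
by exists 1 => _ [M _ <-].
Qed.

Let S_le1 t : Delta t -> S t <= 1.
Proof. by move=> [t0 t1]; apply: ge_sup => [|_ [M _ <-]//]; exists (psum t 0), 0%N. Qed.

Let S_lim t e : Delta t -> 0 < e -> exists M, forall n, (M <= n)%N -> S t - e <= psum t n.
Proof.
move=> Dt e0; have hS : has_sup [set psum t N | N in setT].
  split; first by exists (psum t 0), 0%N.
  by exists 1 => _ [M _ <-]; have [_] := Dt.
have [_ [M _ <-] HM] := sup_adherent e0 hS.
by exists M => n Mn; rewrite (le_trans (ltW HM))// psum_mono.
Qed.

Let PB t M N : (M <= N)%N -> P t N - P t M = \sum_(M <= i < N) (t i)%:C%C *: (psi i - phi).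
Proof.
move=> MN; rewrite /P -!(big_mkord xpredT (fun i => (t i)%:C%C *: (psi i - phi))).
by rewrite (big_cat_nat (leq0n M) MN)//= opprD addrACA subrr add0r addrAC subrr add0r.
Qed.

Let psumB t M N : (M <= N)%N -> psum t N - psum t M = \sum_(M <= i < N) t i.
Proof.
move=> MN; rewrite /psum -!(big_mkord xpredT t).
by rewrite (big_cat_nat (leq0n M) MN)//= addrAC subrr add0r.
Qed.

Let P_dist t M N : Delta t -> (M <= N)%N -> nr (P t N - P t M) <= 2 * (psum t N - psum t M).
Proof.
move=> [t0 _] MN; rewrite PB// psumB// mulr_sumr (le_trans (nr_sum _ _ _))//.
apply: ler_sum => i _; rewrite nrZR ger0_norm// mulrC ler_wpM2r//.
by rewrite (le_trans (nrB _ _))// mulr2n lerD.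
Qed.

Let rep_ex t : Delta t -> exists f, rep t f.
Proof.
move=> Dt; have [|f Hf] := @dual_complete _ _ (P t).
  move=> e e0; have e2 : 0 < e / 2 by rewrite divr_gt0.
  have [M HM] := S_lim Dt e2; exists M => m n Mm Mn.
  wlog mn : m n Mm Mn / (m <= n)%N => [H|].
    by have [/H|/ltnW/H] := leqP m n; [exact|rewrite nr_sub; exact].
  rewrite nr_sub (le_trans (P_dist Dt mn))// -ler_pdivlMl// mulrC.
  by have := HM m Mm; have := S_ub n Dt; lra.
by exists f => e /Hf[M HM]; exists M => n Mn; rewrite nr_sub HM.
Qed.

Let PBt t t' N : P t N - P t' N =
  \sum_(i < N) (t i - t' i)%:C%C *: psi i + (- (psum t N - psum t' N))%:C%C *: phi.
Proof.
rewrite /P opprD addrACA subrr add0r -sumrB /psum -sumrB rmorphN rmorph_sum scaleNr.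
rewrite scaler_suml -sumrB; apply: eq_bigr => i _.
by rewrite rmorphB; lmod.
Qed.

(** The hypothesis [l1] passed to the limit: half of the isometry between [C] and pairs of a
    sequence and its mass. *)
Let lower t t' f f' e : rep t f -> rep t' f' -> 0 < e -> exists M, forall n, (M <= n)%N ->
  \sum_(i < n) `|t i - t' i| + `|psum t n - psum t' n| <= nr (f - f') + e.
Proof.
move=> rf rf' e0; have e2 : 0 < e / 2 by rewrite divr_gt0.
have [M1 H1] := rf _ e2; have [M2 H2] := rf' _ e2.
exists (maxn M1 M2) => n; rewrite geq_max => /andP[n1 n2].
have := l1 n (fun i => t i - t' i) (- (psum t n - psum t' n)).
rewrite -PBt normrN => /le_trans; apply.
have -> : P t n - P t' n = (f - f') - ((f - P t n) - (f' - P t' n)) by lmod.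
rewrite (le_trans (nrB _ _))// lerD// (le_trans (nrB _ _))// (splitr e) lerD//.
  exact: H1.
exact: H2.
Qed.

(** Terms from [N] on contribute at most [d] times their mass, hence at most [d], whatever [t] is;
    this uniformity yields compactness. *)
Let tail t f x N d : Delta t -> rep t f ->
  (forall n, (N <= n)%N -> nr (psi n x - phi x) <= d) -> 0 <= d ->
  nr (f x - P t N x) <= d.
Proof.
move=> Dt rf Hd d0; apply/ler_addgt0Pr => e e0.
have x0 : 0 < nr x + 1 by rewrite ltr_wpDl ?nr_ge0.
have [M HM] := rf (e / (nr x + 1)) ltac:(by rewrite divr_gt0).
pose n := maxn M N.
have -> : f x - P t N x = (f - P t n) x + (P t n - P t N) x.
  by rewrite !dualB; ring.
rewrite (le_trans (nrD _ _))// addrC lerD//.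
  rewrite PB ?leq_maxr//.
  have -> : (\sum_(N <= i < n) (t i)%:C%C *: (psi i - phi)) x =
      \sum_(N <= i < n) (t i)%:C%C * (psi i x - phi x).
    by elim/big_ind2 : _ => // f1 z1 f2 z2 <- <-.
  rewrite (le_trans (nr_sum _ _ _))// (@le_trans _ _ (\sum_(N <= i < n) t i * d))//.
    rewrite big_nat [leRHS]big_nat; apply: ler_sum => i /andP[Ni _].
    by rewrite nrM nrR ger0_norm ?Dt.1// ler_wpM2l ?Dt.1// Hd.
  rewrite -mulr_suml -psumB ?leq_maxr// ler_piMl//.
  have := Dt.2 n; have : 0 <= psum t N by apply: sumr_ge0 => i _; exact: Dt.1.
  lra.
rewrite (le_trans (nr_dual _ _))// (@le_trans _ _ (nr (f - P t n) * (nr x + 1)))//.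
  by rewrite ler_wpM2l ?nr_ge0// lerDl.
by rewrite -ler_pdivlMr// HM// leq_maxl.
Qed.

Let C : set (dual X) := [set f | exists2 t, Delta t & rep t f].

Let psum_convex t t' (a b : R) N :
  psum (fun n => a * t n + b * t' n) N = a * psum t N + b * psum t' N.
Proof. by rewrite /psum big_split /= -!mulr_sumr. Qed.

Let C_convex : convex_set C.
Proof.
apply/convex_setE => f g a [t Dt rf] [t' Dt' rg] /andP[a0 a1].
have b0 : 0 <= 1 - a by rewrite subr_ge0.
exists (fun n => a * t n + (1 - a) * t' n).
  split=> [n|N]; first by rewrite addr_ge0// mulr_ge0// ?Dt.1 ?Dt'.1.
  rewrite psum_convex (@le_trans _ _ (a * 1 + (1 - a) * 1))//; last by lra.
  by rewrite lerD// ler_wpM2l// ?Dt.2 ?Dt'.2.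
move=> e e0; have e2 : 0 < e / 2 by rewrite divr_gt0.
have [M1 H1] := rf _ e2; have [M2 H2] := rg _ e2.
exists (maxn M1 M2) => n; rewrite geq_max => /andP[n1 n2].
have -> : a%:C%C *: f + (1 - a)%:C%C *: g - P (fun n => a * t n + (1 - a) * t' n) n =
    a%:C%C *: (f - P t n) + (1 - a)%:C%C *: (g - P t' n).
  rewrite !scalerBr addrACA -opprD; congr (_ - _); rewrite /P !scalerDr addrACA.
  rewrite -scalerDl -rmorphD (_ : a + (1 - a) = 1) ?rmorph1 ?scale1r; last by ring.
  congr (_ + _).
  rewrite !scaler_sumr -big_split; apply: eq_bigr => i _ /=.
  by rewrite rmorphD !rmorphM rmorphB; lmod.
rewrite (le_trans (nrD _ _))// !nrZR !ger0_norm// (@le_trans _ _ (a * e + (1 - a) * e))//.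
  have h (y : R) : y <= e / 2 -> y <= e by move=> /le_trans; apply; lra.
  by rewrite lerD// ler_wpM2l// h ?H1 ?H2.
lra.
Qed.

(** Coordinates converge along the ultrafilter, and mass that escapes to infinity ends up at [phi];
    this is why [Delta] contains sequences of mass less than one. [tail] reduces convergence at [x]
    to finitely many coordinates. *)
Let C_compact : compact (C : set (weak_star X)).
Proof.
rewrite compact_ultra => F FU FC.
have FF : ProperFilter F by exact: ultra_proper.
have [tau Htau] : exists tau : dual X -> nat -> R,
    forall f, C f -> Delta (tau f) /\ rep (tau f) f.
  suff /choice[tau H] : forall f, exists t, C f -> Delta t /\ rep t f by exists tau.
  move=> f; have [[t Dt rt]|nC] := pselect (C f); first by exists t.
  by exists (fun=> 0).
have [t Ht] : exists t : nat -> R, forall n, ulimr F (fun f : dual X => tau f n) (t n).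
  suff /choice[t H] : forall n, exists l, ulimr F (fun f : dual X => tau f n) l by exists t.
  move=> n; apply: (@ulimr_ex _ _ _ _ 1) => //; apply: filterS FC => f Cf /=.
  have [[t0 t1] _] := Htau f Cf; rewrite ger0_norm// (le_trans _ (t1 n.+1))// psumS lerDr.
  by apply: sumr_ge0 => i _.
have psum_lim N : ulimr F (fun f : dual X => psum (tau f) N) (psum t N).
  elim: N => [|N IH] e e0.
    by apply: filterS filterT => f _ /=; rewrite /psum !big_ord0 subrr normr0 ltW.
  have e2 : 0 < e / 2 by rewrite divr_gt0.
  apply: filterS (filterI (IH _ e2) (Ht N _ e2)) => f /= [h1 h2].
  by rewrite !psumS opprD addrACA (splitr e) (le_trans (ler_normD _ _))// lerD.
have Dt : Delta t.
  split=> [n|N]; rewrite leNgt; apply/negP => bad.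
    have e0 : 0 < - t n / 2 by lra.
    have [f /= [Cf]] := filter_ex (filterI FC (Ht n _ e0)).
    have [[t0 _] _] := Htau f Cf; have := t0 n.
    by rewrite ler_norml => a /andP[_ b]; lra.
  have e0 : 0 < (psum t N - 1) / 2 by lra.
  have [f /= [Cf]] := filter_ex (filterI FC (psum_lim N _ e0)).
  have [[_ t1] _] := Htau f Cf; have := t1 N.
  by rewrite ler_norml => a /andP[b _]; lra.
have [f rf] := rep_ex Dt; exists f; split; first by exists t.
apply/weak_star_cvgP => x e e0.
have e4 : 0 < e / 4 by rewrite divr_gt0.
have [N HN] := psi_phi x e4.
have Plim : ulim F (fun g : dual X => P (tau g) N x) (P t N x).
  have PE s : P s N x = phi x + \sum_(i < N) (psi i x - phi x) * (s i)%:C%C.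
    rewrite /P dualD; congr (_ + _).
    by elim/big_ind2 : _ => // [f1 z1 f2 z2 <- <-//|i _]; rewrite dualZ dualB mulrC.
  under eq_fun do rewrite PE; rewrite PE.
  apply: ulimD; first exact: ulim_cst.
  apply: (@ulim_sum _ _ _ _ N (fun i g => (psi i x - phi x) * (tau g i)%:C%C)
    (fun i => (psi i x - phi x) * (t i)%:C%C)) => i _.
  apply: ulimZ => d d0; apply: filterS (Ht i d d0) => g /=.
  by rewrite -rmorphB nrR.
have e2 : 0 < e / 2 by rewrite divr_gt0.
apply: filterS (filterI FC (Plim _ e2)) => g /= [Cg gP].
have [Dg rg] := Htau g Cg.
have -> : g x - f x = (g x - P (tau g) N x) + (P (tau g) N x - P t N x) - (f x - P t N x) by ring.
have -> : e = e / 4 + e / 2 + e / 4 by field.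
rewrite (le_trans (nrB _ _))// lerD ?(tail Dt rf HN) ?(ltW e4)//.
by rewrite (le_trans (nrD _ _))// lerD// (tail Dg rg HN)// ltW.
Qed.

Let shift t : nat -> R := fun n => if n is m.+1 then t m else 1 - S t.

Let psum_shift t N : psum (shift t) N.+1 = 1 - S t + psum t N.
Proof. by rewrite /psum big_ord_recl. Qed.

Let shift_Delta t : Delta t -> Delta (shift t).
Proof.
move=> Dt; split=> [[|n]|[|N]] /=; rewrite ?subr_ge0 ?S_le1//; first exact: Dt.1.
  by rewrite /psum big_ord0.
by rewrite psum_shift; have := S_ub N Dt; lra.
Qed.

Let S_dist t t' e : Delta t -> Delta t' -> 0 < e -> exists M, forall n, (M <= n)%N ->
  `|(psum t n - psum t' n) - (S t - S t')| <= e.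
Proof.
move=> Dt Dt' e0; have [M1 H1] := S_lim Dt e0; have [M2 H2] := S_lim Dt' e0.
exists (maxn M1 M2) => n; rewrite geq_max => /andP[n1 n2].
have := H1 n n1; have := H2 n n2; have := S_ub n Dt; have := S_ub n Dt'.
by move=> *; rewrite ler_norml; apply/andP; split; lra.
Qed.

(** A shifted sequence has total mass one, so the coefficient of [phi] disappears, and its new first
    term contributes just the difference of the masses: the distance of images is at most the bound
    in [lower]. A fixed point would come from [t = shift t], a constant and summable, hence zero
    sequence, whose first term is [1 - S t = 1]. *)
Lemma shift_no_fixed_point : ~ weak_star_fpp X.
Proof.
move=> fpp.
have CX : weak_star_compact_convex C.
  have D0 : Delta (fun=> 0) by split=> [n|N]; rewrite /psum ?big1.
  split; [|exact: C_compact|exact: C_convex].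
  by have [f rf] := rep_ex D0; exists f; exists (fun=> 0).
have [T HT] : exists T : dual X -> dual X, forall f, C f ->
    exists t, [/\ Delta t, rep t f & rep (shift t) (T f)].
  suff /choice[T H] : forall f, exists g, C f ->
    exists t, [/\ Delta t, rep t f & rep (shift t) g] by exists T.
  move=> f; have [[t Dt rt]|nC] := pselect (C f); last by exists 0.
  by have [g rg] := rep_ex (shift_Delta Dt); exists g => _; exists t.
have CT : {homo T : x / C x}.
  by move=> f /HT[t [Dt rt rT]]; exists (shift t) => //; exact: shift_Delta.
have nT : nonexpansive_on C T.
  move=> f g Cf Cg; have [t [Dt rf rTf]] := HT f Cf; have [s [Ds rg rTg]] := HT g Cg.
  rewrite !nrE lecR; apply/ler_addgt0Pr => e e0.
  have e6 : 0 < e / 6 by rewrite divr_gt0.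
  have [M1 H1] := lower rf rg e6.
  have [M2 H2] := S_dist Dt Ds e6.
  have [M3 H3] := rTf _ e6; have [M4 H4] := rTg _ e6.
  pose n := maxn (maxn M1 M2) (maxn M3 M4).
  have n1 : (M1 <= n)%N by rewrite !leq_max leqnn.
  have n2 : (M2 <= n)%N by rewrite !leq_max leqnn orbT.
  have n3 : (M3 <= n.+1)%N by rewrite leqW// !leq_max leqnn !orbT.
  have n4 : (M4 <= n.+1)%N by rewrite leqW// !leq_max leqnn !orbT.
  have -> : T f - T g = (T f - P (shift t) n.+1) - (T g - P (shift s) n.+1) +
    (P (shift t) n.+1 - P (shift s) n.+1) by lmod.
  have K : nr (P (shift t) n.+1 - P (shift s) n.+1) <= nr (f - g) + e / 6 + e / 6 + e / 6.
    rewrite PBt !psum_shift; set d := - _.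
    have dE : `|d| <= e / 6.
      have -> : d = - (psum t n - psum s n - (S t - S s)) by rewrite /d; ring.
      by rewrite normrN H2.
    rewrite (le_trans (nrD _ _))// lerD//; last first.
      by rewrite nrZR (le_trans _ dE)// ler_piMr.
    rewrite (le_trans (nr_sum _ _ _))// (@le_trans _ _ (\sum_(i < n.+1) `|shift t i - shift s i|))//.
      by apply: ler_sum => i _; rewrite nrZR ler_piMr.
    have D : `|1 - S t - (1 - S s)| <= `|psum t n - psum s n| + e / 6.
      have -> : 1 - S t - (1 - S s) = - (psum t n - psum s n) + (psum t n - psum s n - (S t - S s)).
        by ring.
      by rewrite (le_trans (ler_normD _ _))// normrN lerD// H2.
    rewrite big_ord_recl /=; apply: le_trans (lerD D (lexx _)) _.
    by have := H1 n n1; under [X in _ -> _ + X <= _]eq_bigr do rewrite /bump /=; lra.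
  rewrite (le_trans (nrD _ _))// (le_trans (lerD (nrB _ _) K))//.
  by have := H3 _ n3; have := H4 _ n4; lra.
have [f [Cf fE]] := fpp C CX T CT nT.
have [t [Dt rf rT]] := HT f Cf; rewrite fE in rT.
have tE n : t n = shift t n.
  apply/eqP; rewrite -subr_eq0 -normr_le0; apply/ler_addgt0Pr => e e0; rewrite add0r.
  have [M HM] := lower rf rT e0.
  have := HM (maxn M n.+1) (leq_maxl _ _); rewrite subrr nr0 add0r => /(le_trans _); apply.
  have nM : (n < maxn M n.+1)%N by rewrite leq_maxr.
  rewrite (bigD1 (Ordinal nM))//= -addrA lerDl addr_ge0//.
  by apply: sumr_ge0.
have tc n : t n = t 0%N by elim: n => // n <-; rewrite tE.
have t0 : t 0%N = 0.
  apply/eqP; rewrite eq_le Dt.1 andbT; apply/ler_addgt0Pr => e e0; rewrite add0r.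
  have [N HN] : exists N : nat, e^-1 < N%:R.
    by exists (Num.truncn e^-1).+1; rewrite truncnS_gt.
  have := Dt.2 N; rewrite /psum (eq_bigr (fun=> t 0%N)) => [|i _]; last by rewrite tc.
  rewrite sumr_const card_ord -mulr_natr => H; rewrite leNgt; apply/negP => et.
  have N0 : 0 < N%:R :> R by rewrite (lt_trans _ HN)// invr_gt0.
  have : 1 < t 0%N * N%:R.
    apply: (@lt_trans _ _ (e * N%:R)); last by rewrite ltr_pM2r.
    by rewrite -ltr_pdivrMl// mulr1.
  by rewrite ltNge H.
have := tE 0%N; rewrite /= t0.
have -> : S t = 0; last by rewrite subr0 => /esym/eqP; rewrite oner_eq0.
apply/eqP; rewrite eq_le; apply/andP; split.
  apply: ge_sup; first by exists (psum t 0), 0%N.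
  by move=> _ [N _ <-]; rewrite /psum big1// => i _; rewrite tc.
by have := S_ub 0 Dt; rewrite /psum big_ord0.
Qed.

End shift_map.

Lemma dual_sum {R : realType} {X : normedModType R[i]} (I : Type) (r : seq I)
  (f : I -> dual X) x : (\sum_(i <- r) f i) x = \sum_(i <- r) f i x.
Proof. by elim/big_ind2 : _ => // g1 z1 g2 z2 <- <-. Qed.

(** * Sequences of states spanning a copy of [l^1] *)

Section state_limits.
Context {R : realType} {A : cStarAlgType R}.
Local Notation U := (unitization A).
Local Notation "t %:u" := (t%:C%C *: (1 : U)) (at level 2, format "t %:u").
Implicit Types (x y b c : U) (f g : dual A).

Lemma dense_seq : separable_space A ->
  exists d : nat -> A, forall (x : A) (e : R), 0 < e -> exists n, nr (x - d n) <= e.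
Proof.
move=> [D /countable_injP[h hI] Dd].
suff /choice[d Hd] : forall n, exists y : A, forall x : A, D x -> h x = n -> y = x.
  exists d => x e e0.
  have [||y [/= xy Dy]] := Dd (ball x (e%:C%C : R[i])).
  - by exists x; apply: ballxx; rewrite gt0C.
  - by apply: ball_open; rewrite gt0C.
  exists (h y); rewrite (Hd _ y)// nr_le.
  by move: xy; rewrite -ball_normE => /ltW.
move=> n; have [[y [Dy hy]]|H] := pselect (exists y : A, D y /\ h y = n).
  by exists y => x Dx hx; apply: hI; rewrite ?inE// hx.
by exists 0 => x Dx hx; case: H; exists x.
Qed.

Lemma ext_uin f a : ext f (uin a) = f a.
Proof. by rewrite ext_inA. Qed.

Lemma udecomp x : x = x.1 *: 1 + uin x.2.
Proof. by rewrite uscalarE; apply: uext; rewrite /= ?addr0// add0r. Qed.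

Lemma state_compress f b : state f -> 0 < ext f (ustar b * b) ->
  exists g, state g /\ forall x, ext g x = ext f (ustar b * x * b) / ext f (ustar b * b).
Proof.
move=> sf; set k := ext _ _ => k0.
have [g Hg] : exists g : dual A, forall a, g a = ext f (ustar b * uin a * b) / k.
  apply: (@bounded_dual _ _ _ (un b ^+ 2 * nr k^-1)) => [l x y|x].
    by rewrite uinD uinZ mulrDr mulrDl scale_mulr scale_mull ext_lin mulrDl mulrA.
  rewrite nrM mulrAC ler_wpM2r ?nr_ge0// (le_trans (state_le sf _))//.
  rewrite (le_trans (unM _ _))// expr2 mulrAC ler_wpM2r ?un_ge0//.
  by rewrite (le_trans (unM _ _))// un_star un_uin.
have E x : ext g x = ext f (ustar b * x * b) / k.
  rewrite {2}(udecomp x) mulrDr mulrDl scale_mulr mulr1 scale_mull ext_lin -/k mulrDl.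
  by rewrite mulfK ?gt_eqF// -Hg.
exists g; split=> // x; rewrite E divr_ge0 ?(ltW k0)//.
have -> : ustar b * (ustar x * x) * b = ustar (x * b) * (x * b) by rewrite ustarM !mulrA.
exact: sf.
Qed.

(** Compressing by [b] a state that does not vanish at [ustar b * b] gives value one at [c], because
    [c * b = b]. *)
Lemma node_state c : node c -> exists f, state f /\ ext f c = 1.
Proof.
move=> [_ _ _ [b [_ b0 cb]]]; have [f [sf fb]] := state_exists b0.
have [g [sg gE]] := state_compress sf fb; exists g; split=> //.
by rewrite gE -mulrA cb divff// gt_eqF.
Qed.

Lemma state_ulim (T : Type) (F : set_system T) (g : T -> dual A) : UltraFilter F ->
  (forall t, state (g t)) ->
  exists f, state f /\ forall x, ulim F (fun t => ext (g t) x) (ext f x).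
Proof.
move=> FU sg; have FF : ProperFilter F by exact: ultra_proper.
have [||f _ Hf] := @ultra_dual _ _ _ F g 1 => //.
  by apply: filterS filterT => t _; exact: state_norm.
have H x : ulim F (fun t => ext (g t) x) (ext f x).
  by apply: ulimD; [exact: ulim_cst|exact: Hf].
exists f; split=> // x; apply: (ulim_ge0 FF (H _)).
by apply: filterS filterT => t _; exact: sg.
Qed.

Lemma free_ultrafilter : exists F : set_system nat,
  UltraFilter F /\ forall M, F [set n | (M <= n)%N].
Proof.
have [G [GU sG]] := ultraFilterLemma eventually_filter.
by exists G; split=> // M; apply: sG; exists M.
Qed.

(** The [k]-th index is taken beyond the previous ones, where the first [k] members of the dense
    sequence are matched up to the inverse of [k.+1]; states are contractions, which extends
    convergence to all of [A]. The set built by [shift_no_fixed_point] needs a true sequence. *)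
Lemma state_subseq (psi : nat -> dual A) (phi : dual A) (F : set_system nat) (d : nat -> A) :
  ProperFilter F -> (forall M, F [set n | (M <= n)%N]) ->
  (forall (x : A) (e : R), 0 < e -> exists n, nr (x - d n) <= e) ->
  (forall n, state (psi n)) -> state phi ->
  (forall x, ulim F (fun t => ext (psi t) x) (ext phi x)) ->
  exists s : nat -> nat, (forall m n, (m < n)%N -> (s m < s n)%N) /\
    forall x : A, nnull (fun n => nr (psi (s n) x - phi x)).
Proof.
move=> FF Ffree dd spsi sphi lim.
pose Q k n := forall i, (i < k)%N -> nr (psi n (d i) - phi (d i)) <= k.+1%:R^-1.
have FQ k j : F [set n | forall i, (i < j)%N -> nr (psi n (d i) - phi (d i)) <= k.+1%:R^-1].
  elim: j => [|j IH]; first by apply: filterS filterT.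
  have := lim (uin (d j)) k.+1%:R^-1 ltac:(by rewrite invr_gt0).
  move=> H; apply: filterS (filterI IH H) => n /= [h1 h2] i.
  rewrite ltnS leq_eqVlt => /predU1P[->|/h1//].
  by rewrite !ext_uin in h2.
have [g Hg] : exists g : nat * nat -> nat, forall mk, (mk.1 <= g mk)%N /\ Q mk.2 (g mk).
  suff /choice[g Hg] : forall mk : nat * nat, exists n, (mk.1 <= n)%N /\ Q mk.2 n.
    by exists g.
  move=> [m k]; have [n /= [h1 h2]] := filter_ex (filterI (Ffree m) (FQ k k)).
  by exists n.
pose s := fix s k := if k is j.+1 then g ((s j).+1, k) else g (0%N, 0%N).
have sS k : (s k < s k.+1)%N by have [] := Hg ((s k).+1, k.+1).
have sQ k : Q k (s k) by case: k => [|k]; [have [] := Hg (0%N, 0%N)|have [] := Hg ((s k).+1, k.+1)].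
exists s; split.
  move=> m; elim=> // n IH; rewrite ltnS leq_eqVlt => /predU1P[->//|/IH H].
  exact: ltn_trans (sS n).
move=> x e e0; have e3 : 0 < e / 3 by rewrite divr_gt0.
have [i Hi] := dd x _ e3.
pose M := (Num.truncn (e / 3)^-1).+1.
have HM : (e / 3)^-1 < M%:R by rewrite truncnS_gt.
exists (maxn i.+1 M) => n; rewrite geq_max => /andP[ni nM].
have -> : psi (s n) x - phi x = psi (s n) (x - d i) +
   (psi (s n) (d i) - phi (d i)) - phi (x - d i) by rewrite !linearB /=; move: (psi _ _) (phi _) (psi _ _) (phi _) => *; ring.
have -> : e = e / 3 + e / 3 + e / 3 by field.
have B f : state f -> nr (f (x - d i)) <= e / 3.
  move=> sf; rewrite (le_trans (nr_dual _ _))// (le_trans _ Hi)//.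
  by rewrite ler_piMl ?nr_ge0// state_norm.
rewrite (le_trans (nrB _ _))// lerD ?B// (le_trans (nrD _ _))// lerD ?B//.
rewrite (le_trans (sQ n i ni))// -[leRHS]invrK lef_pV2 ?posrE ?invr_gt0//.
by rewrite (le_trans (ltW HM))// ler_nat leqW.
Qed.

Lemma upos1B_sq x : usa x -> un x <= 1 -> upos (1 - x * x).
Proof.
move=> sx x1; have -> : 1 - x * x = (1 - un (x * x))%:u + ((un (x * x))%:u - x * x).
  by rewrite rmorphB rmorph1; lmod.
apply: uposD; last exact/upos_norm_sub/usaX.
by apply: uposr; rewrite subr_ge0 unX2// expr_le1// un_ge0.
Qed.

(** The square root [s] of [1 - x * x] commutes with [y], and [1 - (x + y)^2] equals
    [s * (1 - y * y) * s]. *)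
Lemma un_orthogonal x y : usa x -> usa y -> x * y = 0 -> y * x = 0 ->
  un x <= 1 -> un y <= 1 -> un (x + y) <= 1.
Proof.
move=> sx sy xy yx x1 y1.
have [s [ps ss sc]] := upos_sqrt (upos1B_sq sx x1).
have ys : y * s = s * y by apply: sc; expand; rewrite yx -!mulrA xy !(mulr0, mul0r).
have sxy : usa (x + y) by exact: usaD.
have H : upos (1%:u - (x + y) * (x + y)).
  have -> : 1%:u - (x + y) * (x + y) = ustar s * (1 - y * y) * s.
    rewrite (upos_sa ps) mulrBr mulr1 mulrBl ss.
    have -> : s * (y * y) * s = y * y * (s * s) by rewrite !mulrA -ys -!mulrA; congr (_ * _); rewrite !mulrA -ys -!mulrA.
    rewrite ss mulrBr mulr1 (_ : y * y * (x * x) = 0) ?subr0; last first.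
      by rewrite mulrA -(mulrA y) yx mulr0 mul0r.
    by rewrite rmorph1; expand; rewrite xy yx; lmod.
  by apply: upos_conj; exact: upos1B_sq.
have := un_le_pos (upos_sq sxy) H; rewrite unX2// => /le_trans.
by move=> /(_ 1 (lexx _)); rewrite expr_le1 ?un_ge0.
Qed.

Lemma ext_sum f (I : Type) (r : seq I) (x : I -> U) :
  ext f (\sum_(i <- r) x i) = \sum_(i <- r) ext f (x i).
Proof. exact: (big_morph _ (extD f) (ext0 f)). Qed.

Theorem atomic_of_fpp : separable_space A -> weak_star_fpp A -> @atomic R A.
Proof.
move=> /dense_seq[d dd] fpp; apply: contrapT => /not_atomic_comb[a [c cb]].
have [_ Nc _ _ _] := cb.
have /choice[psi0 Hpsi0] := fun n => node_state (Nc n).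
have [F [FU Ffree]] := free_ultrafilter.
have FF : ProperFilter F by exact: ultra_proper.
have [phi [sphi lim]] := state_ulim FU (fun n => (Hpsi0 n).1).
have [s [sm slim]] := state_subseq FF Ffree dd (fun n => (Hpsi0 n).1) sphi lim.
have sI m n : m != n -> s m != s n.
  by rewrite neq_ltn => /orP[]/sm; rewrite neq_ltn => ->; rewrite ?orbT.
have sle m n : (m <= n)%N -> (s m <= s n)%N.
  by rewrite leq_eqVlt => /predU1P[->//|/sm/ltnW].
have [Ha _ cc ac ac0] := cb.
have mulc n x : ext (psi0 n) x = ext (psi0 n) (x * c n).
  have [_ sc c1 _] := Nc n; have [sp p1] := Hpsi0 n.
  by have [] := state_unit sp x sc c1 p1.
have psi_a_lt m n : (n < m)%N -> ext (psi0 m) (a n) = 1.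
  by move=> nm; rewrite mulc ac// (Hpsi0 m).2.
have psi_a_le m n : (m <= n)%N -> ext (psi0 m) (a n) = 0.
  by move=> nm; rewrite mulc ac0// ext0.
have psi_c m n : m != n -> ext (psi0 m) (c n) = 0.
  by move=> mn; rewrite mulc cc ?ext0// eq_sym.
have phi_a n : ext phi (a n) = 1.
  by apply: (ulim_eq FF (lim _)); apply: filterS (Ffree n.+1) => m; exact: psi_a_lt.
have phi_c n : ext phi (c n) = 0.
  apply: (ulim_eq FF (lim _)); apply: filterS (Ffree n.+1) => m /= nm; apply: psi_c.
  by rewrite neq_ltn nm orbT.
apply: (@shift_no_fixed_point _ _ (psi0 \o s) phi) fpp.
- by move=> n; apply: state_norm; have [] := Hpsi0 (s n).
- exact: state_norm.
- exact: slim.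
move=> N t v.
(* The norming element. [psi0 (s i)] sees only the term [c (s i)], as it vanishes at [a (s N)] for
   [i <= N], and [phi] sees only [a (s N)]. Each added term is orthogonal to the previous ones, so
   the norm stays at most one. *)
pose x n : U := \sum_(i < n) (Num.sg (t i))%:C%C *: c (s i) + (Num.sg v)%:C%C *: a (s N).
have sg1 (r : R) y : un y <= 1 -> un ((Num.sg r)%:C%C *: y) <= 1.
  move=> y1; rewrite unZR (le_trans _ y1)// ler_piMl ?un_ge0//.
  by rewrite normr_sg; case: (r == 0).
have Hx n : (n <= N)%N -> [/\ inA (x n), usa (x n), un (x n) <= 1
    & forall j, (n <= j)%N -> (j <= N)%N -> x n * c (s j) = 0].
  elim: n => [_|n IH nN].
    have [Aa sa a1] := Ha (s N).
    rewrite /x big_ord0 add0r; split; [exact: inAZ|exact: usaZ|exact: sg1|].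
    by move=> j _ jN; rewrite scale_mull ac0 ?scaler0// sle.
  have [Ax sx x1 xc] := IH (ltnW nN); have [Ac sc c1 _] := Nc (s n).
  have xE : x n.+1 = x n + (Num.sg (t n))%:C%C *: c (s n).
    by rewrite /x big_ord_recr /= addrAC.
  have xcn := xc n (leqnn _) (ltnW nN).
  have cxn : c (s n) * x n = 0.
    by have := congr1 ustar xcn; rewrite ustarM sx sc ustar0.
  rewrite xE; split.
  - by apply: inAD => //; exact: inAZ.
  - by apply: usaD => //; exact: usaZ.
  - apply: un_orthogonal => //; first exact: usaZ.
    + by rewrite scale_mulr xcn scaler0.
    + by rewrite scale_mull cxn scaler0.
    + exact: sg1.
  move=> j nj jN; rewrite mulrDl xc// ?(ltnW nj)// scale_mull cc ?scaler0 ?addr0//.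
  by apply: sI; rewrite neq_ltn nj.
have [Ax sx x1 _] := Hx N (leqnn _).
have x21 : nr (x N).2 <= 1 by rewrite -un_uin -(uinP Ax).
set f := (X in _ <= nr X); have := nr_dual f (x N).2.
move=> /le_trans /(_ (ler_piMr (nr_ge0 f) x21)); apply: le_trans.
have psix i : (i < N)%N -> psi0 (s i) (x N).2 = (Num.sg (t i))%:C%C.
  move=> iN; rewrite -ext_inA// /x extD ext_sum extZ psi_a_le ?sle 1?ltnW// mulr0 addr0.
  rewrite (bigD1 (Ordinal iN))//= extZ (Hpsi0 (s i)).2 mulr1 big1 ?addr0// => j /eqP ji.
  rewrite extZ psi_c ?mulr0//; apply: sI; apply/eqP => ij; apply: ji.
  exact/val_inj.
have phix : phi (x N).2 = (Num.sg v)%:C%C.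
  rewrite -ext_inA// /x extD ext_sum extZ phi_a mulr1 big1 ?add0r// => j _.
  by rewrite extZ phi_c mulr0.
have -> : f (x N).2 = (\sum_(i < N) `|t i| + `|v|)%:C%C.
  rewrite /f dualD dualZ phix rmorphD rmorph_sum; congr (_ + _); last first.
    by rewrite -rmorphM normrEsg mulrC.
  rewrite dual_sum; apply: eq_bigr => i _; rewrite dualZ /= psix//.
  by rewrite -rmorphM normrEsg mulrC.
by rewrite nrR ler_norm.
Qed.

End state_limits.

(** * Single maps as actions of the additive semigroup of natural numbers *)

Definition nat_add : Type := nat.

Section nat_add.
Implicit Types m n : nat_add.

HB.instance Definition _ := Choice.copy nat_add nat.
HB.instance Definition _ := DiscreteTopology.copy nat_add nat.

Let mul m n : nat_add := (m + n)%N.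

Let mulA : associative mul. Proof. exact: addnA. Qed.

HB.instance Definition _ := hasMul.Build nat_add mul.
HB.instance Definition _ := Magma_isSemigroup.Build nat_add mulA.

Lemma nat_add_mul m n : monoid.mul m n = (m + n)%N. Proof. by []. Qed.

Lemma nat_add_continuous (T : topologicalType) (f : nat_add -> T) : continuous f.
Proof. move=> n B /nbhs_singleton Bn; have := @discrete_set1 nat_add n.
by apply: (@filterS _ (nbhs n)) => _ ->. Qed.

HB.instance Definition _ := isSemitopologicalSemigroup.Build nat_add
  (@discrete_hausdorff nat_add) (fun a => @nat_add_continuous _ _)
  (fun a => @nat_add_continuous _ _).

Lemma nat_add_left_reversible : left_reversible nat_add.
Proof.
move=> I J [i Ii] _ rI [j Jj] _ rJ; exists (monoid.mul i j); split; first exact: rI.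
by rewrite nat_add_mul addnC; exact: rJ.
Qed.

End nat_add.

Section iterates.
Context {R : realType} {E : normedModType R[i]}.
Variables (C : set E) (T : E -> E).
Hypotheses (CT : {homo T : x / C x}) (nT : nonexpansive_on C T).

Lemma nonexpansive_continuous (S : E -> E) : nonexpansive_on C S -> {within C, continuous S}.
Proof.
move=> nS; apply/subspace_continuousP => x Cx; apply/cvgrPdist_le => e e0.
rewrite /within/=; apply: filterS (nbhsx_ballx x e e0) => y; rewrite -ball_normE => xy Cy.
exact: le_trans (nS x y Cx Cy) (ltW xy).
Qed.

Lemma iter_homo n x : C x -> C (iter n T x).
Proof. by move=> Cx; elim: n => // n IH; exact: CT. Qed.

Lemma iter_nonexpansive n : nonexpansive_on C (iter n T).
Proof.
elim: n => // n IH x y Cx Cy; apply: le_trans (IH x y Cx Cy).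
by apply: nT; exact: iter_homo.
Qed.

End iterates.

Lemma fpp_of_left_reversible (R : realType) (X : normedModType R[i]) :
  weak_star_fpp_left_reversible X -> weak_star_fpp X.
Proof.
move=> H C CX T CT nT.
have [|||x [Cx Hx]] := H nat_add C (fun n => iter n T) nat_add_left_reversible CX.
- by split=> [s x|s t x Cx]; [exact: iter_homo|rewrite nat_add_mul iterD].
- split=> [s|x Cx]; last exact: nat_add_continuous.
  exact/nonexpansive_continuous/iter_nonexpansive.
- by move=> s; exact: iter_nonexpansive.
- by exists x; split=> //; exact: (Hx 1%N).
Qed.

(** * Compressions by finite sums of minimal projections *)

Section compressions.
Context {R : realType} {A : cStarAlgType R}.
Local Notation U := (unitization A).
Implicit Types (a b : A) (x y p e Q : U) (f g u v z : dual A) (t : R).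

Lemma umul2_lin (k : R[i]) x y (a b : A) :
  (x * uin (k *: a + b) * y).2 = k *: (x * uin a * y).2 + (x * uin b * y).2.
Proof. by rewrite uinD uinZ mulrDr mulrDl scale_mulr scale_mull. Qed.

Lemma dual_un f x : inA x -> nr (f x.2) <= nr f * un x.
Proof. by move=> Ax; rewrite (le_trans (nr_dual _ _))// {2}(uinP Ax) un_uin. Qed.

Lemma inA_mid x y (a : A) : inA (x * uin a * y).
Proof. exact/inAMr/inAMl. Qed.

Let cp_bound x f y (a : A) : nr (f (x * uin a * y).2) <= un x * un y * nr f * nr a.
Proof.
rewrite (le_trans (dual_un _ (inA_mid _ _ _)))//.
rewrite [leRHS](_ : _ = nr f * (un x * nr a * un y)); last by ring.
rewrite ler_wpM2l ?nr_ge0// (le_trans (unM _ _))// ler_wpM2r ?un_ge0//.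
by rewrite (le_trans (unM _ _))// un_uin.
Qed.

Let cp_ex x f y : exists g : dual A, forall a, g a = f (x * uin a * y).2.
Proof. by apply: bounded_dual (cp_bound x f y) => k b c; rewrite umul2_lin dualP. Qed.

Definition cp x f y : dual A := sval (cid (cp_ex x f y)).

Lemma cpE x f y a : cp x f y a = f (x * uin a * y).2.
Proof. by rewrite /cp; case: cid. Qed.

Lemma cp_inA x f y (b : U) : inA b -> cp x f y b.2 = f (x * b * y).2.
Proof. by move=> Ab; rewrite cpE -uinP. Qed.

Lemma cp_le x f y : nr (cp x f y) <= un x * un y * nr f.
Proof.
apply: dual_nr_le => [|a]; first by rewrite !mulr_ge0 ?un_ge0 ?nr_ge0.
by rewrite cpE.
Qed.

Lemma cp_contr x f y : un x <= 1 -> un y <= 1 -> nr (cp x f y) <= nr f.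
Proof.
move=> x1 y1; rewrite (le_trans (cp_le _ _ _))// ler_piMl ?nr_ge0//.
by rewrite mulr_ile1 ?un_ge0.
Qed.

Lemma cp_cp x x' f y y' : cp x (cp x' f y') y = cp (x' * x) f (y * y').
Proof.
apply: dual_ext => a; rewrite cpE cp_inA; last exact: inA_mid.
by rewrite cpE !mulrA.
Qed.

Lemma cp11 f : cp 1 f 1 = f.
Proof. by apply: dual_ext => a; rewrite cpE mul1r mulr1. Qed.

Lemma cpD x f g y : cp x (f + g) y = cp x f y + cp x g y.
Proof. by apply: dual_ext => a; rewrite dualD !cpE. Qed.

Lemma cpDl x x' f y : cp (x + x') f y = cp x f y + cp x' f y.
Proof.
apply: dual_ext => a; rewrite dualD !cpE !mulrDl.
by have := dualP f 1 (x * uin a * y).2 (x' * uin a * y).2; rewrite scale1r mul1r => <-.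
Qed.

Lemma cpDr x f y y' : cp x f (y + y') = cp x f y + cp x f y'.
Proof.
apply: dual_ext => a; rewrite dualD !cpE !mulrDr.
by have := dualP f 1 (x * uin a * y).2 (x * uin a * y').2; rewrite scale1r mul1r => <-.
Qed.

Lemma cp0l f y : cp 0 f y = 0.
Proof. by apply: dual_ext => a; rewrite cpE !mul0r dual0 linear0. Qed.

Lemma cp0r x f : cp x f 0 = 0.
Proof. by apply: dual_ext => a; rewrite cpE !mulr0 dual0 linear0. Qed.

Lemma dual_sq_le f t : 0 <= t -> (forall a : A, nr a <= 1 -> nr (f a) ^+ 2 <= t) ->
  nr f ^+ 2 <= t.
Proof.
move=> t0 H; rewrite -[leRHS]sqr_sqrtr// ler_sqr ?nnegrE ?nr_ge0 ?sqrtr_ge0//.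
apply: dual_nr_le => [|a]; first exact: sqrtr_ge0.
have [->|a0] := eqVneq a 0; first by rewrite linear0 !nr0 mulr0.
have na : 0 < nr a by rewrite lt_def nr_ge0 andbT; apply: contra_neq a0 => /nr0_eq0.
have i0 : 0 < (nr a)^-1 by rewrite invr_gt0.
have E : nr (f (((nr a)^-1)%:C%C *: a)) = nr (f a) / nr a.
  by rewrite linearZ /= nrM nrR gtr0_norm// mulrC.
rewrite -ler_pdivrMr// -E -ler_sqr ?nnegrE ?nr_ge0 ?sqrtr_ge0// sqr_sqrtr//.
by apply: H; rewrite nrZR gtr0_norm// mulVf ?gt_eqF.
Qed.

Definition uproj p := usa p /\ p * p = p.

Lemma uprojC p : uproj p -> uproj (1 - p).
Proof.
move=> [sp pp]; split; first by apply: usaB => //; exact: usa1.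
by expand; rewrite pp; lmod.
Qed.

Lemma uproj_un p : uproj p -> un p <= 1.
Proof. by move=> [sp pp]; exact: proj_un. Qed.

Lemma un_pythagoras p (a b : U) (s t : R[i]) : uproj p -> un a <= 1 -> un b <= 1 ->
  un (s *: (p * a) + t *: ((1 - p) * b)) ^+ 2 <= nr s ^+ 2 + nr t ^+ 2.
Proof.
move=> pp a1 b1; have [sq qq] := uprojC pp; have [sp p2] := pp.
have pq : p * (1 - p) = 0 by rewrite mulrBr mulr1 p2 subrr.
have qp : (1 - p) * p = 0 by rewrite mulrBl mul1r p2 subrr.
have q1 := uproj_un (uprojC pp); have p1 := uproj_un pp.
set q := 1 - p in sq qq pq qp q1 *; clearbody q.
rewrite -un_starM ustarD !ustarZ !ustarM sp sq.
have -> : (s^* *: (ustar a * p) + t^* *: (ustar b * q)) * (s *: (p * a) + t *: (q * b)) =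
  (s^* * s) *: (ustar a * p * a) + (t^* * t) *: (ustar b * q * b).
  rewrite mulrDl !mulrDr !(scale_mull, scale_mulr) !scalerA.
  have -> x y (X Y : U) : (ustar X * x) * (y * Y) = ustar X * (x * y) * Y by rewrite !mulrA.
  have -> x y (X Y : U) : (ustar X * x) * (y * Y) = ustar X * (x * y) * Y by rewrite !mulrA.
  have -> x y (X Y : U) : (ustar X * x) * (y * Y) = ustar X * (x * y) * Y by rewrite !mulrA.
  have -> x y (X Y : U) : (ustar X * x) * (y * Y) = ustar X * (x * y) * Y by rewrite !mulrA.
  by rewrite p2 qq pq qp !(mulr0, mul0r, scaler0, addr0, add0r).
have E (r : R[i]) x y : un x <= 1 -> un y <= 1 -> un ((r^* * r) *: (ustar x * y * x)) <= nr r ^+ 2.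
  move=> x1 y1; rewrite unZ nrM nr_conj -expr2 ler_piMr ?sqr_ge0//.
  rewrite (le_trans (unM _ _))// mulr_ile1 ?un_ge0// (le_trans (unM _ _))//.
  by rewrite mulr_ile1 ?un_ge0// un_star.
by rewrite (le_trans (unD _ _))// lerD// E.
Qed.

(** Taking [s] and [t] conjugate to [g a] and [h b] turns the hypothesis into
    [T ^+ 2 <= nr f ^+ 2 * T] for [T = nr (g a) ^+ 2 + nr (h b) ^+ 2]; then [a] and [b] vary. It
    supplies the convexity of the dual norm on which the fixed point theorem rests. *)
Let pyth f g (h : dual A) (H : forall (a b : A) (s t : R[i]), nr a <= 1 -> nr b <= 1 ->
  nr (s * g a + t * h b) ^+ 2 <= nr f ^+ 2 * (nr s ^+ 2 + nr t ^+ 2)) :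
  nr g ^+ 2 + nr h ^+ 2 <= nr f ^+ 2.
Proof.
have E (a b : A) : nr a <= 1 -> nr b <= 1 -> nr (g a) ^+ 2 + nr (h b) ^+ 2 <= nr f ^+ 2.
  move=> a1 b1; have := H a b (g a)^* (h b)^* a1 b1.
  set T := nr (g a) ^+ 2 + nr (h b) ^+ 2.
  have -> : (g a)^* * g a + (h b)^* * h b = T%:C%C.
    have sq (z : R[i]) : (nr z ^+ 2)%:C%C = z * z^* by rewrite -normCK nrE -rmorphXn.
    by rewrite rmorphD /= !sq; ring.
  rewrite !nr_conj -/T nrR ger0_norm ?addr_ge0 ?sqr_ge0//.
  have : 0 <= T by rewrite addr_ge0 ?sqr_ge0.
  rewrite le_eqVlt => /predU1P[<- _|T0]; first exact: sqr_ge0.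
  by rewrite expr2 ler_pM2r.
have E2 (a : A) : nr a <= 1 -> nr (g a) ^+ 2 + nr h ^+ 2 <= nr f ^+ 2.
  move=> a1; rewrite addrC -lerBrDr; apply: dual_sq_le => [|b b1].
    by rewrite subr_ge0; have := E a 0 a1; rewrite nr0 ler01 linear0 nr0 expr0n addr0; exact.
  by rewrite lerBrDr addrC; exact: E.
rewrite -lerBrDr; apply: dual_sq_le => [|a a1]; last by rewrite lerBrDr; exact: E2.
by rewrite subr_ge0; have := E2 0; rewrite nr0 ler01 linear0 nr0 expr0n add0r; exact.
Qed.

Let dual_un_sq f x t : inA x -> un x ^+ 2 <= t -> nr (f x.2) ^+ 2 <= nr f ^+ 2 * t.
Proof.
move=> Ax xt; rewrite (@le_trans _ _ (nr f ^+ 2 * un x ^+ 2))//; last first.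
  by rewrite ler_wpM2l ?sqr_ge0.
by rewrite -exprMn ler_sqr ?nnegrE ?mulr_ge0 ?nr_ge0 ?un_ge0// dual_un.
Qed.

Lemma pythagoras_l f p : uproj p ->
  nr (cp p f 1) ^+ 2 + nr (cp (1 - p) f 1) ^+ 2 <= nr f ^+ 2.
Proof.
move=> pp; apply: pyth => a b s t a1 b1; rewrite !cpE !mulr1.
pose x := s *: (p * uin a) + t *: ((1 - p) * uin b).
have -> : s * f (p * uin a).2 + t * f ((1 - p) * uin b).2 = f x.2.
  have -> : x.2 = s *: (p * uin a).2 + t *: ((1 - p) * uin b).2 by [].
  by rewrite dualP linearZ.
apply: dual_un_sq; first by apply: inAD; apply: inAZ; exact: inAMl.
by apply: un_pythagoras; rewrite ?un_uin.
Qed.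

Lemma pythagoras_r f p : uproj p ->
  nr (cp 1 f p) ^+ 2 + nr (cp 1 f (1 - p)) ^+ 2 <= nr f ^+ 2.
Proof.
move=> pp; apply: pyth => a b s t a1 b1; rewrite !cpE !mul1r.
pose x := s *: (uin a * p) + t *: (uin b * (1 - p)).
have -> : s * f (uin a * p).2 + t * f (uin b * (1 - p)).2 = f x.2.
  have -> : x.2 = s *: (uin a * p).2 + t *: (uin b * (1 - p)).2 by [].
  by rewrite dualP linearZ.
apply: dual_un_sq; first by apply: inAD; apply: inAZ; exact: inAMr.
have -> : x = ustar (s^* *: (p * ustar (uin a)) + t^* *: ((1 - p) * ustar (uin b))).
  by rewrite ustarD !ustarZ !conjCK !ustarM !ustarK pp.1 (uprojC pp).1.
rewrite un_star -(nr_conj s) -(nr_conj t).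
by apply: un_pythagoras; rewrite ?un_star ?un_uin.
Qed.

Lemma dual_near f (d : R) : 0 < d -> exists2 a : A, nr a <= 1 & nr f - d <= nr (f a).
Proof.
move=> d0; apply: contrapT => H.
have [fd|fd] := ltP (nr f - d) 0.
  by apply: H; exists 0; rewrite ?nr0// (le_trans (ltW fd))// nr_ge0.
have : nr f ^+ 2 <= (nr f - d) ^+ 2.
  apply: dual_sq_le => [|a a1]; first exact: sqr_ge0.
  rewrite ler_sqr ?nnegrE ?nr_ge0//; apply: contrapT => /negP; rewrite -ltNge => /ltW fa.
  by apply: H; exists a.
rewrite ler_sqr ?nnegrE ?nr_ge0//; lra.
Qed.

(** [ustar w * w] lies in the corner of [p] and is [l] times [p], so [w] is a multiple of a partial
    isometry, with range projection [w * ustar w] divided by [l]. *)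
Lemma minproj_range p x : minproj p -> x * p != 0 -> exists e,
  [/\ minproj e, e * (x * p) = x * p & forall y, y * (x * p) = 0 -> y * e = 0].
Proof.
move=> [Ap sp pp p0 minp]; set w := x * p => w0.
have Aw : inA w by exact: inAMl.
have wp : w * p = w by rewrite /w -mulrA pp.
have pw : p * ustar w = ustar w by rewrite -{1}sp -ustarM wp.
have [l Hl] := minp (ustar w * w) (inAMl _ Aw).
have {}Hl : ustar w * w = l *: p by rewrite -Hl mulrA pw -mulrA wp.
have l0 : l != 0.
  by apply: contra_neq w0 => l0; apply: ustar_sq0; rewrite Hl l0 scale0r.
have lr : l^* = l.
  have /eqP : l^* *: p = l *: p by rewrite -Hl -{1}sp -ustarZ -Hl ustarM ustarK.
  by rewrite -subr_eq0 -scalerBl scaler_eq0 (negbTE p0) orbF subr_eq0 => /eqP.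
have w3 : w * ustar w * w = l *: w by rewrite -mulrA Hl scale_mulr wp.
pose e := l^-1 *: (w * ustar w).
have ew : e * w = w by rewrite /e scale_mull w3 scalerA mulVf// scale1r.
exists e; split=> //; last by move=> y yw; rewrite /e scale_mulr mulrA yw mul0r scaler0.
split.
- by apply: inAZ; exact: inAMr.
- by rewrite /usa /e ustarZ ustarM ustarK fmorphV/= lr.
- by rewrite {2}/e scale_mulr mulrA ew.
- by apply: contra_neq w0 => e0; rewrite -ew e0 mul0r.
clearbody w; move=> z Az; have [m Hm] := minp (ustar w * z * w) (inAMl _ Aw).
exists (l^-1 * m); rewrite {1}/e {2}/e scale_mull scale_mull scale_mulr.
have -> : w * ustar w * z * (w * ustar w) = w * (p * (ustar w * z * w) * p) * ustar w.
  by rewrite -!mulrA pw !mulrA wp.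
by rewrite Hm scale_mulr scale_mull wp -!scalerA; congr (_ *: _); rewrite /e !scalerA mulrC.
Qed.

(** The corner [e A p] is at most one-dimensional: for a nonzero [w] in it, [ustar w * w] is a
    multiple of [p], and [e * uin a * ustar w] is a multiple of [e]. *)
Lemma minproj_pair e p : minproj e -> minproj p -> exists (v : U) (K : R),
  [/\ inA v, 0 <= K & forall a, exists c : R[i], e * uin a * p = c *: v /\ nr c <= K * nr a].
Proof.
move=> me mp; have [Ae se ee e0 mine] := me; have [Ap sp pp p0 minp] := mp.
have [H|/existsNP[b /eqP w0]] := pselect (forall a, e * uin a * p = 0).
  by exists 0, 0; split=> // a; exists 0; rewrite H scaler0 nr0 mul0r.
pose w := e * uin b * p.
have Aw : inA w by exact: inA_mid.
have ew : e * w = w by rewrite /w !mulrA ee.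
have wE : ustar w = p * ustar (uin b) * e by rewrite /w !ustarM se sp mulrA.
have [m Hm] := minp (ustar (uin b) * e * uin b) (inAMl _ (inA_uin b)).
have {}Hm : ustar w * w = m *: p.
  by rewrite -Hm wE /w -!mulrA (mulrA e e) ee.
have m0 : m != 0.
  by apply: contra_neq w0 => m0; apply: ustar_sq0; rewrite Hm m0 scale0r.
have ne : 0 < un e by exact: un_neq0.
pose K := nr m^-1 * (un e)^-1 * un (ustar w).
have wp1 := un_ge0 (ustar w).
exists w, K; split=> //.
  by rewrite /K !mulr_ge0 ?nr_ge0 ?invr_ge0// ltW.
move=> a; have [l Hl] := mine (uin a * (p * ustar (uin b))) (inAMr _ (inA_uin a)).
have {}Hl : e * uin a * ustar w = l *: e by rewrite wE -Hl !mulrA.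
exists (m^-1 * l); split.
  apply: (scalerI m0); rewrite scalerA mulrA mulfV// mul1r.
  by rewrite -scale_mulr -Hm mulrA Hl scale_mull ew.
rewrite nrM /K -!mulrA ler_wpM2l ?nr_ge0// ler_pdivlMl// mulrC -unZ -Hl mulrC.
rewrite (le_trans (unM _ _))// ler_wpM2r// (le_trans (unM _ _))// un_uin.
by rewrite ler_piMl ?nr_ge0// proj_un.
Qed.

Inductive finproj : U -> Prop :=
| finproj0 : finproj 0
| finprojD Q e : finproj Q -> minproj e -> e * Q = 0 -> finproj (Q + e).

Lemma finprojP Q : finproj Q -> inA Q /\ uproj Q.
Proof.
elim=> [|{}Q e _ [AQ [sQ QQ]] [Ae se ee _ _] eQ].
  by split=> //; split; [exact: ustar0|rewrite mulr0].
have Qe : Q * e = 0 by have := congr1 ustar eQ; rewrite ustarM ustar0 sQ se.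
split; first exact: inAD.
by split; [exact: usaD|rewrite mulrDl !mulrDr QQ Qe eQ ee addr0 add0r].
Qed.

(** A Gram-Schmidt step: the range projection of [(1 - Q) * x * p] is minimal and orthogonal to
    [Q]. *)
Lemma finproj_extend Q p x : finproj Q -> minproj p ->
  exists Q', [/\ finproj Q', Q' * Q = Q & Q' * (x * p) = x * p].
Proof.
move=> fQ mp; have [AQ [sQ QQ]] := finprojP fQ.
pose w := (1 - Q) * x * p.
have wE : w = x * p - Q * (x * p) by rewrite /w !mulrBl mul1r mulrA.
have [w0|w0] := eqVneq w 0.
  by exists Q; split=> //; apply/esym/eqP; rewrite -subr_eq0 -wE w0.
have [e [me ew He]] := minproj_range mp w0.
have Qe : Q * e = 0.
  by apply: He; rewrite -/w wE mulrBr [Q * (Q * _)]mulrA QQ subrr.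
have [Ae se _ _ _] := me.
have eQ : e * Q = 0 by have := congr1 ustar Qe; rewrite ustarM ustar0 sQ se.
exists (Q + e); split; first exact: finprojD.
  by rewrite mulrDl QQ eQ addr0.
rewrite mulrDl; have -> : e * (x * p) = e * w.
  by rewrite wE mulrBr [e * (Q * _)]mulrA eQ mul0r subr0.
by rewrite [e * w]ew -/w wE addrC subrK.
Qed.

Lemma finproj_minspan Q y : finproj Q -> minspan y ->
  exists Q', [/\ finproj Q', Q' * Q = Q & Q' * y = y].
Proof.
move=> fQ; elim=> [|{}y x p v _ [Q1 [f1 Q1Q Q1y]] mp].
  by exists Q; split=> //; rewrite ?mulr0//; have [_ []] := finprojP fQ.
have [Q2 [f2 Q21 Q2x]] := finproj_extend x f1 mp.
exists Q2; split=> //; first by rewrite -Q1Q mulrA Q21.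
by rewrite mulrDr -{1}Q1y [Q2 * (Q1 * y)]mulrA Q21 Q1y [Q2 * (_ * v)]mulrA Q2x.
Qed.

Hypothesis atomicA : @atomic R A.

Lemma finproj_approx_l Q x (d : R) : finproj Q -> inA x -> 0 < d ->
  exists Q', [/\ finproj Q', Q' * Q = Q & un ((1 - Q') * x) <= d].
Proof.
move=> fQ Ax d0; have [y my xy] := atomicA Ax d0.
have [Q' [fQ' Q'Q Q'y]] := finproj_minspan fQ my; exists Q'; split=> //.
have -> : (1 - Q') * x = (1 - Q') * (x - y).
  by rewrite mulrBr [(1 - Q') * y]mulrBl mul1r Q'y subrr subr0.
have [_ pQ'] := finprojP fQ'.
rewrite (le_trans (unM _ _))// (le_trans _ xy)// ler_piMl ?un_ge0//.
exact/uproj_un/uprojC.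
Qed.

Lemma finproj_mono Q Q' x : finproj Q -> finproj Q' -> Q' * Q = Q ->
  un ((1 - Q') * x) <= un ((1 - Q) * x).
Proof.
move=> fQ fQ' Q'Q; have [_ pQ'] := finprojP fQ'.
have -> : (1 - Q') * x = (1 - Q') * ((1 - Q) * x).
  rewrite mulrA; congr (_ * _).
  by rewrite mulrBr mulr1 mulrBl mul1r Q'Q subrr subr0.
rewrite (le_trans (unM _ _))// ler_piMl ?un_ge0//.
exact/uproj_un/uprojC.
Qed.

Lemma finproj_approx Q x (d : R) : finproj Q -> inA x -> 0 < d ->
  exists Q', [/\ finproj Q', Q' * Q = Q, un ((1 - Q') * x) <= d
    & un (x * (1 - Q')) <= d].
Proof.
move=> fQ Ax d0; have [Q1 [f1 Q1Q H1]] := finproj_approx_l fQ Ax d0.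
have [Q2 [f2 Q21 H2]] := finproj_approx_l f1 (inA_star Ax) d0.
exists Q2; split=> //; first by rewrite -Q1Q mulrA Q21.
  exact: le_trans (finproj_mono x f1 f2 Q21) H1.
have [_ p2] := finprojP f2.
by rewrite -un_star ustarM (uprojC p2).1.
Qed.

Let gap (m n l d e : R) : 0 <= n -> n <= m -> m - d <= n -> n ^+ 2 + l ^+ 2 <= m ^+ 2 ->
  2 * d * m <= e ^+ 2 -> 0 <= l -> 0 <= e -> l <= e.
Proof.
move=> n0 nm dm H de l0 e0; rewrite -ler_sqr ?nnegrE//.
have : (m - n) * (m + n) <= d * (2 * m).
  by rewrite ler_pM ?subr_ge0// ?addr_ge0 ?(le_trans n0)//; lra.
by move=> K; apply: le_trans de; rewrite [2 * d * m](_ : _ = d * (2 * m)); last ring; nra.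
Qed.

(** Choose [a] almost norming [f] and [Q'] almost a unit for [a] on both sides. The compression by
    [Q'] then has norm at least [nr f - d], and the Pythagorean inequality leaves at most the square
    root of [2 * d * nr f] to the complement; this dictates [d]. *)
Lemma finproj_dual Q f (e : R) : finproj Q -> 0 < e -> exists Q',
  [/\ finproj Q', Q' * Q = Q, nr (cp 1 f (1 - Q')) <= e & nr (cp (1 - Q') f 1) <= e].
Proof.
move=> fQ e0; pose d := e ^+ 2 / (2 * (nr f + 1)).
have k0 : 0 < nr f + 1 by rewrite ltr_wpDl ?nr_ge0.
have d0 : 0 < d by rewrite divr_gt0 ?exprn_gt0// mulr_gt0.
have d2 : 0 < d / 2 by rewrite divr_gt0.
have [a a1 fa] := dual_near f d2.
pose d' := d / 2 / (nr f + 1); have d'0 : 0 < d' by rewrite divr_gt0.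
have [Q' [fQ' Q'Q Hl Hr]] := finproj_approx fQ (inA_uin a) d'0.
have [_ pQ'] := finprojP fQ'; have Q'1 := uproj_un pQ'.
have f2d : 2 * d * nr f <= e ^+ 2.
  have -> : 2 * d * nr f = e ^+ 2 * (nr f / (nr f + 1)) by rewrite /d; field; rewrite gt_eqF.
  by rewrite ler_piMr ?sqr_ge0// ler_pdivrMr// mul1r lerDl.
have near x : inA x -> un x <= d' -> nr (f x.2) <= d / 2.
  move=> Ax xd; rewrite (le_trans (dual_un _ Ax))//.
  rewrite (@le_trans _ _ ((nr f + 1) * d'))//; last first.
    by rewrite /d' mulrC divfK// gt_eqF.
  by rewrite ler_pM ?nr_ge0 ?un_ge0// lerDl.
exists Q'; split=> //.
- apply: (gap (n := nr (cp 1 f Q')) (m := nr f) (d := d)); rewrite ?nr_ge0 ?(ltW e0)//.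
  + by apply: cp_contr; rewrite ?un1.
  + have : nr (f (uin a * Q').2) <= nr (cp 1 f Q').
      by have := nr_dual (cp 1 f Q') a; rewrite cpE mul1r => /le_trans; apply; rewrite ler_piMr ?nr_ge0.
    have : nr (f a - f (uin a * Q').2) <= d / 2.
      have := near _ (inAMr _ (inA_uin a)) Hr; rewrite mulrBr mulr1; apply: le_trans.
      by rewrite -linearB.
    by have := nr_dist (f a) (f (uin a * Q').2); lra.
  + exact: pythagoras_r.
- apply: (gap (n := nr (cp Q' f 1)) (m := nr f) (d := d)); rewrite ?nr_ge0 ?(ltW e0)//.
  + by apply: cp_contr; rewrite ?un1.
  + have : nr (f (Q' * uin a).2) <= nr (cp Q' f 1).
      by have := nr_dual (cp Q' f 1) a; rewrite cpE mulr1 => /le_trans; apply; rewrite ler_piMr ?nr_ge0.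
    have : nr (f a - f (Q' * uin a).2) <= d / 2.
      have := near _ (inAMl _ (inA_uin a)) Hl; rewrite mulrBl mul1r; apply: le_trans.
      by rewrite -linearB.
    by have := nr_dist (f a) (f (Q' * uin a).2); lra.
  + exact: pythagoras_l.
Qed.

(** [Q A Q] is finite-dimensional, a sum of corners as in [minproj_pair], and on such a space
    pointwise null functionals are norm null. The two sides are decomposed by separate
    inductions. *)
Lemma cp_small (T : Type) (F : set_system T) (u : T -> dual A) Q (e : R) :
  Filter F -> (forall a, ulim F (fun i => u i a) 0) -> finproj Q -> 0 < e ->
  F [set i | nr (cp Q (u i) Q) <= e].
Proof.
move=> FF u0 fQ.
suff H Q1 Q2 : finproj Q1 -> finproj Q2 -> forall d : R, 0 < d ->
    F [set i | nr (cp Q1 (u i) Q2) <= d] by apply: H.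
elim=> [|{fQ}P1 e1 f1 IH me1 _] f2 d d0.
  by apply: filterS filterT => i _ /=; rewrite cp0l nr0 ltW.
have d2 : 0 < d / 2 by rewrite divr_gt0.
have {}IH := IH f2 _ d2.
suff H : F [set i | nr (cp e1 (u i) Q2) <= d / 2].
  apply: filterS (filterI IH H) => i /= [h1 h2].
  by rewrite cpDl (le_trans (nrD _ _))// (splitr d) lerD.
elim: f2 (d / 2) d2 {IH} => [|P2 e2 f2 IH me2 _] {d0}d d0.
  by apply: filterS filterT => i _ /=; rewrite cp0r nr0 ltW.
have d2 : 0 < d / 2 by rewrite divr_gt0.
have [v [K [Av K0 Hv]]] := minproj_pair me1 me2.
have k0 : 0 < K + 1 by rewrite ltr_wpDl.
have dk : 0 < d / 2 / (K + 1) by rewrite divr_gt0.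
apply: filterS (filterI (IH _ d2) (u0 v.2 _ dk)) => i /= [h1 h2].
rewrite cpDr (le_trans (nrD _ _))// (splitr d) lerD//.
apply: dual_nr_le => [|a]; first exact: ltW.
rewrite cpE; have [c [-> cK]] := Hv a.
rewrite /= linearZ /= nrM; rewrite subr0 in h2.
rewrite (@le_trans _ _ (K * nr a * (d / 2 / (K + 1))))//.
  by rewrite ler_pM ?nr_ge0.
have -> : K * nr a * (d / 2 / (K + 1)) = d / 2 * nr a * (K / (K + 1)).
  by field; rewrite gt_eqF.
rewrite ler_piMr//; first by rewrite mulr_ge0 ?nr_ge0// ltW.
by rewrite ler_pdivrMr// mul1r lerDl.
Qed.

End compressions.

(** * The Kadec-Klee inequality and semicontinuity of the asymptotic radius *)

Section norm_estimates.
Context {R : realType} {A : cStarAlgType R}.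
Local Notation U := (unitization A).
Hypothesis atomicA : @atomic R A.
Implicit Types (x y p Q : U) (f g u v z : dual A) (e d : R).

Let cp3 Q f : cp Q f Q + cp Q f (1 - Q) + cp (1 - Q) f 1 = f.
Proof.
by have QC : Q + (1 - Q) = 1 by [rewrite addrC subrK]; rewrite -cpDr QC -cpDl QC cp11.
Qed.

Let un11 : un (1 : U) <= 1. Proof. by rewrite un1. Qed.

Let cp_mid x f y : un x <= 1 -> nr (cp x f y) <= nr (cp 1 f y).
Proof. by move=> x1; rewrite -[cp x f y](_ : cp x (cp 1 f y) 1 = _) ?cp_contr// cp_cp !mul1r. Qed.

Let cp_mid' x f y : un y <= 1 -> nr (cp x f y) <= nr (cp x f 1).
Proof. by move=> y1; rewrite -[cp x f y](_ : cp 1 (cp x f 1) y = _) ?cp_contr// cp_cp !mulr1. Qed.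

(** A finite projection [Q] carries almost all of [v], while [w i] almost vanishes on [Q A Q]. Hence
    about half of its norm is found on the complement of [Q] on one side, the origin of [d / 2], and
    the Pythagorean inequality on that side separates it from [v]. *)
Lemma kadec_klee (T : Type) (F : set_system T) (w : T -> dual A) v (rho d : R) :
  ProperFilter F -> (forall a, ulim F (fun i => w i a) 0) ->
  F [set i | nr (v + w i) <= rho] -> F [set i | d <= nr (w i)] -> 0 <= d ->
  nr v ^+ 2 + (d / 2) ^+ 2 <= rho ^+ 2.
Proof.
move=> FF w0 Frho Fd d0.
have key e : 0 < e -> exists m n, [/\ 0 <= m, 0 <= n, nr v <= m + 3 * e,
    d / 2 <= n + 3 * e & m ^+ 2 + n ^+ 2 <= rho ^+ 2].
  move=> e0; have [Q [fQ _ v1 v2]] := finproj_dual atomicA v finproj0 e0.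
  have [_ pQ] := finprojP fQ; have Q1 := uproj_un pQ; have r1 := uproj_un (uprojC pQ).
  have [i /= [[i1 i2] i3]] := filter_ex (filterI (filterI Frho Fd) (cp_small _ w0 fQ e0)).
  set u := w i in i1 i2 i3; set r := 1 - Q in v1 v2 r1.
  have uE : nr u <= nr (cp Q u Q) + nr (cp 1 u r) + nr (cp r u 1).
    rewrite -{1}(cp3 Q u) (le_trans (nrD _ _))// lerD2r (le_trans (nrD _ _))// lerD2l.
    exact: cp_mid.
  have vE : nr v <= nr (cp Q v Q) + 2 * e.
    have := nrD (cp Q v Q + cp Q v r) (cp r v 1); rewrite cp3.
    by have := nrD (cp Q v Q) (cp Q v r); have := cp_mid v r Q1; lra.
  have QQ : nr (cp Q v Q) <= nr (cp Q (v + u) Q) + e.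
    rewrite (le_trans (nr_dist _ (cp Q (v + u) Q)))// lerD2l cpD opprD addrA subrr add0r nrN//.
  have vu : nr (v + u) ^+ 2 <= rho ^+ 2.
    by rewrite ler_sqr ?nnegrE ?nr_ge0// (le_trans _ i1) ?nr_ge0.
  (* Decides whether the complement acts from the right or from the left. *)
  have [big|small] := leP ((d - e) / 2) (nr (cp 1 u r)).
    exists (nr (cp 1 (v + u) Q)), (nr (cp 1 (v + u) r)); rewrite !nr_ge0; split=> //.
    - by have := cp_mid (v + u) Q Q1; lra.
    - have := nr_dist (cp 1 u r) (cp 1 (v + u) r).
      by rewrite cpD opprD addrCA subrr addr0 nrN -cpD; lra.
    - by apply: le_trans vu; exact: pythagoras_r.
  exists (nr (cp Q (v + u) 1)), (nr (cp r (v + u) 1)); rewrite !nr_ge0; split=> //.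
  - by have := cp_mid' Q (v + u) Q1; lra.
  - have := nr_dist (cp r u 1) (cp r (v + u) 1).
    by rewrite cpD opprD addrCA subrr addr0 nrN -cpD; lra.
  - by apply: le_trans vu; exact: pythagoras_l.
have rho0 : 0 <= rho.
  by have [i /= H] := filter_ex Frho; rewrite (le_trans _ H) ?nr_ge0.
apply/ler_addgt0Pr => eta eta0.
(* Each of the two squares loses at most [e * (6 * rho + 9)], by [sq] below. *)
pose k := 12 * rho + 18; have k0 : 0 < k by rewrite /k; lra.
pose e := Num.min 1 (eta / k).
have e0 : 0 < e by rewrite /e lt_min ltr01 divr_gt0.
have [m [n [m0 n0 vm dn mn]]] := key e e0.
have e1 : e <= 1 by rewrite /e ge_min lexx.
have ek : e * k <= eta by rewrite -ler_pdivlMr// /e ge_min lexx orbT.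
have mr : m <= rho.
  by rewrite -ler_sqr ?nnegrE// (le_trans _ mn)// lerDl sqr_ge0.
have nrh : n <= rho.
  by rewrite -ler_sqr ?nnegrE// (le_trans _ mn)// lerDr sqr_ge0.
have sq (x y : R) : 0 <= x -> 0 <= y -> x <= y + 3 * e -> y <= rho ->
    x ^+ 2 <= y ^+ 2 + e * (6 * rho + 9).
  move=> x0 y0 xy yr; rewrite (@le_trans _ _ ((y + 3 * e) ^+ 2))//.
    by rewrite ler_sqr ?nnegrE// addr_ge0// mulr_ge0// ltW.
  have -> : (y + 3 * e) ^+ 2 = y ^+ 2 + e * (6 * y + 9 * e) by ring.
  by rewrite lerD2l ler_wpM2l ?(ltW e0)//; lra.
have := sq _ _ (nr_ge0 v) m0 vm mr; have := sq _ _ (divr_ge0 d0 (ler0n R 2)) n0 dn nrh.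
by rewrite /k in ek; lra.
Qed.

Let ulimr_mono (T : Type) (F : set_system T) (h h' : T -> R) l l' : ProperFilter F ->
  ulimr F h l -> ulimr F h' l' -> F [set i | h i <= h' i] -> l <= l'.
Proof.
move=> FF hl hl' H; apply/ler_addgt0Pr => e e0; have e2 : 0 < e / 2 by rewrite divr_gt0.
have [i /= [[]]] := filter_ex (filterI (filterI (hl _ e2) (hl' _ e2)) H).
by rewrite !ler_norml => /andP[? ?] /andP[? ?] ?; lra.
Qed.

(** Squares make this superadditive over orthogonal projections, so that a projection of almost
    maximal energy leaves little for what is added to it later. *)
Let energy u Q := nr (cp 1 u Q) ^+ 2 + nr (cp Q u 1) ^+ 2.

Let energyD u Q1 Q2 : finproj Q1 -> finproj Q2 -> Q2 * Q1 = Q1 ->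
  energy u Q1 + energy u (Q2 - Q1) <= energy u Q2.
Proof.
move=> f1 f2 Q21; have [_ p1] := finprojP f1; have [_ p2] := finprojP f2.
have Q12 : Q1 * Q2 = Q1.
  by have := congr1 ustar Q21; rewrite ustarM p1.1 p2.1.
have := pythagoras_r (cp 1 u Q2) p1; have := pythagoras_l (cp Q2 u 1) p1.
rewrite !cp_cp !mulr1 Q21 Q12 mulrBr mulr1 mulrBl mul1r Q21 Q12.
by rewrite /energy; lra.
Qed.

Let energy_ge0 u Q : 0 <= energy u Q.
Proof. by rewrite addr_ge0// sqr_ge0. Qed.

(* Weak-* null functionals are almost orthogonal to a projection [r] supporting
   most of [z j], so that compressing by [1 - r] removes [z j] alone. *)
Lemma radius_lsc (T T' : Type) (F : set_system T) (H : set_system T')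
  (w : T -> dual A) (z : T' -> dual A) v (M rho e0 : R) :
  UltraFilter F -> ProperFilter H ->
  (forall a, ulim F (fun i => w i a) 0) -> (forall a, ulim H (fun j => z j a) 0) ->
  F [set i | nr (w i) <= M] -> 0 < e0 ->
  H [set j | F [set i | nr (v + w i + z j) <= rho + e0 / 2]] ->
  ~ F [set i | rho + e0 <= nr (v + w i)].
Proof.
move=> FU HF w0 z0 FM e0_gt0 Hz Fbig.
have FF : ProperFilter F by exact: ultra_proper.
have e_gt0 : 0 < e0 / 20 by rewrite divr_gt0.
(* The final estimate [total] costs nine times [e0 / 20], less than the available [e0 / 2]. *)
have num : rho + e0 / 2 + 9 * (e0 / 20) < rho + e0 by lra.
set e := e0 / 20 in e_gt0 num.
have hM Q : finproj Q -> F [set i | energy (w i) Q <= 2 * M ^+ 2].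
  move=> fQ; have [_ /uproj_un Q1] := finprojP fQ; apply: filterS FM => i /= wM.
  have E f : nr f <= nr (w i) -> nr f ^+ 2 <= M ^+ 2.
    by move=> fw; rewrite ler_sqr ?nnegrE ?nr_ge0// ?(le_trans fw)// (le_trans _ wM) ?nr_ge0.
  by rewrite /energy mulr_natl mulr2n lerD// E// cp_contr.
have [g Hg] : exists g : U -> R, forall Q, finproj Q -> ulimr F (fun i => energy (w i) Q) (g Q).
  suff /choice[g Hg] : forall Q, exists l, finproj Q -> ulimr F (fun i => energy (w i) Q) l.
    by exists g.
  move=> Q; have [fQ|nf] := pselect (finproj Q); last by exists 0.
  have [|l Hl] := @ulimr_ex _ _ F (fun i => energy (w i) Q) (2 * M ^+ 2) FU.
    by apply: filterS (hM Q fQ) => i /=; rewrite ger0_norm.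
  by exists l.
have gM Q : finproj Q -> g Q <= 2 * M ^+ 2.
  move=> fQ; apply: (ulimr_mono FF (Hg Q fQ) (h' := fun=> 2 * M ^+ 2)); last exact: hM.
  by move=> d d0; apply: filterS filterT => i _ /=; rewrite subrr normr0 ltW.
pose G := [set g Q | Q in finproj].
have G0 : G !=set0 by exists (g 0), 0 => //; exact: finproj0.
have Gub : has_ubound G by exists (2 * M ^+ 2) => _ [Q fQ <-]; exact: gM.
have e2_gt0 : 0 < e ^+ 2 by rewrite exprn_gt0.
(* [Q0] almost attains the supremum of the limit energies along [F]. Whatever [Q1] and [Q2] above it
   are chosen afterwards, [Q2 - Q1] carries limit energy at most [e ^+ 2], although [Q2] depends on
   [z j]. *)
have [_ [Q0 f0 <-] HQ0] := sup_adherent e2_gt0 (conj G0 Gub).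
have [Q1 [f1 Q10 v1 v2]] := finproj_dual atomicA v f0 e_gt0.
have [j /= [Fj zj]] := filter_ex (filterI Hz (cp_small _ z0 f1 e_gt0)).
have [Q2 [f2 Q21 z1 z2]] := finproj_dual atomicA (z j) f1 e_gt0.
have [_ p1] := finprojP f1; have [_ p2] := finprojP f2.
have Q12 : Q1 * Q2 = Q1 by have := congr1 ustar Q21; rewrite ustarM p1.1 p2.1.
have g01 : g Q0 <= g Q1.
  apply: (ulimr_mono FF (Hg _ f0) (Hg _ f1)); apply: filterS filterT => i _ /=.
  by apply: le_trans (energyD (w i) f0 f1 Q10); rewrite lerDl.
have g2 : g Q2 <= sup G by apply: ub_le_sup => //; exists Q2.
have [i /= [[[i1 i2] i3] i4]] := filter_ex (filterI (filterI (filterI Fj Fbig)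
  (Hg _ f1 _ e2_gt0)) (Hg _ f2 _ e2_gt0)).
set u := w i in i1 i2 i3 i4; pose r := Q2 - Q1; pose s := 1 - r.
have pr : uproj r.
  split; first by apply: usaB; [case: p2|case: p1].
  by rewrite /r; expand; rewrite p2.2 p1.2 Q12 Q21; lmod.
have s1 : un s <= 1 by exact/uproj_un/uprojC.
have r1 : un r <= 1 by exact: uproj_un.
have eu : energy u r <= (2 * e) ^+ 2.
  have := energyD u f1 f2 Q21; rewrite -/r.
  by move: i3 i4; rewrite !ler_norml => /andP[? ?] /andP[? ?]; rewrite exprMn; lra.
have split_s f : nr (f - cp s f s) <= nr (cp 1 f r) + nr (cp r f 1).
  have -> : f - cp s f s = cp s f r + cp r f 1.
    rewrite -{1}(cp11 f) -{1}(subrK r 1) cpDl -/s addrAC; congr (_ + _).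
    by rewrite -[X in cp s f X - _](subrK r 1) cpDr -/s addrAC subrr add0r.
  by rewrite (le_trans (nrD _ _))// lerD2r cp_mid.
have small (x : R) : 0 <= x -> x ^+ 2 <= (2 * e) ^+ 2 -> x <= 2 * e.
  by move=> x0; rewrite ler_sqr ?nnegrE// mulr_ge0// ltW.
have ur : nr (cp 1 u r) <= 2 * e.
  by apply: small; rewrite ?nr_ge0// (le_trans _ eu)// lerDl sqr_ge0.
have ru : nr (cp r u 1) <= 2 * e.
  by apply: small; rewrite ?nr_ge0// (le_trans _ eu)// lerDr sqr_ge0.
have vr : nr (cp 1 v r) <= e.
  have -> : r = Q2 * (1 - Q1) by rewrite mulrBr mulr1 Q21.
  rewrite (le_trans _ v1)// -[cp 1 v _](_ : cp 1 (cp 1 v (1 - Q1)) Q2 = _).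
    by apply: cp_contr => //; exact: uproj_un.
  by rewrite cp_cp !mul1r.
have rv : nr (cp r v 1) <= e.
  have -> : r = (1 - Q1) * Q2 by rewrite mulrBl mul1r Q12.
  rewrite (le_trans _ v2)// -[cp _ v 1](_ : cp Q2 (cp (1 - Q1) v 1) 1 = _).
    by apply: cp_contr => //; exact: uproj_un.
  by rewrite cp_cp !mul1r.
have zs : nr (cp s (z j) s) <= 3 * e.
  rewrite -{1}(cp3 Q2 (z j)) !cpD (le_trans (nrD _ _))//.
  have -> : 3 * e = e + e + e by ring.
  rewrite lerD//; last by rewrite (le_trans _ z2)// cp_contr.
  rewrite (le_trans (nrD _ _))// lerD//; last first.
    rewrite (le_trans _ z1)// (le_trans (cp_contr _ _ _))//.
    by apply: cp_mid; exact: uproj_un.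
  rewrite cp_cp; have -> : Q2 * s = Q1 by rewrite /s /r; expand; rewrite p2.2 Q21; lmod.
  by have -> : s * Q2 = Q1 by rewrite /s /r; expand; rewrite p2.2 Q12; lmod.
(* Compressing by [s] changes [v] by at most [2 * e] and [u] by at most [4 * e], and leaves at most
   [3 * e] of [z j]. *)
have total : nr (v + u) <= nr (cp s (v + u + z j) s) + 9 * e.
  have E : v + u = cp s (v + u + z j) s - cp s (z j) s + (v - cp s v s) + (u - cp s u s).
    by rewrite !cpD; lmod.
  rewrite {1}E {E}.
  have -> : 9 * e = 3 * e + (e + e) + (2 * e + 2 * e) by ring.
  have Hv := le_trans (split_s v) (lerD vr rv); have Hu := le_trans (split_s u) (lerD ur ru).
  apply: le_trans (nrD _ _) _; rewrite [leRHS]addrA lerD//.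
  apply: le_trans (nrD _ _) _; rewrite [leRHS]addrA lerD//.
  by apply: le_trans (nrB _ _) _; rewrite lerD.
have := le_trans i2 (le_trans total (lerD (le_trans (cp_contr _ s1 s1) i1) (lexx _))).
by rewrite leNgt num.
Qed.

End norm_estimates.

(** * Weak-* compactness through ultrafilters, and uniform boundedness *)

Lemma filter_base_ultra (I T : Type) (D : set I) (B : I -> set T) :
  (exists i, D i) ->
  (forall i j, D i -> D j -> exists2 k, D k & B k `<=` B i `&` B j) ->
  (forall i, D i -> B i !=set0) ->
  exists F : set_system T, UltraFilter F /\ forall i, D i -> F (B i).
Proof.
move=> D0 DI B0.
have FF := filter_from_proper (filter_from_filter D0 DI) B0.
have [F [FU sF]] := ultraFilterLemma FF.
by exists F; split=> // i Di; apply: sF; exists i.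
Qed.

Section weak_star_compactness.
Context {R : realType} {X : normedModType R[i]}.
Implicit Types (K C : set (dual X)) (f g y : dual X).

Definition ulimd (F : set_system (dual X)) f := forall x, ulim F (fun g : dual X => g x) (f x).

(** Weak-* compactness in terms of pointwise limits only, the form in which it is used from here
    on. *)
Definition wcomp K := forall F : set_system (dual X), UltraFilter F -> F K ->
  exists2 f, K f & ulimd F f.

Lemma wcompP K : compact (K : set (weak_star X)) -> wcomp K.
Proof.
rewrite compact_ultra => cK F FU FK; have FF : ProperFilter F by exact: ultra_proper.
have [f [Kf Ff]] := cK F FU FK; exists f => // x e e0.
exact: ((@weak_star_cvgP _ _ F f _).1 Ff).
Qed.

Lemma ulimd_uniq (F : set_system (dual X)) f g : ProperFilter F -> ulimd F f -> ulimd F g -> f = g.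
Proof. by move=> FF Hf Hg; apply: dual_ext => x; exact: ulim_uniq (Hf x) (Hg x). Qed.

Lemma wcomp_bigcap (I : Type) (D : set I) (B : I -> set (dual X)) :
  (exists i, D i) ->
  (forall i j, D i -> D j -> exists2 k, D k & B k `<=` B i `&` B j) ->
  (forall i, D i -> B i !=set0) -> (forall i, D i -> wcomp (B i)) ->
  (\bigcap_(i in D) B i) !=set0 /\ wcomp (\bigcap_(i in D) B i).
Proof.
move=> D0 DI B0 Bw.
have H (F : set_system (dual X)) : UltraFilter F -> (forall i, D i -> F (B i)) ->
    exists2 f, (\bigcap_(i in D) B i) f & ulimd F f.
  move=> FU FB; have FF : ProperFilter F by exact: ultra_proper.
  have [i0 D0'] := D0; have [f _ Hf] := Bw i0 D0' F FU (FB _ D0').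
  exists f => // i Di; have [g Bg Hg] := Bw i Di F FU (FB _ Di).
  by rewrite (ulimd_uniq FF Hf Hg).
split.
  have [F [FU FB]] := filter_base_ultra D0 DI B0.
  by have [f Hf _] := H F FU FB; exists f.
move=> F FU FB; have FF : ProperFilter F by exact: ultra_proper.
by apply: (H F FU) => i Di; apply: filterS FB => f /(_ i Di).
Qed.

End weak_star_compactness.

Section uniform_boundedness.
Context {R : realType} {A : cStarAlgType R}.
Implicit Types (K C : set (dual A)) (f g : dual A) (x y a : A).

(** For [a] almost norming [f], the values at [x + r a] and [x - r a] differ by [2 r f a], so one of
    them has modulus at least [r] times that of [f a]. *)
Lemma dual_bump f x (r : R) : 0 < r -> exists y,
  nr (y - x) <= r /\ 2 / 3 * r * nr f <= nr (f y).
Proof.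
move=> r0; have := nr_ge0 f; rewrite le_eqVlt => /predU1P[f0|f0].
  by exists x; rewrite subrr nr0 -f0 mulr0 nr_ge0 ltW.
have f3 : 0 < nr f / 3 by rewrite divr_gt0.
have [a a1 fa] := dual_near f f3.
have B (s : R) : `|s| = r -> nr (x + s%:C%C *: a - x) <= r.
  by move=> sr; rewrite addrAC subrr add0r nrZR sr ler_piMr// ltW.
have E : 2 * r * nr (f a) <= nr (f (x + r%:C%C *: a)) + nr (f (x + (- r)%:C%C *: a)).
  apply: le_trans (nrB _ _); rewrite -linearB opprD addrACA subrr add0r -scalerBl -rmorphB opprK.
  rewrite linearZ /= nrM nrR ger0_norm ?addr_ge0 ?(ltW r0)//.
  by rewrite mulrDl mul1r.
have H : 2 / 3 * r * nr f <= r * nr (f a).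
  by rewrite [leLHS](_ : _ = r * (2 / 3 * nr f)); [rewrite ler_wpM2l ?(ltW r0)//; lra|ring].
have [h|h] := leP (r * nr (f a)) (nr (f (x + r%:C%C *: a))).
  exists (x + r%:C%C *: a); split; first by rewrite B// gtr0_norm.
  exact: le_trans h.
exists (x + (- r)%:C%C *: a); split; first by rewrite B// normrN gtr0_norm.
by apply: le_trans H _; move: E h; set u := nr (f (_ + (- r)%:C%C *: _)); lra.
Qed.

Let q n : R := 3 ^- n.

Let q_gt0 n : 0 < q n. Proof. by rewrite invr_gt0 exprn_gt0. Qed.

Let qS n : q n = 3 * q n.+1.
Proof. by rewrite /q exprS invfM mulrA mulfV ?mul1r// pnatr_eq0. Qed.

Let q_small e : 0 < e -> exists M, forall n, (M <= n)%N -> q n <= e.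
Proof.
move=> e0; exists (Num.truncn e^-1).+1 => n Mn.
rewrite -[leRHS]invrK lef_pV2 ?posrE ?invr_gt0 ?exprn_gt0//.
rewrite (le_trans (ltW (truncnS_gt _)))// (@le_trans _ _ n%:R) ?ler_nat//.
by rewrite -natrX ler_nat ltnW// ltn_expl.
Qed.

(** Values at a fixed point are bounded, since an ultrafilter of functionals with unbounded values
    there has no limit. Uniformity follows by a gliding hump: if norms at least [n * 3 ^+ n]
    occurred, steps of length [3 ^- n.+1] chosen by [dual_bump] would lead to a point at which the
    values are unbounded. *)
Lemma wcomp_bounded K : wcomp K -> exists M : R, forall f, K f -> nr f <= M.
Proof.
move=> cK.
have pb x : exists M : R, forall f, K f -> nr (f x) <= M.
  apply: contrapT => /forallNP H.
  have [|||F [FU HF]] := @filter_base_ultra nat _ setT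
    (fun n => [set f | K f /\ n%:R <= nr (f x)]).
  - by exists 0%N.
  - move=> i j _ _; exists (maxn i j) => // f /= [Kf nf].
    by split; split=> //; apply: le_trans nf; rewrite ler_nat ?leq_maxl ?leq_maxr.
  - move=> n _; have /existsNP[f /not_implyP[Kf /negP]] := H n%:R.
    by rewrite -ltNge => /ltW nf; exists f.
  have FF : ProperFilter F by exact: ultra_proper.
  have [|f _ Hf] := cK F FU; first by apply: filterS (HF 0%N I) => f [].
  have [g /= [[Kg ng] gf]] := filter_ex (filterI (HF (Num.truncn (nr (f x) + 1)).+1 I) (Hf x 1 ltr01)).
  have := nr_dist (g x) (f x); have := truncnS_gt (nr (f x) + 1).
  lra.
apply: contrapT => /forallNP unb.
have /choice[F HF] : forall n, exists f, K f /\ n%:R * 3 ^+ n <= nr f.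
  move=> n; have /existsNP[f /not_implyP[Kf /negP]] := unb (n%:R * 3 ^+ n).
  by rewrite -ltNge => /ltW nf; exists f.
have [Y HY] : exists Y : nat * A -> A, forall nx,
    nr (Y nx - nx.2) <= q nx.1.+1 /\ 2 / 3 * q nx.1.+1 * nr (F nx.1) <= nr (F nx.1 (Y nx)).
  suff /choice[Y HY] : forall nx : nat * A, exists y,
      nr (y - nx.2) <= q nx.1.+1 /\ 2 / 3 * q nx.1.+1 * nr (F nx.1) <= nr (F nx.1 y).
    by exists Y.
  by move=> [n x]; exact: dual_bump.
pose x := fix x n := if n is m.+1 then Y (m, x m) else 0.
have x1 n : nr (x n.+1 - x n) <= q n.+1 by have [] := HY (n, x n).
have x2 n : 2 / 3 * q n.+1 * nr (F n) <= nr (F n (x n.+1)) by have [] := HY (n, x n).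
have xd n m : (n <= m)%N -> nr (x m - x n) <= (q n - q m) / 2.
  elim: m => [|m IH]; first by rewrite leqn0 => /eqP->; rewrite !subrr nr0 mul0r.
  rewrite leq_eqVlt => /predU1P[->|]; first by rewrite !subrr nr0 mul0r.
  rewrite ltnS => /IH H; have := nr_tri (x m) (x m.+1) (x n); have := x1 m; have := qS m.
  lra.
have [|l Hl] := @nr_complete _ _ x.
  move=> e e0; have [M HM] := q_small e0; exists M => m n Mm Mn.
  wlog mn : m n Mm Mn / (n <= m)%N => [H|].
    by have [/H|/ltnW/H] := leqP n m; [exact|rewrite nr_sub; exact].
  have := xd n m mn; have := HM n Mn; have := q_gt0 m; have := q_gt0 n; lra.
have ld n : nr (l - x n) <= q n / 2.
  apply/ler_addgt0Pr => e e0; have [M HM] := Hl e e0.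
  have := nr_tri (x (maxn M n)) l (x n); have := HM _ (leq_maxl M n).
  have := xd n _ (leq_maxr M n); have := q_gt0 (maxn M n); rewrite (nr_sub l (x (maxn M n))).
  lra.
have [M HM] := pb l.
(* The value at [l] is at least [2 / 3 - 1 / 2 = 1 / 6] of [q n.+1 * nr (F n)], which is at least
   [n / 3]; hence [n / 18 <= M]. *)
pose n := (Num.truncn (18 * M)).+1.
have Mn : 18 * M < n%:R by exact: truncnS_gt.
have [Kn Fn] := HF n.
have h1 : nr (F n (x n.+1)) <= nr (F n l) + q n.+1 / 2 * nr (F n).
  rewrite (le_trans (nr_dist _ (F n l)))// lerD2l -linearB (le_trans (nr_dual _ _))//.
  by rewrite mulrC ler_wpM2r ?nr_ge0// nr_sub.
have h2 : n%:R <= 3 * q n.+1 * nr (F n).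
  rewrite -qS; have -> : n%:R = q n * (n%:R * 3 ^+ n).
    by rewrite /q mulrCA mulVf ?mulr1// expf_neq0// pnatr_eq0.
  by rewrite ler_pM2l.
have h3 := x2 n; have h4 := HM _ Kn.
pose v := q n.+1 * nr (F n).
have E1 : q n.+1 / 2 * nr (F n) = v / 2 by rewrite /v mulrAC.
have E2 : 2 / 3 * q n.+1 * nr (F n) = 2 / 3 * v by rewrite /v mulrA.
have E3 : 3 * q n.+1 * nr (F n) = 3 * v by rewrite /v mulrA.
by rewrite E1 in h1; rewrite E3 in h2; rewrite E2 in h3; lra.
Qed.

End uniform_boundedness.

(** * Common fixed points *)

Section invariant_sets.
Context {R : realType} {A : cStarAlgType R} {S : Type}.
Variables (C : set (dual A)) (act : S -> dual A -> dual A).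
Implicit Types (K : set (dual A)) (f g : dual A).

Definition invariant K := [/\ K `<=` C, K !=set0, wcomp K, convex_set K
  & forall s f, K f -> K (act s f)].

Lemma minimal_invariant : invariant C -> exists K, invariant K /\
  forall K', invariant K' -> K' `<=` K -> K' = K.
Proof.
move=> iC; pose T := {K | invariant K}.
pose r (K L : T) := `[< sval L `<=` sval K >].
have eqT (K L : T) : sval K = sval L -> K = L.
  by case: K L => [K iK] [L iL] /= E; subst; congr exist; exact: Prop_irrelevance.
have [||||[K iK] HK] := @Zorn T r.
- by move=> K; apply/asboolP.
- by move=> K L N /asboolP LK /asboolP NL; apply/asboolP => f /NL/LK.
- by move=> K L /asboolP LK /asboolP KL; apply: eqT; apply/seteqP.
- move=> D totD; have [[K0 D0]|D0] := pselect (exists K : T, D K); last first.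
    by exists (exist _ C iC) => K DK; case: D0; exists K.
  have [||||ne wc] := @wcomp_bigcap _ _ T D (@sval _ _).
  + by exists K0.
  + move=> K L DK DL; have [/asboolP LK|/asboolP KL] := totD K L DK DL.
      by exists L => // f Lf; split=> //; exact: LK.
    by exists K => // f Kf; split=> //; exact: KL.
  + by move=> [K iK] _; have [] := iK.
  + by move=> [K iK] _; have [] := iK.
  have iI : invariant (\bigcap_(K in D) sval K).
    split=> //.
    - by move=> f /(_ K0 D0); have [KC _ _ _ _] := svalP K0; exact: KC.
    - apply/convex_setE => f g t If Ig t01 K DK.
      have [_ _ _ cK _] := svalP K; apply: (convex_setE _).1 => //; [exact: If|exact: Ig].
    - move=> s f If K DK; have [_ _ _ _ iK] := svalP K; apply: iK; exact: If.
  by exists (exist _ _ iI) => K DK; apply/asboolP => f; exact.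
exists K; split=> // K' iK' K'K.
by have /(congr1 (@sval _ _)) /= := HK (exist _ K' iK') (asboolT K'K).
Qed.

End invariant_sets.

Section common_fixed_point.
Context {R : realType} {A : cStarAlgType R} {S : semitopologicalSemigroupType}.
Hypothesis atomicA : @atomic R A.
Variables (C : set (dual A)) (act : S -> dual A -> dual A) (M : R).
Hypotheses (revS : left_reversible S) (actC : acts_on C act)
  (ctsC : separately_continuous_on C act)
  (nexC : forall s, nonexpansive_on C (act s)) (bdC : forall f, C f -> nr f <= M).
Implicit Types (f g y z w : dual A) (s a b c : S) (K : set (dual A)) (rho e t : R).
Local Notation "s ** t" := (monoid.mul s t) (at level 40).

Section orbit.
Variables (x0 : dual A).
Hypothesis Cx0 : C x0.
Let orb s := act s x0.

(** Of the orbit along [a ** s] only the balls containing it are recorded. Left reversibility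
    compares right ideals merely up to closure, and ball inequalities survive closure. *)
Let tail a : set (dual A) :=
  [set w | C w /\ forall y t, (forall s, nr (orb (a ** s) - y) <= t) -> nr (w - y) <= t].

Let tail_orb a s : tail a (orb (a ** s)).
Proof. by split=> [|y t]; [exact: actC.1|exact]. Qed.

(** The closures of the right ideals generated by [a] and [b] share a point [c]. Every [c ** s] is a
    limit of elements [a ** u], so by continuity of the orbit map the balls for [a] also contain the
    orbit along [c]. *)
Let tail_directed a b : exists c, tail c `<=` tail a `&` tail b.
Proof.
pose I a := closure [set a ** s | s in [set: S]].
have I0 a' : I a' !=set0 by exists (a' ** a'); apply: subset_closure; exists a'.
have Ir a' : right_ideal (I a').
  move=> u s Iu B Bus; have [_ [[t _ <-] Bt]] := Iu _ (semitop_mulr s u _ Bus).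
  by exists (a' ** t ** s); split=> //; exists (t ** s) => //; rewrite mulgA.
have cI a' : closed (I a') by exact: closed_closure.
have [c [ca cb]] := revS (I0 a) (cI a) (Ir a) (I0 b) (cI b) (Ir b).
have H a' : I a' c -> tail c `<=` tail a'.
  move=> ca' w [Cw tw]; split; first exact: Cw.
  move=> y t ty; apply: tw => s; apply/ler_addgt0Pr => e e0.
  have /cvgrPdist_le/(_ e%:C%C) := ctsC.2 x0 Cx0 (c ** s).
  rewrite gt0C => /(_ e0) He.
  have [_ [[u _ <-] /= Hu]] := Ir a' c s ca' _ He.
  rewrite (le_trans (nr_tri (orb (a' ** u)) _ _))// addrC lerD// nr_le.
  exact: Hu.
by exists c => w tw; split; exact: H tw.
Qed.

Let tail_ultra (I : Type) (D : set I) (Q : I -> set (dual A)) :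
  (exists s : S, True) -> (exists i, D i) ->
  (forall i j, D i -> D j -> exists2 k, D k & Q k `<=` Q i `&` Q j) ->
  (forall i a, D i -> (tail a `&` Q i) !=set0) ->
  exists F, [/\ UltraFilter F, forall a, F (tail a) & forall i, D i -> F (Q i)].
Proof.
move=> [s _] [i Di] DI H.
have [|||F [FU HF]] := @filter_base_ultra (S * I) (dual A) [set ai | D ai.2]
  (fun ai => tail ai.1 `&` Q ai.2).
- by exists (s, i).
- move=> [a1 i1] [a2 i2] /= D1 D2; have [c Hc] := tail_directed a1 a2.
  have [k Dk Hk] := DI _ _ D1 D2; exists (c, k) => //= w [/Hc[t1 t2] /Hk[q1 q2]].
  by [].
- by move=> [a1 i1] /= D1; exact: H.
have FF : ProperFilter F by exact: ultra_proper.
exists F; split=> // [a|j Dj].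
  by apply: filterS (HF (a, i) Di) => w [].
by apply: filterS (HF (s, j) Dj) => w [].
Qed.

(** Sublevel set of the asymptotic radius, the infimum over [a] of the supremum over [s] of the
    distance from [y] to [orb (a ** s)]. *)
Let L K rho : set (dual A) := [set y | K y /\
  forall e, 0 < e -> exists a, forall s, nr (orb (a ** s) - y) <= rho + e].

Let L_convex K rho : convex_set K -> convex_set (L K rho).
Proof.
move=> cK; apply/convex_setE => y z t [Ky Ly] [Kz Lz] t01.
split; first exact: (convex_setE K).1.
move=> e e0; have [a Ha] := Ly e e0; have [b Hb] := Lz e e0.
have [c Hc] := tail_directed a b; exists c => s.
have [[_ /(_ y _ Ha) H1] [_ /(_ z _ Hb) H2]] := Hc _ (tail_orb c s).
set o := orb _ in H1 H2 *; case/andP: t01 => t0 t1.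
have -> : o - (t%:C%C *: y + (1 - t)%:C%C *: z) = t%:C%C *: (o - y) + (1 - t)%:C%C *: (o - z).
  by rewrite rmorphB rmorph1; lmod.
rewrite (le_trans (nrD _ _))// !nrZR !ger0_norm ?subr_ge0//.
rewrite (@le_trans _ _ (t * (rho + e) + (1 - t) * (rho + e)))//.
  by rewrite lerD// ler_wpM2l// subr_ge0.
by rewrite -mulrDl addrC subrK mul1r.
Qed.

(** A tail along [a] is moved by [s] to the tail along [s ** a], and distances do not grow. *)
Let L_invariant K rho s y : K `<=` C -> (forall s f, K f -> K (act s f)) ->
  L K rho y -> L K rho (act s y).
Proof.
move=> KC Ki [Ky Ly]; split; first exact: Ki.
move=> e e0; have [a Ha] := Ly e e0; exists (s ** a) => t.
rewrite (le_trans _ (Ha t))//; have -> : orb (s ** a ** t) = act s (orb (a ** t)).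
  by rewrite /orb -mulgA; exact: actC.2.
rewrite nr_le -nrE; apply: nexC; [exact: actC.1|exact: KC].
Qed.

Let L_wcomp K rho : (exists s : S, True) -> K `<=` C -> wcomp K -> K x0 -> 
  (forall s f, K f -> K (act s f)) -> wcomp (L K rho).
Proof.
move=> S0 KC wK Kx0 Ki H HU HL; have HF : ProperFilter H by exact: ultra_proper.
have [|y Ky Hy] := wK H HU; first by apply: filterS HL => f [].
exists y => //; split=> // e e0; apply: contrapT => /forallNP nL.
pose Q := [set w | K w /\ rho + e <= nr (w - y)].
have [|||F [FU Ft FQ]] := @tail_ultra unit setT (fun=> Q) S0.
- by exists tt.
- by move=> _ _ _ _; exists tt.
- move=> i a _; have /existsNP[s /negP] := nL a; rewrite -ltNge => /ltW Hs.
  by exists (orb (a ** s)); split; [exact: tail_orb|split=> //; exact: Ki].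
have FF : ProperFilter F by exact: ultra_proper.
have {}FQ := FQ tt I.
have [|w Kw Hw] := wK F FU; first by apply: filterS FQ => f [].
have null (G : set_system (dual A)) g : ProperFilter G -> ulimd G g ->
    forall x, ulim G (fun f : dual A => (f - g) x) 0.
  by move=> GF Hg x d d0; apply: filterS (Hg x d d0) => f /=; rewrite subr0.
(* For [g] along [F] and [f] along [H], the vectors [w - y], [g - w] and [y - f] add up to [g - f],
   small because [f] is in the sublevel set, whereas the first two give [g - y], large by the choice
   of [F]. *)
apply: (@radius_lsc _ _ atomicA _ _ F H (fun f => f - w) (fun f => y - f) (w - y)
  (M + M) rho e FU HF).
- exact: null.
- move=> x d d0; apply: filterS (Hy x d d0) => f /=.
  by rewrite subr0 nr_sub.
- apply: filterS FQ => f [Kf _] /=; rewrite (le_trans (nrB _ _))// lerD// bdC//; exact: KC.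
- by [].
- apply: filterS HL => f [Kf Lf] /=.
  have [a Ha] := Lf (e / 2) ltac:(by rewrite divr_gt0).
  apply: filterS (Ft a) => g [_ /(_ f _ Ha)] /=.
  by have -> : w - y + (g - w) + (y - f) = g - f by lmod.
- apply: filterS FQ => g [_] /=.
  by have -> : w - y + (g - w) = g - y by lmod.
Qed.

(* In a minimal invariant set all points have the same asymptotic radius [r0];
   the points of a finite set are then simultaneously almost at distance [r0] from some
   point of any tail, which contradicts [kadec_klee] unless [r0 = 0]. *)
Lemma minimal_invariant_fixed K : invariant C act K -> K x0 -> (exists s : S, True) ->
  (forall K', invariant C act K' -> K' `<=` K -> K' = K) -> forall s, act s x0 = x0.
Proof.
move=> [KC _ wK cK Ki] Kx0 S0 Kmin.
have LK rho : L K rho !=set0 -> L K rho = K.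
  move=> L0; apply: Kmin; last by move=> y [].
  split=> //; first by move=> y [/KC].
  - exact: L_wcomp.
  - exact: L_convex.
  - by move=> s f; exact: L_invariant.
pose P := [set rho | L K rho !=set0].
have [s0 _] := S0.
have P0 : P !=set0.
  exists (M + M); exists x0; split=> // e e0; exists s0 => s.
  by rewrite (le_trans (nrB _ _))// (le_trans (lerD (bdC _) (bdC _)))//; [exact: actC.1|rewrite lerDl ltW].
have Plb rho : P rho -> 0 <= rho.
  move=> [y [_ Ly]]; apply/ler_addgt0Pr => e e0; have [a Ha] := Ly e e0.
  exact: le_trans (nr_ge0 _) (Ha s0).
have hP : has_inf P by split=> //; exists 0 => rho /Plb.
pose r0 := inf P.
have r0_ge0 : 0 <= r0 by apply: lb_le_inf => // rho /Plb.
have above y e : K y -> 0 < e -> exists a, forall s, nr (orb (a ** s) - y) <= r0 + e.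
  move=> Ky e0; have e2 : 0 < e / 2 by rewrite divr_gt0.
  have [rho Prho rho_r0] := inf_adherent e2 hP.
  have [_ /(_ _ e2)[a Ha]] : L K rho y by rewrite LK.
  exists a => s; rewrite (le_trans (Ha s))//.
  by move: rho_r0; rewrite -/r0; lra.
have below y e a : K y -> 0 < e -> exists s, r0 - e <= nr (orb (a ** s) - y).
  move=> Ky e0; apply: contrapT => /forallNP H.
  suff : r0 <= r0 - e by rewrite lerBrDr gerDl leNgt e0.
  apply: (ge_inf hP.2); exists y; split=> // d d0; exists a => s.
  by have /negP := H s; rewrite -ltNge => /ltW /le_trans; apply; rewrite lerDl ltW.
have tail_above (l : seq (dual A)) (d : R) a : 0 < d -> (forall z, z \in l -> K z) ->
    exists c, tail c `<=` tail a /\ forall z s, z \in l -> nr (orb (c ** s) - z) <= r0 + d.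
  move=> d0; elim: l => [|z l IH] lK.
    by exists a; split=> // z s; rewrite in_nil.
  have [c [ca Hc]] := IH (fun z' zl => lK z' ltac:(by rewrite in_cons zl orbT)).
  have [b Hb] := above z d (lK z (mem_head _ _)) d0.
  have [c' Hc'] := tail_directed c b; exists c'; split.
    by move=> w /Hc'[/ca].
  move=> z' s; rewrite in_cons => /predU1P[->|zl].
    by have [_ [_ /(_ z _ Hb)]] := Hc' _ (tail_orb c' s).
  have [[_ /(_ z' (r0 + d)) H1] _] := Hc' _ (tail_orb c' s).
  by apply: H1 => s'; exact: Hc.
(* [y] is an iterated midpoint of [x0] and the points of [l]. A vector at distance almost [r0] from
   [y], and hardly more than [r0] from each of these points, is almost [r0] away from all of
   them. *)
have mean (l : seq (dual A)) (e : R) : 0 < e -> (forall z, z \in l -> K z) -> exists y d, [/\ K y, 0 < d,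
    forall w t, (forall z, z \in x0 :: l -> nr (w - z) <= t) -> nr (w - y) <= t
  & forall w, r0 - d <= nr (w - y) -> (forall z, z \in x0 :: l -> nr (w - z) <= r0 + d) ->
    forall z, z \in x0 :: l -> r0 - e <= nr (w - z)].
  move=> e0; elim: l => [|z l IH] lK.
    exists x0, e; split=> // [w t|w H _ z]; first by apply; rewrite mem_head.
    by rewrite mem_seq1 => /eqP->.
  have [y [d [Ky d0 yt yd]]] := IH (fun z' zl => lK z' ltac:(by rewrite in_cons zl orbT)).
  have Kz : K z by apply: lK; rewrite mem_head.
  (* If the mean of two numbers is at least [r0 - d'] and one of them is at most [r0 + d'], the
     other is at least [r0 - 3 * d']. *)
  pose d' := Num.min d e / 3; have d'0 : 0 < d' by rewrite divr_gt0// lt_min d0.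
  have d'd : 3 * d' <= d by rewrite /d' mulrC divfK ?pnatr_eq0// ge_min lexx.
  have d'e : 3 * d' <= e by rewrite /d' mulrC divfK ?pnatr_eq0// ge_min lexx orbT.
  have sub w t : (forall z', z' \in x0 :: z :: l -> nr (w - z') <= t) ->
      nr (w - y) <= t /\ nr (w - z) <= t.
    move=> H; split; last by apply: H; rewrite !in_cons eqxx orbT.
    apply: yt => z'; rewrite in_cons => zl; apply: H; rewrite !in_cons.
    by case/orP: zl => ->; rewrite ?orbT.
  pose m := (2^-1)%:C%C *: z + (1 - 2^-1)%:C%C *: y.
  have mE w : w - m = (2^-1)%:C%C *: ((w - z) + (w - y)).
    rewrite /m (_ : 1 - 2^-1 = 2^-1); last by lra.
    by rewrite -{1}(halfD w); lmod.
  have mle w : nr (w - m) <= (nr (w - z) + nr (w - y)) / 2.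
    by rewrite mE nrZR ger0_norm ?invr_ge0// mulrC ler_wpM2r ?invr_ge0// nrD.
  exists m, d'; split=> //.
  - by apply: (convex_setE K).1 => //; apply/andP; split; lra.
  - by move=> w t /sub[H1 H2]; have := mle w; lra.
  move=> w wm wz z' zl; have [H1 H2] := sub _ _ wz; have := mle w => H3.
  have : z' \in x0 :: l \/ z' = z.
    move: zl; rewrite !in_cons => /or3P[->|/eqP|->]; rewrite ?orbT; by [left|right].
  case=> [zl'|->]; last by lra.
  apply: yd => //; first by lra.
  move=> z'' zl''; rewrite (le_trans (wz z'' _))//.
    by move: zl''; rewrite !in_cons => /orP[]->; rewrite ?orbT.
  by lra.
have := r0_ge0; rewrite le_eqVlt => /predU1P[r00|r0_gt0].
  move=> s; apply/eqP; rewrite -subr_eq0; apply/eqP/nr_small => e e0.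
  have e2 : 0 < e / 2 by rewrite divr_gt0.
  have xsK z : z \in [:: act s x0; x0] -> K z.
    by rewrite !in_cons in_nil orbF => /orP[]/eqP-> //; exact: Ki.
  have [c [_ Hc]] := tail_above _ _ s0 e2 xsK.
  have := Hc (act s x0) s0; have := Hc x0 s0; rewrite !in_cons !eqxx !orbT -r00 !add0r.
  move=> /(_ isT) h1 /(_ isT) h2; rewrite (le_trans (nr_tri (orb (c ** s0)) _ _))// (splitr e).
  by rewrite lerD// nr_sub.
exfalso.
(* These conditions, for all finite lists at once, force an ultrafilter through the tails to stay at
   limit distance at least [r0] from every point of [K], including its own weak-* limit. *)
pose D (i : seq (dual A) * R) := (forall z, z \in i.1 -> K z) /\ 0 < i.2.
pose Q (i : seq (dual A) * R) := [set w | K w /\ forall z, z \in i.1 -> r0 - i.2 <= nr (w - z)].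
have [|||F [FU Ft FQ]] := @tail_ultra (seq (dual A) * R) D Q S0.
- by exists ([::], 1).
- move=> [l1 e1] [l2 e2] [/= K1 p1] [/= K2 p2]; exists (l1 ++ l2, Num.min e1 e2).
    split=> /= [z|]; last by rewrite lt_min p1.
    by rewrite mem_cat => /orP[/K1|/K2].
  move=> w [Kw Hw]; split; split=> //= z zl.
    apply: le_trans (Hw z _); last by rewrite mem_cat zl.
    by rewrite lerB// ge_min lexx.
  apply: le_trans (Hw z _); last by rewrite mem_cat zl orbT.
  by rewrite lerB// ge_min lexx orbT.
- move=> [l e] a [/= lK e0]; have [y [d [Ky d0 _ yd]]] := mean l e e0 lK.
  have xlK z : z \in x0 :: l -> K z by rewrite in_cons => /predU1P[->|/lK].
  have [c [ca Hc]] := tail_above _ d a d0 xlK.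
  have [s Hs] := below y d c Ky d0; exists (orb (c ** s)); split.
    by apply: ca; exact: tail_orb.
  split=> [|z zl /=]; first exact: Ki.
  by apply: yd; rewrite ?in_cons ?zl ?orbT// => z' z'l; exact: Hc.
have FF : ProperFilter F by exact: ultra_proper.
have FK : F K by apply: filterS (FQ ([::], 1) _) => // w [].
have [w Kw Hw] := wK F FU FK.
(* In units of [e] the Kadec-Klee inequality would give [19^2 + (19 / 2)^2 <= 21^2], which is false
   by [41 / 4]. *)
have [e e0 r0E] : exists2 e, 0 < e & r0 = 20 * e.
  by exists (r0 / 20); rewrite ?divr_gt0// mulrC divfK// pnatr_eq0.
have Fw : F [set f | r0 - e <= nr (f - w)].
  apply: filterS (FQ ([:: w], e) _) => [f [_ /(_ w)]|]; first by rewrite mem_seq1 eqxx; exact.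
  by split=> //= z; rewrite mem_seq1 => /eqP->.
have [f /= [Kf fw]] := filter_ex (filterI FK Fw).
have Ff : F [set g | nr (g - f) <= r0 + e].
  have [a Ha] := above f e Kf e0; apply: filterS (Ft a) => g [_]; exact.
have d0 : 0 <= r0 - e by rewrite r0E; lra.
have sq : (r0 - e) ^+ 2 <= nr (w - f) ^+ 2 by rewrite ler_sqr ?nnegrE ?nr_ge0// nr_sub.
have num : (r0 + e) ^+ 2 < (r0 - e) ^+ 2 + ((r0 - e) / 2) ^+ 2.
  rewrite r0E -subr_gt0 [X in 0 < X](_ : _ = e ^+ 2 * (41 / 4)); last by field.
  by rewrite mulr_gt0 ?exprn_gt0// divr_gt0.
have Hn x : ulim F (fun g : dual A => (g - w) x) 0.
  by move=> d dd; apply: filterS (Hw x d dd) => g /=; rewrite subr0.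
have Hf : F [set g | nr ((w - f) + (g - w)) <= r0 + e].
  by apply: filterS Ff => g /=; have -> : w - f + (g - w) = g - f by lmod.
have H := kadec_klee atomicA FF Hn Hf Fw d0.
by move: (le_lt_trans H num); rewrite ltrD2r ltNge sq.
Qed.

End orbit.

End common_fixed_point.

Theorem left_reversible_of_atomic (R : realType) (A : cStarAlgType R) :
  @atomic R A -> weak_star_fpp_left_reversible A.
Proof.
move=> atA S C act revS [C0 cC cxC] actC ctsC nexC.
have wC := wcompP cC; have [M bdC] := wcomp_bounded wC.
have [S0|nS] := pselect (exists s : S, True); last first.
  by have [x Cx] := C0; exists x; split=> // s; case: nS; exists s.
have [|K [iK Kmin]] := @minimal_invariant _ _ _ C act.
  by split=> //; move=> s f; exact: actC.1.
have [KC [x Kx] _ _ _] := iK; exists x; split; first exact: KC.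
exact: (minimal_invariant_fixed atA revS actC ctsC nexC bdC (KC _ Kx) iK Kx S0 Kmin).
Qed.

(** * Representations and the spectrum *)

Section hilbert.
Context {R : realType} {H : hilbertType R}.
Implicit Types (u v w x y z : H) (k : R[i]) (V : set H).

Lemma ipP k u v w : inner (k *: u + v) w = k * inner u w + inner v w.
Proof. exact: linearPl. Qed.

Lemma ipDl u v w : inner (u + v) w = inner u w + inner v w.
Proof. exact: linearDl. Qed.

Lemma ipBl u v w : inner (u - v) w = inner u w - inner v w.
Proof. exact: linearBl. Qed.

Lemma ipDr u v w : inner u (v + w) = inner u v + inner u w.
Proof. exact: linearDr. Qed.

Lemma ipBr u v w : inner u (v - w) = inner u v - inner u w.
Proof. exact: linearBr. Qed.

Lemma ipZl k u v : inner (k *: u) v = k * inner u v.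
Proof. exact: linearZl_LR. Qed.

Lemma ipZr k u v : inner u (k *: v) = k^* * inner u v.
Proof. exact: linearZr_LR. Qed.

Lemma ip0l u : inner 0 u = 0. Proof. exact: linear0l. Qed.
Lemma ip0r u : inner u 0 = 0. Proof. exact: linear0r. Qed.

Lemma ipC u v : inner v u = (inner u v)^*.
Proof. by rewrite hermC expr0 mul1r. Qed.

Lemma ip_nr u : inner u u = (nr u ^+ 2)%:C%C.
Proof. by rewrite -inner_norm nrE rmorphXn. Qed.

Lemma ip_le u v : nr (inner u v) <= nr u * nr v.
Proof.
rewrite -ler_sqr ?nnegrE ?mulr_ge0 ?nr_ge0// exprMn.
have := @cauchy_schwarz R H (fun u v => inner u v) ipP ipC _ u v.
by rewrite !ip_nr /=; apply=> x; rewrite ip_nr ler0c sqr_ge0.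
Qed.

Lemma ip_eq0 u : (forall v, inner u v = 0) -> u = 0.
Proof.
move=> /(_ u); rewrite ip_nr => /eqP; rewrite -(rmorph0 (real_complex R)).
by move=> /eqP[] /eqP; rewrite sqrf_eq0 => /eqP/nr0_eq0.
Qed.

Lemma nrD_ortho u v : inner u v = 0 -> nr (u + v) ^+ 2 = nr u ^+ 2 + nr v ^+ 2.
Proof.
move=> uv; apply: complexI; rewrite rmorphD /= -!ip_nr ipDl !ipDr (ipC u v) uv.
by rewrite rmorph0 addr0 add0r.
Qed.

Lemma closed_nr V : closed V <-> forall x, (forall e, 0 < e -> exists2 y, V y & nr (x - y) <= e) -> V x.
Proof.
split=> [cV x Hx|HV x Vx].
  apply: cV => B /nbhs_ballP[e /= e0 eB].
  have er : e = (complex.Re e)%:C%C by rewrite RRe_real// gtr0_real.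
  have r0 : 0 < complex.Re e by rewrite -gt0C -er.
  have r2 : 0 < complex.Re e / 2 by rewrite divr_gt0.
  have [y Vy xy] := Hx _ r2; exists y; split=> //; apply: eB; rewrite -ball_normE /=.
  by rewrite er nrE ltcR (le_lt_trans xy)// ltr_pdivrMr// ltr_pMr// ltr1n.
apply: HV => e e0; have [|y [Vy]] := Vx (ball x (e%:C%C : R[i])).
  by apply: nbhsx_ballx; rewrite gt0C.
rewrite -ball_normE /= => xy; exists y => //.
by rewrite nr_le; exact: ltW.
Qed.

End hilbert.

Section representations.
Context {R : realType} {A : cStarAlgType R}.
Local Notation U := (unitization A).
Local Notation "t %:u" := (t%:C%C *: (1 : U)) (at level 2, format "t %:u").
Implicit Types (pi sigma : representation A) (a b : A) (x y p : U) (k : R[i]).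

Section rep.
Variable pi : representation A.
Implicit Types (u v w : rep_space pi).

Lemma repP a k u v : pi a (k *: u + v) = k *: pi a u + pi a v.
Proof. exact: rep_op_linear. Qed.

Lemma rep_Pl k a b v : pi (k *: a + b) v = k *: pi a v + pi b v.
Proof. exact: rep_linear. Qed.

Lemma repD a u v : pi a (u + v) = pi a u + pi a v.
Proof. by have := repP a 1 u v; rewrite !scale1r. Qed.

Lemma rep0 a : pi a 0 = 0.
Proof. by have := repP a (-1) 0 0; rewrite scaler0 addr0 scaleN1r addNr. Qed.

Lemma repZ a k v : pi a (k *: v) = k *: pi a v.
Proof. by have := repP a k v 0; rewrite !addr0 rep0 addr0. Qed.

Lemma repB a u v : pi a (u - v) = pi a u - pi a v.
Proof. by rewrite [u - v]addrC -scaleN1r repP scaleN1r addrC. Qed.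

Lemma rep_Dl a b v : pi (a + b) v = pi a v + pi b v.
Proof. by have := rep_Pl 1 a b v; rewrite !scale1r. Qed.

Lemma rep_0l v : pi 0 v = 0.
Proof. by have := rep_Pl (-1) 0 0 v; rewrite scaler0 addr0 scaleN1r addNr. Qed.

Lemma rep_Zl k a v : pi (k *: a) v = k *: pi a v.
Proof. by have := rep_Pl k a 0 v; rewrite !addr0 rep_0l addr0. Qed.

Lemma rep_Bl a b v : pi (a - b) v = pi a v - pi b v.
Proof. by rewrite [a - b]addrC -scaleN1r rep_Pl scaleN1r addrC. Qed.

Definition urep x v := x.1 *: v + pi x.2 v.

Lemma urepM x y v : urep (x * y) v = urep x (urep y v).
Proof. by rewrite /urep /= !rep_Dl !rep_Zl repM repD repZ; lmod. Qed.

Lemma urep_star x u v : inner (urep x u) v = inner u (urep (ustar x) v).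
Proof. by rewrite /urep /= ipDl ipDr ipZl ipZr conjCK rep_star. Qed.

Lemma urepZ k x v : urep (k *: x) v = k *: urep x v.
Proof. by rewrite /urep rep_Zl scalerDr scalerA. Qed.

Lemma urepB x y v : urep (x - y) v = urep x v - urep y v.
Proof. by rewrite /urep /= rep_Bl; lmod. Qed.

Lemma urep1 v : urep 1 v = v.
Proof. by rewrite /urep /= rep_0l scale1r addr0. Qed.

Lemma urep_inA x v : inA x -> urep x v = pi x.2 v.
Proof. by rewrite /urep => ->; rewrite scale0r add0r. Qed.

Lemma urep_ge0 x v : upos x -> 0 <= inner (urep x v) v.
Proof.
move=> /upos_sqrt[s [ps <- _]].
by rewrite urepM urep_star (upos_sa ps) ip_nr ler0c sqr_ge0.
Qed.

Lemma urep_le x v : nr (urep x v) <= un x * nr v.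
Proof.
rewrite -ler_sqr ?nnegrE ?mulr_ge0 ?nr_ge0 ?un_ge0// exprMn -subr_ge0 -ler0c.
have := urep_ge0 v (upos_norm_sub (usa_starM x)).
have E : inner (urep (ustar x * x) v) v = inner (urep x v) (urep x v).
  by rewrite urepM urep_star ustarK.
rewrite un_starM urepB urepZ urep1 ipBl ipZl E !ip_nr.
by rewrite -rmorphM -rmorphB.
Qed.

Lemma rep_le a v : nr (pi a v) <= nr a * nr v.
Proof. by have := urep_le (uin a) v; rewrite urep_inA// un_uin. Qed.

End rep.

Definition rep_dense pi (xi : rep_space pi) :=
  forall v e, 0 < e -> exists a, nr (v - pi a xi) <= e.

(** The closure of the orbit of [xi] is invariant. If it were zero, [xi] would lie in the closed
    invariant subspace annihilated by all operators, which is zero as well because the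
    representation is not null. *)
Lemma irreducible_dense pi (xi : rep_space pi) : irreducible pi -> xi != 0 -> rep_dense xi.
Proof.
move=> [[a0 [v0 av0]] irr] xi0.
pose V (w : rep_space pi) := forall e, 0 < e -> exists a, nr (w - pi a xi) <= e.
have cV : closed_subspace V.
  split.
  - apply/closed_nr => x Hx e e0; have e2 : 0 < e / 2 by rewrite divr_gt0.
    have [y Vy xy] := Hx _ e2; have [a ya] := Vy _ e2; exists a.
    by rewrite (le_trans (nr_tri y _ _))// (splitr e) lerD.
  - by move=> e e0; exists 0; rewrite rep_0l subrr nr0 ltW.
  - move=> c u v Vu Vv e e0; have k0 : 0 < nr c + 1 by rewrite ltr_wpDl ?nr_ge0.
    have [a ua] := Vu (e / 2 / (nr c + 1)) ltac:(by rewrite !divr_gt0).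
    have [b vb] := Vv (e / 2) ltac:(by rewrite divr_gt0).
    exists (c *: a + b); rewrite rep_Pl opprD addrACA -scalerBr.
    rewrite (le_trans (nrD _ _))// (splitr e) lerD// nrZ.
    rewrite (@le_trans _ _ ((nr c + 1) * nr (u - pi a xi)))//.
      by rewrite ler_wpM2r ?nr_ge0// lerDl.
    by rewrite mulrC -ler_pdivlMr.
have Vinv a v : V v -> V (pi a v).
  move=> Vv e e0; have k0 : 0 < nr a + 1 by rewrite ltr_wpDl ?nr_ge0.
  have [b vb] := Vv (e / (nr a + 1)) ltac:(by rewrite divr_gt0).
  exists (cmul a b); rewrite repM -repB (le_trans (rep_le _ _))//.
  rewrite (@le_trans _ _ ((nr a + 1) * nr (v - pi b xi)))//.
    by rewrite ler_wpM2r ?nr_ge0// lerDl.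
  by rewrite mulrC -ler_pdivlMr.
have [V0|VT] := irr V cV Vinv; last by move=> v; have : setT v by []; rewrite -VT.
have Vxi a : V (pi a xi) by move=> e e0; exists a; rewrite subrr nr0 ltW.
have xi_null a : pi a xi = 0 by have := Vxi a; rewrite V0.
have cN : closed_subspace [set v | forall a, pi a v = 0].
  split.
  - apply/closed_nr => x Hx a; apply: nr_small => e e0.
    have k0 : 0 < nr a + 1 by rewrite ltr_wpDl ?nr_ge0.
    have [y Vy xy] := Hx (e / (nr a + 1)) ltac:(by rewrite divr_gt0).
    rewrite -[pi a x](_ : pi a (x - y) = _); last by rewrite repB Vy subr0.
    rewrite (le_trans (rep_le _ _))// (@le_trans _ _ ((nr a + 1) * nr (x - y)))//.
      by rewrite ler_wpM2r ?nr_ge0// lerDl.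
    by rewrite mulrC -ler_pdivlMr.
  - by move=> a; rewrite rep0.
  - by move=> c u v Hu Hv a; rewrite repP Hu Hv scaler0 addr0.
have [|N0|NT] := irr _ cN.
- by move=> a v Hv b; rewrite Hv rep0.
- by have : [set 0] xi by [rewrite -N0]; move=> /= /eqP; rewrite (negbTE xi0).
- have : setT v0 by []; rewrite -NT => /(_ a0) /eqP.
  by rewrite (negbTE av0).
Qed.

Section equivalence.
Variables (pi sigma : representation A) (xi : rep_space pi) (eta : rep_space sigma).
Hypotheses (dxi : rep_dense xi) (deta : rep_dense eta)
  (state_eq : forall a, inner (pi a xi) xi = inner (sigma a eta) eta).

Let ip_eq a b : inner (pi a xi) (pi b xi) = inner (sigma a eta) (sigma b eta).
Proof. by rewrite -[b]cstarK -!rep_star -!repM state_eq. Qed.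

Let nr_eq a : nr (pi a xi) = nr (sigma a eta).
Proof.
apply/eqP; rewrite -(@eqrXn2 _ 2) ?nr_ge0// -(inj_eq (@complexI R)) -!ip_nr.
by rewrite ip_eq.
Qed.

(** The graph of the closure of the isometry sending [pi a xi] to [sigma a eta]. *)
Definition intertwined v w := forall e, 0 < e ->
  exists a, nr (v - pi a xi) <= e /\ nr (w - sigma a eta) <= e.

Lemma intertwined_ex v : exists w, intertwined v w.
Proof.
have /choice[a Ha] : forall n, exists a, nr (v - pi a xi) <= n.+1%:R^-1.
  by move=> n; apply: dxi; rewrite invr_gt0.
have small (e : R) : 0 < e -> exists M, forall n, (M <= n)%N -> n.+1%:R^-1 <= e.
  move=> e0; exists (Num.truncn e^-1).+1 => n Mn.
  rewrite -[leRHS]invrK lef_pV2 ?posrE ?invr_gt0//.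
  by rewrite (le_trans (ltW (truncnS_gt _)))// ler_nat leqW.
have [|w Hw] := @nr_complete _ _ (fun n => sigma (a n) eta).
  move=> e e0; have e2 : 0 < e / 2 by rewrite divr_gt0.
  have [M HM] := small _ e2; exists M => m n Mm Mn.
  rewrite -rep_Bl -nr_eq rep_Bl (le_trans (nr_tri v _ _))// (splitr e) lerD//.
    by rewrite nr_sub (le_trans (Ha m))// HM.
  by rewrite (le_trans (Ha n))// HM.
exists w => e e0; have [M HM] := small _ e0; have [N HN] := Hw _ e0.
exists (a (maxn M N)); split; first by rewrite (le_trans (Ha _))// HM// leq_maxl.
by rewrite nr_sub HN// leq_maxr.
Qed.

Lemma intertwined_lin k v w v' w' : intertwined v w -> intertwined v' w' ->
  intertwined (k *: v + v') (k *: w + w').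
Proof.
move=> H H' e e0; have k0 : 0 < nr k + 1 by rewrite ltr_wpDl ?nr_ge0.
have [a [a1 a2]] := H (e / 2 / (nr k + 1)) ltac:(by rewrite !divr_gt0).
have [b [b1 b2]] := H' (e / 2) ltac:(by rewrite divr_gt0).
have E (V : normedModType R[i]) (x y : V) : nr x <= e / 2 / (nr k + 1) -> nr y <= e / 2 ->
    nr (k *: x + y) <= e.
  move=> hx hy; rewrite (le_trans (nrD _ _))// (splitr e) lerD// nrZ.
  rewrite (@le_trans _ _ ((nr k + 1) * nr x))//; first by rewrite ler_wpM2r ?nr_ge0// lerDl.
  by rewrite mulrC -ler_pdivlMr.
by exists (k *: a + b); split; rewrite rep_Pl opprD addrACA -scalerBr; exact: E.
Qed.

Lemma intertwined_nr v w : intertwined v w -> nr v = nr w.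
Proof.
move=> H; apply/eqP; rewrite eq_le; apply/andP; split; apply/ler_addgt0Pr => e e0;
  have e2 : 0 < e / 2 by [rewrite divr_gt0];
  have [a [a1 a2]] := H _ e2; have E := nr_eq a.
  have := nr_dist v (pi a xi); have := nr_dist (sigma a eta) w; rewrite (nr_sub _ w).
  by move: a1 a2 E => + + ->; lra.
have := nr_dist w (sigma a eta); have := nr_dist (pi a xi) v; rewrite (nr_sub _ v).
by move: a1 a2 E => + + ->; lra.
Qed.

Lemma intertwined_uniq v w w' : intertwined v w -> intertwined v w' -> w = w'.
Proof.
move=> H H'; have := intertwined_nr (intertwined_lin (-1) H H').
by rewrite !scaleN1r addNr nr0 addrC => /esym/nr0_eq0/eqP; rewrite subr_eq0 => /eqP.
Qed.

Lemma intertwined_rep b v w : intertwined v w -> intertwined (pi b v) (sigma b w).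
Proof.
move=> H e e0; have k0 : 0 < nr b + 1 by rewrite ltr_wpDl ?nr_ge0.
have [a [a1 a2]] := H (e / (nr b + 1)) ltac:(by rewrite divr_gt0).
have E (t : R) : 0 <= t -> t <= e / (nr b + 1) -> nr b * t <= e.
  move=> t0 te; rewrite (@le_trans _ _ ((nr b + 1) * t))//; first by rewrite ler_wpM2r// lerDl.
  by rewrite mulrC -ler_pdivlMr.
by exists (cmul b a); rewrite !repM -!repB; split; rewrite (le_trans (rep_le _ _))// E ?nr_ge0.
Qed.

End equivalence.

Lemma intertwinedC pi sigma (xi : rep_space pi) (eta : rep_space sigma) v w :
  intertwined xi eta v w -> intertwined eta xi w v.
Proof. by move=> H e /H[a [a1 a2]]; exists a. Qed.

Lemma equivalent_of_states pi sigma (xi : rep_space pi) (eta : rep_space sigma) :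
  rep_dense xi -> rep_dense eta ->
  (forall a, inner (pi a xi) xi = inner (sigma a eta) eta) -> unitarily_equivalent pi sigma.
Proof.
move=> dxi deta E; have /choice[W HW] := intertwined_ex dxi E.
have lW : linear W.
  move=> k u v; apply: (intertwined_uniq E (HW _)).
  exact: intertwined_lin.
have nW v : nr (W v) = nr v by rewrite -(intertwined_nr E (HW v)).
exists W; split=> //.
- move=> y; have [x Hx] := intertwined_ex deta (fun a => esym (E a)) y.
  by exists x; apply: (intertwined_uniq E (HW x)); exact: intertwinedC.
- move=> x y; apply/eqP; rewrite -subr_eq0; apply/eqP/nr0_eq0/eqP; rewrite -sqrf_eq0 eq_le sqr_ge0 andbT.
  have B0 z : inner (W z) (W z) - inner z z = 0 by rewrite !ip_nr nW subrr.
  (* In place of polarisation: the difference of the two forms is zero on the diagonal, hence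
     positive semidefinite, and Cauchy-Schwarz makes it zero. *)
  have := @cauchy_schwarz R _ (fun u v : rep_space pi => inner (W u) (W v) - inner u v) _ _ _ x y.
  rewrite !B0 mul0r; apply.
  + by move=> k u v w; rewrite lW !ipP; ring.
  + by move=> u v; rewrite rmorphB/= -!ipC.
  + by move=> u; rewrite B0.
- move=> a v; apply: (intertwined_uniq E (HW _)); exact: intertwined_rep.
Qed.

End representations.

Section spectrum.
Context {R : realType} {A : cStarAlgType R}.
Local Notation U := (unitization A).
Implicit Types (pi sigma rho : irrep A) (a b : A) (x y p : U) (k : R[i]).

Lemma unitarily_equivalent_sym (pi sigma : representation A) :
  unitarily_equivalent pi sigma -> unitarily_equivalent sigma pi.
Proof.
move=> [W [lW sW iW WE]]; have /choice[V VK] := sW.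
have Winj : injective W.
  move=> u v uv; apply/eqP; rewrite -subr_eq0; apply/eqP/ip_eq0 => w.
  have E : W (u - v) = 0 by rewrite addrC -scaleN1r lW uv scaleN1r addNr.
  by rewrite -iW E ip0l.
have KV u : V (W u) = u by apply: Winj.
exists V; split.
- by move=> k u v; apply: Winj; rewrite lW !VK.
- by move=> u; exists (W u).
- by move=> u v; rewrite -iW !VK.
- by move=> a u; apply: Winj; rewrite WE !VK.
Qed.

Lemma unitarily_equivalent_trans (pi sigma rho : representation A) :
  unitarily_equivalent pi sigma -> unitarily_equivalent sigma rho ->
  unitarily_equivalent pi rho.
Proof.
move=> [V [lV sV iV VE]] [W [lW sW iW WE]]; exists (W \o V); split=> /=.
- by move=> k u v /=; rewrite lV lW.
- by move=> y; have [z <-] := sW y; have [u <-] := sV z; exists u.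
- by move=> u v; rewrite iW iV.
- by move=> a u; rewrite VE WE.
Qed.

Definition sclass pi : spectrum A :=
  exist _ (fun rho : irrep A => unitarily_equivalent pi rho) (ex_intro _ pi erefl).

Lemma sclass_eq (c : spectrum A) pi : sval c pi -> c = sclass pi.
Proof.
case: c => c [rho cE] /= cpi; apply: eq_exist => /=; rewrite cE in cpi *.
apply/funext => sigma; apply/propext; split=> H.
  exact: unitarily_equivalent_trans (unitarily_equivalent_sym cpi) H.
exact: unitarily_equivalent_trans cpi H.
Qed.

Lemma sclass_ex (c : spectrum A) : exists pi, c = sclass pi.
Proof.
have [pi cpi] : exists pi : irrep A, sval c pi.
  by case: c => c [pi cE]; exists pi; rewrite /= cE; exact: unitarily_equivalent_refl.
by exists pi; exact: sclass_eq.
Qed.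

Lemma sclass_equiv pi sigma : sclass pi = sclass sigma -> unitarily_equivalent pi sigma.
Proof.
move=> /(congr1 (fun c => sval c sigma)) /= ->; exact: unitarily_equivalent_refl.
Qed.

Lemma prim_ext (P Q : prim A) : prim_ideal P = prim_ideal Q -> P = Q.
Proof.
by case: P Q => [P pP] [Q pQ] /= E; subst; congr Prim; exact: Prop_irrelevance.
Qed.

Lemma spectrum_primE pi : prim_ideal (spectrum_prim (sclass pi)) = rep_ker pi.
Proof.
by rewrite /= (@spectrum_kerE _ _ (sclass pi) pi)//; exact: unitarily_equivalent_refl.
Qed.

Lemma rep_kerN pi a : ~ rep_ker pi a -> exists v, pi a v != 0.
Proof.
move=> H; apply: contrapT => /forallNP K; apply: H => v.
by apply/eqP/negPn/negP; exact: K.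
Qed.

(** The class of [pi] is an open point, so the common kernel of the remaining primitive ideals is
    not contained in that of [pi]; any element of the difference will do. *)
Lemma discrete_isolated pi : spectrum_discrete A -> exists a, ~ rep_ker pi a /\
  forall sigma, ~ rep_ker sigma a -> unitarily_equivalent pi sigma.
Proof.
move=> disc; have [G oG HG] := disc (fun c => c = sclass pi).
have Gpi : G (spectrum_prim (sclass pi)) by apply/HG.
have [a [aG api]] : exists a, Defs.kernel (~` G) a /\ ~ rep_ker pi a.
  apply: contrapT => /forallNP K.
  apply: (oG _ _ Gpi).
  move=> a aG; rewrite spectrum_primE; apply: contrapT => na.
  by apply: (K a).
exists a; split=> // sigma na; apply: sclass_equiv; symmetry; apply/HG.
apply: contrapT => nG; apply: na; have := aG _ nG.
by rewrite spectrum_primE.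
Qed.

Section atomic.
Hypothesis atomicA : @atomic R A.

Lemma irrep_minproj pi : exists p, minproj p /\ ~ rep_ker pi p.2.
Proof.
have [[a [v av0]] _] := irrepP pi.
apply: contrapT => /forallNP H.
have Hp p w : minproj p -> pi p.2 w = 0.
  by move=> mp; apply: contrapT => pw; apply: (H p); split=> // /(_ w).
have Hs y (w : rep_space pi) : minspan y -> urep y w = 0.
  elim=> [|{}y u p u' _ IH mp]; first by rewrite /urep /= scale0r rep_0l addr0.
  have [Ap _ _ _ _] := mp.
  have -> : urep (y + u * p * u') w = urep y w + urep u (urep p (urep u' w)).
    by rewrite -!urepM /urep /= rep_Dl; lmod.
  by rewrite IH add0r (urep_inA _ Ap) Hp// /urep rep0 scaler0 addr0.
move/eqP: av0; apply; apply: nr_small => e e0.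
have k0 : 0 < nr v + 1 by rewrite ltr_wpDl ?nr_ge0.
have [y my xy] := atomicA (inA_uin a) (divr_gt0 e0 k0).
have -> : pi a v = urep (uin a - y) v by rewrite urepB (Hs y)// subr0 urep_inA.
rewrite (le_trans (urep_le _ _))// (@le_trans _ _ (un (uin a - y) * (nr v + 1)))//.
  by rewrite ler_wpM2l ?un_ge0// lerDl.
by rewrite -ler_pdivlMr.
Qed.

(** As [p * uin a * p] is a multiple [l] of [p], a unit vector fixed by [p] has the vector state
    sending [a] to [l], in either representation. *)
Lemma minproj_equiv p pi sigma : minproj p ->
  ~ rep_ker pi p.2 -> ~ rep_ker sigma p.2 -> unitarily_equivalent pi sigma.
Proof.
move=> [Ap sp pp p0 minp] npi nsigma.
have unit (rho : irrep A) : ~ rep_ker rho p.2 -> exists xi : rep_space rho,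
    nr xi = 1 /\ rho p.2 xi = xi.
  move=> /rep_kerN[v pv]; set w := rho p.2 v in pv.
  have w0 : 0 < nr w by rewrite lt_def nr_ge0 andbT; apply: contra_neq pv => /nr0_eq0.
  exists ((nr w)^-1%:C%C *: w); split.
    by rewrite nrZR gtr0_norm ?invr_gt0// mulVf// gt_eqF.
  rewrite repZ /w -repM; congr (_ *: rho _ v).
  by have := congr1 snd pp; rewrite /= Ap !scale0r !add0r.
have [xi [xi1 pxi]] := unit pi npi; have [eta [eta1 peta]] := unit sigma nsigma.
have nz (V : normedModType R[i]) (v : V) : nr v = 1 -> v != 0.
  by move=> v1; apply/eqP => v0; move: v1; rewrite v0 nr0 => /esym/eqP; rewrite oner_eq0.
apply: (@equivalent_of_states _ _ pi sigma xi eta).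
- exact: irreducible_dense (irrepP pi) (nz _ _ xi1).
- exact: irreducible_dense (irrepP sigma) (nz _ _ eta1).
move=> a; have [l Hl] := minp (uin a) (inA_uin a).
have E (rho : irrep A) (v : rep_space rho) : nr v = 1 -> rho p.2 v = v -> inner (rho a v) v = l.
  move=> v1 pv; have {1}-> : v = urep p v by rewrite urep_inA.
  have {2}-> : v = urep p v by rewrite urep_inA.
  have -> z : rho a z = urep (uin a) z by rewrite urep_inA.
  rewrite -{2}sp -urep_star -!urepM.
  by rewrite Hl urepZ urep_inA// pv ipZl ip_nr v1 expr1n mulr1.
by rewrite !E.
Qed.

(** A minimal projection outside [rep_ker pi] belongs to every other primitive ideal, so the kernel
    of a set of primitive ideals without that of [pi] contains it; this makes every set of the form
    [O] open. *)
Lemma discrete_of_atomic : spectrum_discrete A.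
Proof.
move=> D; pose O : set (prim A) := [set P | exists pi, D (sclass pi) /\ P = spectrum_prim (sclass pi)].
have key p (P : prim A) pi : minproj p -> ~ rep_ker pi p.2 -> ~ prim_ideal P p.2 ->
    P = spectrum_prim (sclass pi).
  move=> mp npi nP; apply: prim_ext; rewrite spectrum_primE.
  have [sigma PE] := primP P; rewrite PE in nP *.
  by apply: rep_ker_unitary; exact: (minproj_equiv mp).
exists O.
  move=> P HP OP; have [pi [Dpi PE]] := OP.
  have [p [mp npi]] := irrep_minproj pi.
  apply: (npi); have : prim_ideal P p.2.
    apply: HP => Q nQ; apply: contrapT => nQp; apply: nQ; exists pi; split=> //.
    exact: key mp npi nQp.
  by rewrite PE spectrum_primE.
move=> c; have [pi ->] := sclass_ex c; split=> [Dpi|[sigma [Dsigma E]]]; first by exists pi.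
have [p [mp npi]] := irrep_minproj pi.
have nsigma : ~ rep_ker sigma p.2.
  by have := congr1 (fun P => prim_ideal P) E; rewrite !spectrum_primE => <-.
suff -> : sclass pi = sclass sigma by [].
by apply: sclass_eq => /=; exact: (minproj_equiv mp).
Qed.

End atomic.

End spectrum.

(** * The Gelfand-Naimark-Segal construction *)

Record preinner (R : realType) (V : lmodType R[i]) := Preinner {
  pform :> V -> V -> R[i];
  pform_lin : forall (k : R[i]) x y z, pform (k *: x + y) z = k * pform x z + pform y z;
  pform_conj : forall x y, pform y x = (pform x y)^*;
  pform_ge0 : forall x, 0 <= pform x x }.

Section preinner.
Context {R : realType} {V : lmodType R[i]} (B : preinner V).
Implicit Types (x y z : V) (k : R[i]).

Definition pnorm x : R := Num.sqrt (complex.Re (B x x)).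

Lemma pnorm_ge0 x : 0 <= pnorm x. Proof. exact: sqrtr_ge0. Qed.

Lemma pformE x : B x x = (pnorm x ^+ 2)%:C%C.
Proof.
have B0 := pform_ge0 B x; have E : B x x = (complex.Re (B x x))%:C%C.
  by rewrite RRe_real// ger0_real.
by rewrite sqr_sqrtr -?E// -ler0c -E.
Qed.

Lemma pform_le x y : nr (B x y) <= pnorm x * pnorm y.
Proof.
rewrite -ler_sqr ?nnegrE ?mulr_ge0 ?nr_ge0 ?pnorm_ge0// exprMn.
have := cauchy_schwarz (pform_lin B) (pform_conj B) (pform_ge0 B) x y.
by rewrite !pformE.
Qed.

Lemma pform_linr k x y z : B z (k *: x + y) = k^* * B z x + B z y.
Proof.
rewrite (pform_conj B _ z) pform_lin rmorphD rmorphM/=.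
by rewrite (pform_conj B x z) (pform_conj B y z).
Qed.

Lemma pnorm_le x (M : R) : 0 <= M -> (forall z, nr (B x z) <= M * pnorm z) -> pnorm x <= M.
Proof.
move=> M0 /(_ x); rewrite pformE nrR ger0_norm ?sqr_ge0// expr2.
have := pnorm_ge0 x; rewrite le_eqVlt => /predU1P[<-//|x0].
by rewrite ler_pM2r.
Qed.

(** Working among the functions on [V] identifies vectors at distance zero and completes in a single
    step, without a quotient. *)
Definition hpred : {pred V -> R[i]^o} := fun f => `[< forall e : R, 0 < e ->
  exists x, forall y, nr (B x y - f y) <= e * pnorm y >].

Let pform0 y : B 0 y = 0.
Proof.
have := pform_lin B (-1) 0 0 y; rewrite scaler0 addr0 mulN1r addNr.
exact.
Qed.

Lemma hpred_submod : submod_closed hpred.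
Proof.
split.
  apply/asboolP => e e0; exists 0 => y.
  by rewrite pform0 subrr nr0 mulr_ge0 ?pnorm_ge0// ltW.
move=> k f g /asboolP Hf /asboolP Hg; apply/asboolP => e e0.
have k0 : 0 < nr k + 1 by rewrite ltr_wpDl ?nr_ge0.
have [x Hx] := Hf (e / 2 / (nr k + 1)) ltac:(by rewrite !divr_gt0).
have [y Hy] := Hg (e / 2) ltac:(by rewrite divr_gt0).
exists (k *: x + y) => z; rewrite pform_lin.
have -> : k * B x z + B y z - (k *: f + g) z = k * (B x z - f z) + (B y z - g z).
  by rewrite mulrBr opprD addrACA.
rewrite (le_trans (nrD _ _))// (splitr e) mulrDl lerD// nrM.
rewrite (@le_trans _ _ ((nr k + 1) * nr (B x z - f z)))//.
  by rewrite ler_wpM2r ?nr_ge0// lerDl.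
rewrite (@le_trans _ _ ((nr k + 1) * (e / 2 / (nr k + 1) * pnorm z)))//.
  by rewrite ler_wpM2l// ltW.
by rewrite mulrA [(nr k + 1) * _]mulrC divfK// gt_eqF.
Qed.

HB.instance Definition _ := GRing.isSubmodClosed.Build R[i] (V -> R[i]^o) hpred hpred_submod.

(* The completion of [V]: the limits, in the norm of the antidual, of the functionals [B x]. *)
Record hcomp := HComp { hfun :> V -> R[i]^o; hfunP : hfun \in hpred }.

HB.instance Definition _ := [isSub for hfun].
HB.instance Definition _ := [Choice of hcomp by <:].
HB.instance Definition _ := [SubChoice_isSubLmodule of hcomp by <:].

Implicit Types f g h : hcomp.

Lemma hcomp_ext f g : (forall y, f y = g y) -> f = g.
Proof. by move=> E; apply/val_inj/funext. Qed.

Let hn f : R := inf [set M | 0 <= M /\ forall y, nr (f y) <= M * pnorm y].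

Let hS f : [set M | 0 <= M /\ forall y, nr (f y) <= M * pnorm y] !=set0.
Proof.
have /asboolP/(_ 1 ltr01)[x Hx] := hfunP f; exists (pnorm x + 1).
split=> [|y]; first by rewrite addr_ge0 ?pnorm_ge0.
rewrite (le_trans (nr_dist _ (B x y)))// mulrDl lerD ?pform_le// nr_sub.
exact: Hx.
Qed.

Let hlb f : has_lbound [set M | 0 <= M /\ forall y, nr (f y) <= M * pnorm y].
Proof. by exists 0 => M []. Qed.

Let hn_le f (M : R) : 0 <= M -> (forall y, nr (f y) <= M * pnorm y) -> hn f <= M.
Proof. by move=> M0 HM; apply: (ge_inf (hlb f)). Qed.

Let hn_ge0 f : 0 <= hn f.
Proof. by apply: lb_le_inf => [|M []]; [exact: hS|]. Qed.

Let le_hn f y : nr (f y) <= hn f * pnorm y.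
Proof.
have := pnorm_ge0 y; rewrite le_eqVlt => /predU1P[y0|y0].
  by have [M [_ /(_ y)]] := hS f; rewrite -y0 !mulr0.
rewrite -ler_pdivrMr//; apply: lb_le_inf => [|M [_ HM]]; first exact: hS.
by rewrite ler_pdivrMr.
Qed.

Let hnorm f : R[i] := (hn f)%:C%C.

Let hnormD f g : hnorm (f + g) <= hnorm f + hnorm g.
Proof.
rewrite -rmorphD lecR; apply: hn_le => [|y]; first exact: addr_ge0.
by rewrite (le_trans (nrD _ _))// mulrDl lerD.
Qed.

Let hnZ k f : hn (k *: f) <= nr k * hn f.
Proof.
apply: hn_le => [|y]; first by rewrite mulr_ge0 ?nr_ge0.
by rewrite [X in nr X](_ : _ = k * f y)// nrM -mulrA ler_wpM2l ?nr_ge0.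
Qed.

Let hnormZ k f : hnorm (k *: f) = `|k| * hnorm f.
Proof.
rewrite nrE -rmorphM; congr (_%:C%C); apply/eqP; rewrite eq_le hnZ/=.
have [->|k0] := eqVneq k 0; first by rewrite nr0 mul0r.
have nk : 0 < nr k by rewrite lt_def nr_ge0 andbT; apply: contra_neq k0 => /nr0_eq0.
have := hnZ k^-1 (k *: f); rewrite scalerA mulVf// scale1r => H.
rewrite -ler_pdivlMl// (le_trans H)// ler_wpM2r//.
by rewrite -[leLHS]mulr1 -(mulfV (lt0r_neq0 nk)) mulrA -nrM mulVf// nr1 mul1r.
Qed.

Let hnorm_eq0 f : hnorm f = 0 -> f = 0.
Proof.
move=> [/= f0]; apply: hcomp_ext => y; apply: nr0_eq0; apply/eqP.
by rewrite eq_le nr_ge0 andbT (le_trans (le_hn f y))// f0 mul0r.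
Qed.

HB.instance Definition _ := Lmodule_isNormed.Build R[i] hcomp hnormD hnormZ hnorm_eq0.

Lemma hcomp_le f y : nr (f y) <= nr f * pnorm y. Proof. exact: le_hn. Qed.

Lemma hcomp_nr_le f (M : R) : 0 <= M -> (forall y, nr (f y) <= M * pnorm y) -> nr f <= M.
Proof. exact: hn_le. Qed.

Lemma hcompD f g y : (f + g) y = f y + g y. Proof. by []. Qed.
Lemma hcompB f g y : (f - g) y = f y - g y. Proof. by []. Qed.
Lemma hcompZ k f y : (k *: f) y = k * f y. Proof. by []. Qed.

Let hcomp_cauchy (u : nat -> hcomp) : ncauchy (fun m n => nr (u m - u n)) ->
  exists f, nnull (fun n => nr (u n - f)).
Proof.
move=> cu.
have pos y : 0 < pnorm y + 1 by rewrite ltr_wpDl ?pnorm_ge0.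
have cx y : ncauchy (fun m n => nr (u m y - u n y)).
  move=> e e0; have [M HM] := cu (e / (pnorm y + 1)) ltac:(by rewrite divr_gt0).
  exists M => m n Mm Mn; rewrite -hcompB (le_trans (hcomp_le _ _))//.
  rewrite (@le_trans _ _ (nr (u m - u n) * (pnorm y + 1)))//.
    by rewrite ler_wpM2l ?nr_ge0// lerDl.
  by rewrite -ler_pdivlMr// HM.
have [h Hh] := choice (fun y => complex_complete (cx y)).
have HM e : 0 < e -> exists M, forall n y, (M <= n)%N -> nr (u n y - h y) <= e * pnorm y.
  move=> e0; have [M HM] := cu e e0; exists M => n y Mn.
  apply/ler_addgt0Pr => d d0; have [N HN] := Hh y d d0.
  rewrite (le_trans (nr_tri (u (maxn M N) y) _ _))// lerD//.
    rewrite -hcompB (le_trans (hcomp_le _ _))// ler_wpM2r ?pnorm_ge0// HM//.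
    exact: leq_maxl.
  by rewrite HN// leq_maxr.
have hP : h \in hpred.
  apply/asboolP => e e0; have e2 : 0 < e / 2 by rewrite divr_gt0.
  have [M H] := HM _ e2; have /asboolP/(_ _ e2)[x Hx] := hfunP (u M).
  exists x => y; rewrite (le_trans (nr_tri (u M y) _ _))// (splitr e) mulrDl lerD//.
  by rewrite H.
exists (HComp hP) => e e0; have [M H] := HM e e0; exists M => n Mn.
by apply: hcomp_nr_le => [|y]; [exact: ltW|exact: H].
Qed.

Let hcomp_cauchy_cvg (F : set_system hcomp) : ProperFilter F -> cauchy F -> cvg F.
Proof.
move=> FF /cauchyP cF.
have /choice[u Hu] : forall n, exists f, F (ball f ((n.+1%:R^-1 : R)%:C%C : R[i])).
  by move=> n; apply: cF; rewrite gt0C invr_gt0.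
have {}Hu n : F [set g | nr (u n - g) <= n.+1%:R^-1].
  apply: filterS (Hu n) => g; rewrite -ball_normE /= => /ltW.
  by rewrite nr_le.
have small (e : R) : 0 < e -> exists M, forall n, (M <= n)%N -> n.+1%:R^-1 <= e.
  move=> e0; exists (Num.truncn e^-1).+1 => n Mn.
  rewrite -[leRHS]invrK lef_pV2 ?posrE ?invr_gt0//.
  by rewrite (le_trans (ltW (truncnS_gt _)))// ler_nat leqW.
have [|f Hf] := @hcomp_cauchy u.
  move=> e e0; have e2 : 0 < e / 2 by rewrite divr_gt0.
  have [M HM] := small _ e2; exists M => m n Mm Mn.
  have [g /= [gm gn]] := filter_ex (filterI (Hu m) (Hu n)).
  rewrite (le_trans (nr_tri g _ _))// (splitr e) lerD//.
    by rewrite (le_trans gm)// HM.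
  by rewrite nr_sub (le_trans gn)// HM.
apply/cvg_ex; exists f; apply/cvgrPdist_le => e e0.
have er : e = (complex.Re e)%:C%C by rewrite RRe_real// gtr0_real.
have r0 : 0 < complex.Re e by rewrite -gt0C -er.
have r2 : 0 < complex.Re e / 2 by rewrite divr_gt0.
have [M HM] := small _ r2; have [N HN] := Hf _ r2.
apply: filterS (Hu (maxn M N)) => g /= gM.
rewrite er -nr_le (le_trans (nr_tri (u (maxn M N)) _ _))// (splitr (complex.Re e)) lerD//.
  by rewrite nr_sub HN// leq_maxr.
by rewrite (le_trans gM)// HM// leq_maxl.
Qed.

HB.instance Definition _ := Uniform_isComplete.Build hcomp hcomp_cauchy_cvg.

Let hin_pred x : (B x : V -> R[i]^o) \in hpred.
Proof.
apply/asboolP => e e0; exists x => y.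
by rewrite subrr nr0 mulr_ge0 ?pnorm_ge0// ltW.
Qed.

Definition hin x : hcomp := HComp (hin_pred x).

Lemma hinE x y : hin x y = B x y. Proof. by []. Qed.

Lemma hin_lin k x y : hin (k *: x + y) = k *: hin x + hin y.
Proof. by apply: hcomp_ext => z; rewrite hinE pform_lin. Qed.

Lemma nr_hin x : nr (hin x) = pnorm x.
Proof.
apply/eqP; rewrite eq_le; apply/andP; split.
  by apply: hcomp_nr_le => [|y]; [exact: pnorm_ge0|exact: pform_le].
by apply: pnorm_le => [|z]; [exact: nr_ge0|exact: (hcomp_le (hin x) z)].
Qed.

Lemma hin_dense f e : 0 < e -> exists x, nr (hin x - f) <= e.
Proof.
move=> e0; have /asboolP/(_ _ e0)[x Hx] := hfunP f; exists x.
by apply: hcomp_nr_le => [|y]; [exact: ltW|exact: Hx].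
Qed.

Lemma hcomp_antilinear f k x y : f (k *: x + y) = k^* * f x + f y.
Proof.
apply/eqP; rewrite -subr_eq0; apply/eqP/nr_small => e e0.
pose K := pnorm (k *: x + y) + nr k * pnorm x + pnorm y + 1.
have K0 : 0 < K by rewrite ltr_wpDl// !addr_ge0 ?mulr_ge0 ?nr_ge0 ?pnorm_ge0.
have [z Hz] := @hin_dense f (e / K) ltac:(by rewrite divr_gt0).
have H y' : nr (B z y' - f y') <= e / K * pnorm y'.
  by rewrite -hinE -hcompB (le_trans (hcomp_le _ _))// ler_wpM2r ?pnorm_ge0.
have -> : f (k *: x + y) - (k^* * f x + f y) =
  - (B z (k *: x + y) - f (k *: x + y)) + k^* * (B z x - f x) + (B z y - f y).
  by rewrite pform_linr; ring.
rewrite (@le_trans _ _ (e / K * (pnorm (k *: x + y) + nr k * pnorm x + pnorm y)))//.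
  rewrite [leRHS]mulrDr (le_trans (nrD _ _))// lerD//.
  rewrite [leRHS]mulrDr (le_trans (nrD _ _))// lerD//; first by rewrite nrN.
  by rewrite nrM nr_conj mulrCA ler_wpM2l ?nr_ge0.
by rewrite -mulrA ler_piMr ?(ltW e0)// ler_pdivrMl// mulr1 /K lerDl.
Qed.

Let hcomp_sub f x y : f (x - y) = f x - f y.
Proof.
by rewrite -scaleN1r addrC hcomp_antilinear rmorphN rmorph1 mulN1r addrC.
Qed.

Let hin_sub x y : hin (x - y) = hin x - hin y.
Proof. by rewrite -scaleN1r addrC hin_lin scaleN1r addrC. Qed.

(** The bound, valid for all [y], determines [c], as [hin y] comes arbitrarily close to [g]: it is
    the limit of [f y] as [hin y] tends to [g]. *)
Let hi_ex f g : exists c : R[i], forall y, nr (c - f y) <= nr f * nr (hin y - g).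
Proof.
have /choice[y Hy] : forall n, exists y, nr (hin y - g) <= n.+1%:R^-1.
  by move=> n; apply: hin_dense; rewrite invr_gt0.
have f0 : 0 < nr f + 1 by rewrite ltr_wpDl ?nr_ge0.
have small (e : R) : 0 < e -> exists M, forall n, (M <= n)%N -> n.+1%:R^-1 <= e.
  move=> e0; exists (Num.truncn e^-1).+1 => n Mn.
  rewrite -[leRHS]invrK lef_pV2 ?posrE ?invr_gt0//.
  by rewrite (le_trans (ltW (truncnS_gt _)))// ler_nat leqW.
have diff x z : nr (f x - f z) <= nr f * (nr (hin x - g) + nr (hin z - g)).
  rewrite -hcomp_sub (le_trans (hcomp_le _ _))// ler_wpM2l ?nr_ge0//.
  by rewrite -nr_hin hin_sub (le_trans (nr_tri g _ _))// lerD2l nr_sub.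
have grow (t e : R) : 0 <= t -> t <= e / (nr f + 1) -> nr f * t <= e.
  move=> t0 te; rewrite (@le_trans _ _ ((nr f + 1) * t))//; first by rewrite ler_wpM2r// lerDl.
  by rewrite mulrC -ler_pdivlMr.
have [|c Hc] := @complex_complete _ (fun n => f (y n)).
  move=> e e0; have e2 : 0 < e / 2 / (nr f + 1) by rewrite !divr_gt0.
  have [M HM] := small _ e2; exists M => m n Mm Mn.
  rewrite (le_trans (diff _ _))// mulrDr (splitr e) lerD// grow ?nr_ge0//.
    by rewrite (le_trans (Hy _))// HM.
  by rewrite (le_trans (Hy _))// HM.
exists c => z; apply/ler_addgt0Pr => e e0; have e2 : 0 < e / 2 by rewrite divr_gt0.
have [M HM] := small (e / 2 / (nr f + 1)) ltac:(by rewrite divr_gt0).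
have [N HN] := Hc _ e2; pose n := maxn M N.
rewrite (le_trans (nr_tri (f (y n)) _ _))// nr_sub.
rewrite (le_trans (lerD (HN n (leq_maxr _ _)) (diff _ _)))//.
have := grow _ _ (nr_ge0 _) (le_trans (Hy n) (HM n (leq_maxl _ _))).
by move=> h1; rewrite mulrDr addrA [leRHS]addrC lerD2r [leRHS](splitr e) lerD2l.
Qed.

Definition hinner f g : R[i] := sval (cid (hi_ex f g)).

Lemma hinner_near f g y : nr (hinner f g - f y) <= nr f * nr (hin y - g).
Proof. by rewrite /hinner; case: cid. Qed.

Lemma hinner_hin f y : hinner f (hin y) = f y.
Proof.
apply/eqP; rewrite -subr_eq0; apply/eqP/nr0_eq0/eqP; rewrite eq_le nr_ge0 andbT.
by rewrite (le_trans (hinner_near _ _ _))// subrr nr0 mulr0.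
Qed.

Let hinner_uniq f g c (K : R) : (forall e, 0 < e -> e <= 1 -> exists y,
  nr (hin y - g) <= e /\ nr (c - f y) <= e * K) -> hinner f g = c.
Proof.
move=> H; apply/eqP; rewrite -subr_eq0; apply/eqP/nr_small => e e0.
pose L := nr f + `|K| + 1; have L0 : 0 < L by rewrite ltr_wpDl// addr_ge0 ?nr_ge0.
pose d := Num.min 1 (e / L); have d0 : 0 < d by rewrite lt_min ltr01 divr_gt0.
have [|y [yg cf]] := H d d0; first by rewrite ge_min lexx.
have dL : d * L <= e by rewrite -ler_pdivlMr// ge_min lexx orbT.
rewrite (le_trans (nr_tri (f y) _ _))// (le_trans _ dL)// /L !mulrDr mulr1.
rewrite -addrA lerD//; last first.
  rewrite nr_sub (le_trans cf)// (@le_trans _ _ (d * `|K|))//.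
    by rewrite ler_wpM2l ?(ltW d0)// ler_norm.
  by rewrite lerDl ltW.
by rewrite (le_trans (hinner_near _ _ _))// mulrC ler_wpM2r ?nr_ge0.
Qed.

Let hinner_linl k f g h : hinner (k *: f + g) h = k * hinner f h + hinner g h.
Proof.
apply: (hinner_uniq (K := nr k * nr f + nr g)) => e e0 _.
have [y Hy] := hin_dense h e0; exists y; split=> //.
have -> : k * hinner f h + hinner g h - (k *: f + g) y =
  k * (hinner f h - f y) + (hinner g h - g y) by rewrite hcompD hcompZ; ring.
rewrite [leRHS]mulrDr (le_trans (nrD _ _))// lerD//.
  rewrite nrM mulrCA ler_wpM2l ?nr_ge0// mulrC (le_trans (hinner_near _ _ _))//.
  by rewrite ler_wpM2l ?nr_ge0.
by rewrite mulrC (le_trans (hinner_near _ _ _))// ler_wpM2l ?nr_ge0.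
Qed.

Let near_norm x f e : nr (hin x - f) <= e -> pnorm x <= nr f + e.
Proof. by move=> H; rewrite -nr_hin (le_trans (nr_dist _ f))// lerD2l. Qed.

Let hin_near x f y : nr (B x y - f y) <= nr (hin x - f) * pnorm y.
Proof. by rewrite -hinE -hcompB hcomp_le. Qed.

Let hinner_conj f g : hinner g f = (hinner f g)^*.
Proof.
apply: (hinner_uniq (K := nr f + (nr g + 1) + (nr f + 1))) => e e0 e1.
have [x Hx] := hin_dense f e0; have [y Hy] := hin_dense g e0; exists x; split=> //.
have -> : (hinner f g)^* - g x =
   (hinner f g - f y)^* - (B x y - f y)^* + (B y x - g x).
  by rewrite !rmorphB/= -(pform_conj B x y); ring.
rewrite [leRHS]mulrDr (le_trans (nrD _ _))// lerD//; last first.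
  rewrite (le_trans (hin_near _ _ _))// ler_pM ?nr_ge0 ?pnorm_ge0//.
  by rewrite (le_trans (near_norm Hx))// lerD2l.
rewrite [leRHS]mulrDr (le_trans (nrB _ _))// lerD//.
  by rewrite nr_conj (le_trans (hinner_near _ _ _))// mulrC ler_wpM2r ?nr_ge0.
rewrite nr_conj (le_trans (hin_near _ _ _))// ler_pM ?nr_ge0 ?pnorm_ge0//.
by rewrite (le_trans (near_norm Hy))// lerD2l.
Qed.

Let hinner_nr f : hinner f f = (nr f ^+ 2)%:C%C.
Proof.
apply: (hinner_uniq (K := (nr f + 1) + (nr f + 1 + nr f))) => e e0 e1.
have [x Hx] := hin_dense f e0; exists x; split=> //.
have px : pnorm x <= nr f + 1 by rewrite (le_trans (near_norm Hx))// lerD2l.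
have -> : (nr f ^+ 2)%:C%C - f x = (B x x - f x) - (pnorm x ^+ 2 - nr f ^+ 2)%:C%C.
  by rewrite pformE rmorphB; ring.
rewrite [leRHS]mulrDr (le_trans (nrB _ _))// lerD//.
  by rewrite (le_trans (hin_near _ _ _))// ler_pM ?nr_ge0 ?pnorm_ge0.
rewrite nrR subr_sqr normrM ler_pM//.
  rewrite -nr_hin ler_norml; apply/andP; split.
    by have := nr_dist f (hin x); rewrite nr_sub; lra.
  by have := nr_dist (hin x) f; lra.
by rewrite ger0_norm ?addr_ge0 ?pnorm_ge0 ?nr_ge0// lerD2r.
Qed.

Let hinner_bilinear : bilinear_for *%R (Num.conj \; *%R) hinner.
Proof.
split=> [g k f f'|f k g g'] /=; first exact: hinner_linl.
by rewrite hinner_conj hinner_linl rmorphD rmorphM/= -!hinner_conj.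
Qed.

HB.instance Definition _ := bilinear_isBilinear.Build R[i] hcomp hcomp R[i]
  *%R (Num.conj \; *%R) hinner hinner_bilinear.

Let hinner_herm f g : hinner f g = (-1) ^+ false * (hinner g f)^*.
Proof. by rewrite expr0 mul1r -hinner_conj. Qed.

HB.instance Definition _ := isHermitianSesquilinear.Build R[i] hcomp false
  (@Num.conj R[i]) hinner hinner_herm.

Let hinner_gt0 f : f != 0 -> 0 < hinner f f.
Proof.
move=> f0; rewrite hinner_nr gt0C exprn_gt0// lt_def nr_ge0 andbT.
by apply: contra_neq f0 => /nr0_eq0.
Qed.

HB.instance Definition _ := isDotProduct.Build R[i] hcomp hinner hinner_gt0.

Let hinner_norm f : `|f| ^+ 2 = hinner f f.
Proof. by rewrite hinner_nr nrE -rmorphXn. Qed.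

HB.instance Definition _ := isHilbert.Build R hcomp hinner_norm.

Lemma inner_hin f y : inner f (hin y) = f y.
Proof. exact: hinner_hin. Qed.

End preinner.

Lemma lipschitz_continuous (R : realType) (E F : normedModType R[i]) (T : E -> F) (K : R) :
  (forall x y, nr (T x - T y) <= K * nr (x - y)) -> continuous T.
Proof.
move=> TK x; apply/cvgrPdist_le => e e0.
have er : e = (complex.Re e)%:C%C by rewrite RRe_real// gtr0_real.
have r0 : 0 < complex.Re e by rewrite -gt0C -er.
have k0 : 0 < `|K| + 1 by rewrite ltr_wpDl.
have d0 : 0 < ((complex.Re e) / (`|K| + 1))%:C%C :> R[i] by rewrite gt0C divr_gt0.
apply: filterS (nbhsx_ballx x _ d0) => y; rewrite -ball_normE /= => /ltW.
rewrite -nr_le => xy; rewrite er -nr_le (le_trans (TK _ _))//.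
rewrite (@le_trans _ _ ((`|K| + 1) * nr (x - y)))//.
  by rewrite ler_wpM2r ?nr_ge0// (le_trans (ler_norm K))// lerDl.
by rewrite mulrC -ler_pdivlMr.
Qed.

(** * Orthogonal projections in Hilbert spaces *)

Section projection.
Context {R : realType} {H : hilbertType R}.
Implicit Types (u v w x y z : H) (k : R[i]) (V : set H).

Lemma parallelogram u v : nr (u - v) ^+ 2 + nr (u + v) ^+ 2 = 2 * nr u ^+ 2 + 2 * nr v ^+ 2.
Proof.
have E : (nr (u - v) ^+ 2)%:C%C + (nr (u + v) ^+ 2)%:C%C =
    2%:R * (nr u ^+ 2)%:C%C + 2%:R * (nr v ^+ 2)%:C%C.
  by rewrite -!ip_nr !(ipBl, ipDl, ipBr, ipDr); ring.
by move: E; rewrite -!(rmorph_nat (real_complex R) 2) -!rmorphM -!rmorphD => /complexI.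
Qed.

Lemma nr_sub_proj u v (s : R) : nr (u - (s%:C%C * inner u v) *: v) ^+ 2 =
  nr u ^+ 2 - 2 * s * nr (inner u v) ^+ 2 + s ^+ 2 * nr (inner u v) ^+ 2 * nr v ^+ 2.
Proof.
have cc : (nr (inner u v) ^+ 2)%:C%C = inner u v * (inner u v)^* by rewrite -normCK nrE -rmorphXn.
have vu := ipC u v; have uu := ip_nr u; have vv := ip_nr v.
have h : forall a b d : R, (a - 2 * s * b + s ^+ 2 * b * d)%:C%C =
    a%:C%C - 2%:R * s%:C%C * b%:C%C + s%:C%C * s%:C%C * b%:C%C * d%:C%C.
  by move=> a b d; rewrite -(rmorph_nat (real_complex R) 2) (_ : s ^+ 2 = s * s)// -!rmorphM -rmorphB -rmorphD.

apply: complexI; rewrite -ip_nr h cc -uu -vv ipBl !ipBr !ipZl !ipZr rmorphM /= conjR vu.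
by ring.
Qed.

Lemma orthogonal_projection V x : closed_subspace V ->
  exists2 y, V y & forall v, V v -> inner (x - y) v = 0.
Proof.
move=> [cV V0 Vlin].
pose S := [set nr (x - v) ^+ 2 | v in V].
have S0 : S !=set0 by exists (nr (x - 0) ^+ 2), 0.
have Slb : has_lbound S by exists 0 => _ [v _ <-]; exact: sqr_ge0.
pose D := inf S.
have DV v : V v -> D <= nr (x - v) ^+ 2 by move=> Vv; apply: ge_inf => //; exists v.
have inv0 n : 0 < n.+1%:R^-1 :> R by rewrite invr_gt0.
have /choice[v Hv] : forall n, exists v, V v /\ nr (x - v) ^+ 2 <= D + n.+1%:R^-1.
  move=> n; have [_ [v Vv <-] Hv] := inf_adherent (inv0 n) (conj S0 Slb).
  by exists v; split=> //; exact: ltW.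
have small (e : R) : 0 < e -> exists M, forall n, (M <= n)%N -> n.+1%:R^-1 <= e.
  move=> e0; exists (Num.truncn e^-1).+1 => n Mn.
  rewrite -[leRHS]invrK lef_pV2 ?posrE ?invr_gt0//.
  by rewrite (le_trans (ltW (truncnS_gt _)))// ler_nat leqW.
have Vcomb u w k : V u -> V w -> V (u + k *: w) by move=> *; rewrite addrC; exact: Vlin.
have vv m n : nr (v m - v n) ^+ 2 <= 2 * m.+1%:R^-1 + 2 * n.+1%:R^-1.
  have [Vm Hm] := Hv m; have [Vn Hn] := Hv n.
  have := parallelogram (x - v n) (x - v m).
  have -> : x - v n - (x - v m) = v m - v n by lmod.
  have -> : x - v n + (x - v m) = 2%:R *: (x - (2^-1)%:C%C *: (v m + v n)).
    rewrite scalerBr scalerA halfK; lmod.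
  have Vmid : V ((2^-1)%:C%C *: (v m + v n)).
    by rewrite -[X in V X]add0r; apply: (Vcomb) => //; rewrite -[v n]scale1r; exact: Vcomb.
  have := DV _ Vmid.
  have -> : (2%:R : R[i]) = (2%:R)%:C%C by rewrite rmorph_nat.
  rewrite nrZR exprMn ger0_norm ?ler0n// -natrX (_ : (2 ^ 2)%:R = 4 :> R)//.
  have num (q c a b i j d : R) : d <= q -> b <= d + i -> a <= d + j ->
      c + 4 * q = 2 * a + 2 * b -> c <= 2 * i + 2 * j by lra.
  by move=> Dq; exact: num Dq Hm Hn.
have [|y Hy] := @nr_complete _ _ v.
  move=> e e0; have e4 : 0 < e ^+ 2 / 4 by rewrite divr_gt0 ?exprn_gt0.
  have [M HM] := small _ e4; exists M => m n Mm Mn.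
  rewrite -ler_sqr ?nnegrE ?nr_ge0 ?(ltW e0)// (le_trans (vv m n))//.
  have num (i j d : R) : i <= d / 4 -> j <= d / 4 -> 2 * i + 2 * j <= d by lra.
  exact: num (HM m Mm) (HM n Mn).
have Vy : V y.
  apply/(closed_nr V).1 => // e e0; have [M HM] := Hy e e0.
  by exists (v M); [have [] := Hv M|rewrite nr_sub HM].
exists y => // w Vw; pose N := nr w ^+ 2.
have N0 : 0 <= N by exact: sqr_ge0.
have N1 : 0 < N + 1 by rewrite ltr_wpDl.
have cn n : nr (inner (x - v n) w) ^+ 2 <= (N + 1) * n.+1%:R^-1.
  (* [v n] is compared with its perturbation by [s * c] times [w]; using [N + 1] for the optimal [N]
     covers [w = 0]. *)
  have [Vn Hn] := Hv n; set c := inner (x - v n) w; pose s := (N + 1)^-1.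
  have s0 : 0 < s by rewrite invr_gt0.
  have := DV _ (Vcomb _ _ (s%:C%C * c) Vn Vw).
  have -> : nr (x - (v n + (s%:C%C * c) *: w)) ^+ 2 =
      nr (x - v n) ^+ 2 - 2 * s * nr c ^+ 2 + s ^+ 2 * nr c ^+ 2 * N.
    by rewrite opprD addrA nr_sub_proj.
  set C := nr c ^+ 2 in Hn *; have C0 : 0 <= C by exact: sqr_ge0.
  have E : 2 * s * C - s ^+ 2 * C * N = C * s + C * s ^+ 2.
    by rewrite /s; field; rewrite gt_eqF.
  have p2 : 0 <= C * s ^+ 2 by rewrite mulr_ge0// sqr_ge0.
  have num (q i d : R) : q <= d + i -> d <= q - 2 * s * C + s ^+ 2 * C * N -> C * s <= i.
    by move=> h1 h2; lra.
  move=> /(num _ _ _ Hn) h.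
  by rewrite mulrC -ler_pdivrMr.
apply/eqP; rewrite -normr_eq0 nrE -(rmorph0 (real_complex R)); apply/eqP; congr (_%:C%C).
suff -> : inner (x - y) w = 0 by rewrite nr0.
apply: nr_small => e e0; pose K := nr w + 1; have K0 : 0 < K by rewrite ltr_wpDl ?nr_ge0.
have e2 : 0 < e / 2 by rewrite divr_gt0.
have [M HM] := small ((e / 2) ^+ 2 / (N + 1)) ltac:(by rewrite divr_gt0 ?exprn_gt0).
have [M' HM'] := Hy (e / 2 / K) ltac:(by rewrite divr_gt0).
pose n := maxn M M'.
have -> : inner (x - y) w = inner (x - v n) w + inner (v n - y) w.
  by rewrite -ipDl addrA subrK.
rewrite (le_trans (nrD _ _))// (splitr e) lerD//.
  rewrite -ler_sqr ?nnegrE ?nr_ge0 ?(ltW e2)// (le_trans (cn n))//.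
  by rewrite mulrC -ler_pdivlMr// HM// leq_maxl.
rewrite (le_trans (ip_le _ _))// (@le_trans _ _ (nr (v n - y) * K))//.
  by rewrite ler_wpM2l ?nr_ge0// lerDl.
by rewrite -ler_pdivlMr// HM'// leq_maxr.
Qed.

End projection.

Section gns.
Context {R : realType} {A : cStarAlgType R}.
Local Notation U := (unitization A).
Local Notation "t %:u" := (t%:C%C *: (1 : U)) (at level 2, format "t %:u").
Implicit Types (a b : A) (x y z u : U) (f : dual A).

Section construction.
Variables (phi : dual A) (sphi : state phi).

Definition gns_form : preinner U.
Proof.
apply: (@Preinner R U (fun x y => ext phi (ustar y * x))) => [k x y z|x y|x].
- by rewrite mulrDr scale_mulr ext_lin.
- by rewrite -state_star// ustarM ustarK.
- exact: sphi.
Defined.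

Lemma gns_formE x y : gns_form x y = ext phi (ustar y * x). Proof. by []. Qed.

Lemma gns_pnormM u x : pnorm gns_form (u * x) <= un u * pnorm gns_form x.
Proof.
have sq z : (pnorm gns_form z ^+ 2)%:C%C = ext phi (ustar z * z) by rewrite -pformE.
rewrite -ler_sqr ?nnegrE ?mulr_ge0 ?pnorm_ge0 ?un_ge0// exprMn -lecR sq.
have -> : (un u ^+ 2 * pnorm gns_form x ^+ 2)%:C%C = (un u ^+ 2)%:C%C * ext phi (ustar x * x).
  by rewrite -sq -rmorphM.
rewrite -subr_ge0.
have := state_pos sphi (upos_conj x (upos_norm_sub (usa_starM u))).
rewrite un_starM; congr (0 <= _); rewrite mulrBr mulrBl extB scale_mulr scale_mull mulr1 extZ.
by rewrite ustarM !mulrA.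
Qed.

Local Notation H := (hcomp gns_form).

Let uop_hpred u (f : H) : (fun y => f (ustar u * y) : R[i]^o) \in hpred gns_form.
Proof.
apply/asboolP => e e0; have k0 : 0 < un u + 1 by rewrite ltr_wpDl ?un_ge0.
have [x Hx] := @hin_dense _ _ _ f (e / (un u + 1)) ltac:(by rewrite divr_gt0).
exists (u * x) => y.
have -> : gns_form (u * x) y - f (ustar u * y) = (hin gns_form x - f) (ustar u * y).
  by rewrite hcompB hinE !gns_formE ustarM ustarK mulrA.
rewrite (le_trans (hcomp_le _ _))//.
rewrite (@le_trans _ _ (e / (un u + 1) * ((un u + 1) * pnorm gns_form y)))//.
  rewrite ler_pM ?nr_ge0 ?pnorm_ge0// (le_trans (gns_pnormM _ _))// un_star.
  by rewrite ler_wpM2r ?pnorm_ge0// lerDl.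
by rewrite mulrA divfK// gt_eqF.
Qed.

Let uop u (f : H) : H := HComp (uop_hpred u f).

Let uopE u (f : H) y : uop u f y = f (ustar u * y). Proof. by []. Qed.

Let uop_hin u x : uop u (hin gns_form x) = hin gns_form (u * x).
Proof. by apply: hcomp_ext => y; rewrite uopE !hinE !gns_formE ustarM ustarK mulrA. Qed.

Let uop_le u (f : H) : nr (uop u f) <= un u * nr f.
Proof.
apply: hcomp_nr_le => [|y]; first by rewrite mulr_ge0 ?un_ge0 ?nr_ge0.
rewrite uopE (le_trans (hcomp_le _ _))// [un u * _]mulrC -mulrA ler_wpM2l ?nr_ge0//.
by rewrite (le_trans (gns_pnormM _ _))// un_star.
Qed.

Let uop_lin u : linear (uop u).
Proof. by move=> k f g; apply: hcomp_ext => y. Qed.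

Let uop_sub u (f g : H) : uop u (f - g) = uop u f - uop u g.
Proof. by rewrite addrC -scaleN1r uop_lin scaleN1r addrC. Qed.

Let uop_continuous u : continuous (uop u).
Proof.
apply: (@lipschitz_continuous _ _ _ _ (un u)) => f g.
by rewrite -uop_sub uop_le.
Qed.

Let op a := uop (uin a).

Let op_linear v : linear (op^~ v).
Proof.
move=> k a b; apply: hcomp_ext => y; rewrite hcompD hcompZ !uopE uinD uinZ.
by rewrite ustarD ustarZ mulrDl scale_mull hcomp_antilinear conjCK.
Qed.

Let opM a b v : op (cmul a b) v = op a (op b v).
Proof. by apply: hcomp_ext => y; rewrite !uopE uinM ustarM mulrA. Qed.

Let op_star a (u v : H) : inner (op a u) v = inner u (op (cstar a) v).
Proof.
apply/eqP; rewrite -subr_eq0; apply/eqP/nr_small => e e0.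
pose K := nr (op a u) + nr u * nr (cstar a) + 1.
have K0 : 0 < K by rewrite ltr_wpDl// addr_ge0 ?mulr_ge0 ?nr_ge0.
have [y Hy] := @hin_dense _ _ _ v (e / K) ltac:(by rewrite divr_gt0).
have E : inner (op a u) (hin gns_form y) = inner u (op (cstar a) (hin gns_form y)).
  by rewrite inner_hin /op uop_hin inner_hin uopE uin_star.
have -> : inner (op a u) v - inner u (op (cstar a) v) =
  inner u (op (cstar a) (hin gns_form y - v)) - inner (op a u) (hin gns_form y - v).
  by rewrite /op uop_sub !ipBr E; ring.
rewrite (le_trans (nrB _ _))// (@le_trans _ _ (K * (e / K)))//; last first.
  by rewrite mulrC divfK// gt_eqF.
rewrite (@le_trans _ _ (K * nr (hin gns_form y - v)))//; last by rewrite ler_wpM2l// ltW.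
rewrite /K !mulrDl mul1r -addrA addrCA lerD//.
  rewrite (le_trans (ip_le _ _))// -mulrA ler_wpM2l ?nr_ge0//.
  by rewrite -(un_uin (cstar a)) uop_le.
by rewrite -[leLHS]addr0 lerD ?nr_ge0// ip_le.
Qed.

Definition gns : representation A :=
  @Representation R A (hcomp gns_form) op (fun a => @uop_lin (uin a))
    (fun a => @uop_continuous (uin a)) op_linear opM op_star.

Definition gns_vector : rep_space gns := hin gns_form 1.

Lemma gns_state a : inner (gns a gns_vector) gns_vector = phi a.
Proof.
have -> : gns a gns_vector = hin gns_form (uin a * 1) by exact: uop_hin.
by rewrite inner_hin hinE gns_formE ustar1 mul1r mulr1 ext_uin.
Qed.

Lemma gns_vector_nr : nr gns_vector = 1.
Proof.
apply/eqP; rewrite nr_hin -(@eqrXn2 _ 2) ?pnorm_ge0// -(inj_eq (@complexI R)) -pformE.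
by rewrite gns_formE ustar1 mulr1 ext1 expr1n.
Qed.

(** The class of the unit is cyclic for the unitization only. Since [phi] is concentrated on [x],
    the elements [y] and [y * x] have the same class, and the latter lies in [A]. *)
Lemma gns_dense x : inA x -> usa x -> un x <= 1 -> ext phi x = 1 -> rep_dense gns_vector.
Proof.
move=> Ax sx x1 phix v e e0; have [y Hy] := @hin_dense _ _ _ v e e0.
exists (y * x).2.
have -> : gns (y * x).2 gns_vector = hin gns_form (uin (y * x).2 * 1) by exact: uop_hin.
rewrite -uinP; last exact: inAMl.
rewrite mulr1; suff -> : hin gns_form (y * x) = hin gns_form y by rewrite nr_sub.
apply: hcomp_ext => z; rewrite !hinE !gns_formE mulrA.
by have [] := state_unit sphi (ustar z * y) sx x1 phix.
Qed.

End construction.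

Definition pure phi := state phi /\ forall f g (t : R), state f -> state g -> 0 < t < 1 ->
  (forall a, phi a = t%:C%C * f a + (1 - t)%:C%C * g a) -> f = phi.

Lemma vector_state (pi : representation A) (v : rep_space pi) : nr v = 1 ->
  exists f, state f /\ forall a, f a = inner (pi a v) v.
Proof.
move=> v1; have [f Hf] : exists f : dual A, forall a, f a = inner (pi a v) v.
  apply: (@bounded_dual _ _ _ 1) => [k x y|x]; first by rewrite rep_Pl ipP.
  by rewrite (le_trans (ip_le _ _))// v1 mulr1 mul1r (le_trans (rep_le _ _))// v1 mulr1.
have E x : ext f x = inner (urep x v) v.
  by rewrite /ext Hf /urep ipDl ipZl ip_nr v1 expr1n mulr1.
exists f; split=> // x; rewrite E urepM urep_star ustarK ip_nr ler0c.
exact: sqr_ge0.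
Qed.

Lemma dense_eq0 (pi : representation A) (xi w : rep_space pi) : rep_dense xi ->
  (forall a, inner (pi a xi) w = 0) -> w = 0.
Proof.
move=> dxi H; suff : inner w w = 0.
  rewrite ip_nr -(rmorph0 (real_complex R)) => /complexI/eqP.
  by rewrite sqrf_eq0 => /eqP/nr0_eq0.
apply: nr_small => e e0; have k0 : 0 < nr w + 1 by rewrite ltr_wpDl ?nr_ge0.
have [a Ha] := dxi w (e / (nr w + 1)) ltac:(by rewrite divr_gt0).
rewrite -[inner w w]subr0 -(H a) -ipBl (le_trans (ip_le _ _))//.
rewrite (@le_trans _ _ (nr (w - pi a xi) * (nr w + 1)))//.
  by rewrite ler_wpM2l ?nr_ge0// lerDl.
by rewrite -ler_pdivlMr.
Qed.

(** Split the cyclic vector [xi] along an invariant subspace as [y + w]. The vector states of [y]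
    and [w], normalised, decompose [phi] with weight [nr y ^+ 2]; purity makes [y] a multiple of
    [xi], so [xi] is in the subspace unless [y = 0]. *)
Lemma gns_irreducible phi (pphi : pure phi) x : inA x -> usa x -> un x <= 1 ->
  ext phi x = 1 -> irreducible (gns pphi.1).
Proof.
move=> Ax sx x1 phix; set pi := gns _; pose xi : rep_space pi := gns_vector pphi.1.
have dxi : rep_dense xi by exact: gns_dense phix.
have phiE a : inner (pi a xi) xi = phi a by exact: gns_state.
have xi1 : nr xi = 1 by exact: gns_vector_nr.
split.
  exists x.2, xi; apply/eqP => E; have := phiE x.2; rewrite E ip0l -ext_inA// phix.
  by move=> /esym/eqP; rewrite oner_eq0.
move=> V sV Vinv; have [cV V0 Vlin] := sV.
have full : V xi -> V = setT.
  move=> Vxi; apply/seteqP; split=> // v _; apply/(closed_nr V).1 => // e e0.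
  by have [a Ha] := dxi v e e0; exists (pi a xi) => //; exact: Vinv.
have [y Vy Hy] := orthogonal_projection xi sV; set w := xi - y in Hy.
have xiE : xi = y + w by rewrite /w addrC subrK.
clearbody w.
have wV v : V v -> inner v w = 0 by move=> Vv; rewrite ipC Hy// conjC0.
have ws a v : V v -> inner (pi a w) v = 0 by move=> Vv; rewrite rep_star Hy//; exact: Vinv.
have pyth : nr y ^+ 2 + nr w ^+ 2 = 1 by rewrite -nrD_ortho ?wV// -xiE xi1 expr1n.
have [y0|y0] := eqVneq (nr y) 0.
  left; apply/seteqP; split=> v; last by move=> ->.
  move=> Vv; apply: (dense_eq0 dxi) => a.
  have xw : xi = w by rewrite xiE (nr0_eq0 y0) add0r.
  by rewrite xw ws.
have [w0|w0] := eqVneq (nr w) 0.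
  by right; apply: full; rewrite xiE (nr0_eq0 w0) addr0.
have pos (v : rep_space pi) : nr v != 0 -> 0 < nr v by move=> v0; rewrite lt_def v0 nr_ge0.
right; apply: full.
have unit (v : rep_space pi) : nr v != 0 -> exists f, state f /\
    forall a, inner (pi a v) v = (nr v ^+ 2)%:C%C * f a.
  move=> v0; have v_gt0 := pos v v0; have [|f [sf Hf]] := @vector_state pi ((nr v)^-1%:C%C *: v).
    by rewrite nrZR gtr0_norm ?invr_gt0// mulVf.
  exists f; split=> // a; rewrite Hf repZ ipZl ipZr conjR !mulrA -!rmorphM.
  by rewrite expr2 mulfK// mulfV// mul1r.
have [f [sf Hf]] := unit y y0; have [g [sg Hg]] := unit w w0.
have t1 : 0 < nr y ^+ 2 < 1.
  by have := exprn_gt0 2 (pos _ y0); have := exprn_gt0 2 (pos _ w0); move: pyth; lra.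
have fphi : f = phi.
  apply: (pphi.2 f g (nr y ^+ 2)) => // a.
  have -> : 1 - nr y ^+ 2 = nr w ^+ 2 by rewrite -pyth addrC addKr.
  rewrite -Hf -Hg -phiE xiE repD ipDl !ipDr (wV _ (Vinv a y Vy)) (ws a y Vy).
  by rewrite addr0 add0r.
have yE : y = (nr y ^+ 2)%:C%C *: xi.
  apply/eqP; rewrite -subr_eq0; apply/eqP/(dense_eq0 dxi) => a.
  rewrite ipBr ipZr conjR phiE -fphi -Hf xiE repD ipDl (ws a y Vy) addr0.
  by rewrite subrr.
have -> : xi = ((nr y ^+ 2)^-1)%:C%C *: y.
  by rewrite {2}yE scalerA -rmorphM mulVf ?scale1r// expf_neq0.
by rewrite -[X in V X]addr0; exact: Vlin.
Qed.

End gns.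

(** * Pure states *)

Section pure_states.
Context {R : realType} {A : cStarAlgType R}.
Local Notation U := (unitization A).
Implicit Types (a : A) (x p : U) (f g h : dual A) (K : set (dual A)) (t : R).

Definition extremal K := forall f g h t, K f -> state g -> state h -> 0 < t < 1 ->
  (forall a, f a = t%:C%C * g a + (1 - t)%:C%C * h a) -> K g.

Lemma extremalC K f g h t : extremal K -> K f -> state g -> state h -> 0 < t < 1 ->
  (forall a, f a = t%:C%C * g a + (1 - t)%:C%C * h a) -> K h.
Proof.
move=> eK Kf sg sh /andP[t0 t1] fE; apply: (eK f h g (1 - t)) => // [|a].
  by rewrite subr_gt0 t1 ltrBlDr ltrDl.
by rewrite fE subKr addrC.
Qed.

Lemma ext_convex f g h t x : (forall a, f a = t%:C%C * g a + (1 - t)%:C%C * h a) ->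
  ext f x = t%:C%C * ext g x + (1 - t)%:C%C * ext h x.
Proof. by move=> fE; rewrite /ext fE rmorphB rmorph1; ring. Qed.

(* Maximising successively at the points of a dense sequence shrinks a weak-* compact
   extremal set to a single, hence pure, state. *)
Definition maximisers K a := [set f | K f /\ forall g, K g -> complex.Re (g a) <= complex.Re (f a)].

Lemma maximisersP K a : K !=set0 -> wcomp K -> maximisers K a !=set0 /\ wcomp (maximisers K a).
Proof.
move=> K0 wK; pose B g := [set f | K f /\ complex.Re (g a) <= complex.Re (f a)].
have -> : maximisers K a = \bigcap_(g in K) B g.
  apply/seteqP; split=> [f [Kf Hf] g Kg|f Hf]; first by split=> //; exact: Hf.
  have [g Kg] := K0; split=> [|h Kh]; first by have [] := Hf g Kg.
  by have [] := Hf h Kh.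
apply: wcomp_bigcap => // [g h Kg Kh|g Kg|g Kg F FU FB].
- have [gh|/ltW hg] := leP (complex.Re (g a)) (complex.Re (h a)); [exists h|exists g] => //.
    by move=> f [Kf hf]; split; split=> //; exact: le_trans hf.
  by move=> f [Kf hf]; split; split=> //; exact: le_trans hf.
- by exists g; split.
have FF : ProperFilter F by exact: ultra_proper.
have [|f Kf Ff] := wK F FU; first by apply: filterS FB => f [].
exists f => //; split=> //; apply/ler_addgt0Pr => e e0.
have [h [/= he [Kh gh]]] := filter_ex (filterI (Ff a e e0) FB).
rewrite (le_trans gh)// -lerBlDl -raddfB (le_trans (ler_norm _))//.
exact: le_trans (Re_nr _) he.
Qed.

Lemma maximisers_extremal K a : K `<=` @state R A -> extremal K -> extremal (maximisers K a).
Proof.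
move=> sK eK f g h t [Kf mf] sg sh t01 fE.
have Kg := eK _ _ _ _ Kf sg sh t01 fE; have Kh := extremalC eK Kf sg sh t01 fE.
split=> // f' /mf; have := mf g Kg; have := mf h Kh.
have -> : complex.Re (f a) = t * complex.Re (g a) + (1 - t) * complex.Re (h a).
  have ReZ (s : R) (z : R[i]) : complex.Re (s%:C%C * z) = s * complex.Re z.
    by case: z => u v /=; rewrite mul0r subr0.
  by rewrite fE raddfD /= !ReZ.
by move: (complex.Re _) (complex.Re _) (complex.Re _) => u v w; case/andP: t01; nra.
Qed.

Variables (I1 I0 : set U).
Hypothesis I1P : forall x, I1 x -> [/\ inA x, usa x & un x <= 1].
Hypothesis I0P : forall p, I0 p -> [/\ inA p, usa p & p * p = p].

Definition face := [set f | [/\ state f, forall x, I1 x -> ext f x = 1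
  & forall p, I0 p -> ext f p = 0]].

Lemma face_wcomp : wcomp face.
Proof.
move=> F FU FS; have FF : ProperFilter F by exact: ultra_proper.
have [||f _ Hf] := @ultra_dual _ _ _ F id 1 => //.
  by apply: filterS FS => f [/state_norm].
have H x : ulim F (fun g => ext g x) (ext f x).
  by apply: ulimD; [exact: ulim_cst|exact: Hf].
exists f => //; split=> [x|x Ix|x Ix].
- by apply: (ulim_ge0 FF (H _)); apply: filterS FS => g [sg _ _]; exact: sg.
- by apply: (ulim_eq FF (H _)); apply: filterS FS => g [_ + _]; exact.
- by apply: (ulim_eq FF (H _)); apply: filterS FS => g [_ _]; exact.
Qed.

(** One is the largest value of a state on a self-adjoint contraction and zero the least on a
    projection, so both are inherited by the terms of a convex combination. *)
Lemma face_extremal : extremal face.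
Proof.
move=> f g h t [sf f1 f0] sg sh /andP[t0 t1] fE; split=> // x Ix.
  have [_ sx x1] := I1P Ix; have := f1 _ Ix; rewrite (ext_convex _ fE).
  have rg := state_real sg sx; have rh := state_real sh sx.
  have := le_trans (Re_nr _) (le_trans (state_le sg x) x1).
  have := le_trans (Re_nr _) (le_trans (state_le sh x) x1).
  rewrite -(RRe_real rg) -(RRe_real rh) /= -!rmorphM -rmorphD -(rmorph1 (real_complex R)).
  move: (complex.Re _) (complex.Re _) => u v; rewrite !ler_norml => /andP[_ v1] /andP[_ u1].
  by move=> /complexI E; congr (_%:C%C); nra.
have [_ sx xx] := I0P Ix; have := f0 _ Ix; rewrite (ext_convex _ fE).
have := sg x; have := sh x; rewrite sx xx.
move: (ext g x) (ext h x) => u v v0 u0 /eqP.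
have T0 : 0 < t%:C%C :> R[i] by rewrite gt0C.
have T1 : 0 < (1 - t)%:C%C :> R[i] by rewrite gt0C subr_gt0.
rewrite paddr_eq0 ?mulr_ge0 ?(ltW T0) ?(ltW T1)// => /andP[+ _].
by rewrite mulf_eq0 (gt_eqF T0) => /eqP.
Qed.

Lemma pure_in_face : separable_space A -> face !=set0 -> exists f, pure f /\ face f.
Proof.
move=> /dense_seq[d dd] S0.
pose K := fix K n := if n is m.+1 then maximisers (K m) (d m) else face.
have Ksub m n : (m <= n)%N -> K n `<=` K m.
  elim: n => [|n IH]; first by rewrite leqn0 => /eqP->.
  by rewrite leq_eqVlt => /predU1P[->//|/IH H] f [/H].
have KP n : K n !=set0 /\ wcomp (K n).
  elim: n => [|n [K0 wK]]; first by split=> //; exact: face_wcomp.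
  exact: maximisersP.
have Kex n : extremal (K n).
  elim: n => [|n IH]; first exact: face_extremal.
  by apply: maximisers_extremal => // f /(Ksub 0 n (leq0n n))[].
have [|m n _ _|n _|n _|[f Hf] _] := @wcomp_bigcap R A nat setT K.
- by exists 0%N.
- by exists (maxn m n) => // f Kf; split; apply: Ksub Kf; rewrite ?leq_maxl ?leq_maxr.
- by have [] := KP n.
- by have [] := KP n.
exists f; split; last exact: (Hf 0%N).
split=> [|g h t sg sh t01 fE]; first by have [] := Hf 0%N I.
have Kg n : K n g by apply: (Kex n f g h t) => //; exact: Hf.
have E n : complex.Re (g (d n)) = complex.Re (f (d n)).
  have [Kgn mg] := Kg n.+1; have [Kfn mf] := Hf n.+1 I.
  by apply/eqP; rewrite eq_le mg ?mf.
have sf : state f by have [] := Hf 0%N I.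
have ReE a : complex.Re (g a) = complex.Re (f a).
  apply/eqP; rewrite -subr_eq0 -raddfB -normr_le0; apply/ler_addgt0Pr => e e0.
  rewrite add0r.
  have [n Hn] := dd a (e / 2) ltac:(by rewrite divr_gt0).
  rewrite [X in `|X|](_ : _ = complex.Re (g (a - d n)) - complex.Re (f (a - d n))); last first.
    by rewrite !linearB !raddfB /= E; ring.
  have B (k : dual A) : state k -> `|complex.Re (k (a - d n))| <= e / 2.
    move=> sk; rewrite (le_trans (Re_nr _))// (le_trans (nr_dual _ _))// (le_trans _ Hn)//.
    by rewrite ler_piMl ?nr_ge0// state_norm.
  by rewrite (le_trans (ler_normB _ _))// (splitr e) lerD ?B.
apply: dual_ext => a; apply/eqP; rewrite eq_complex ReE eqxx /=; apply/eqP.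
have := ReE ('i%C *: a); rewrite !linearZ /=; case: (g a) (f a) => [u v] [u' v'] /=.
by rewrite !mul0r !mul1r !sub0r => /oppr_inj.
Qed.

(** Prescribed values of states become eigenvectors: for [x] in [I1] the squared norm of
    [pi x.2 xi - xi] is [nr (pi x.2 xi) ^+ 2 - 1], hence zero, and for a projection in [I0] that of
    its image of [xi] is the value of the state. *)
Lemma irrep_of_face : separable_space A -> I1 !=set0 -> face !=set0 ->
  exists (pi : irrep A) (xi : rep_space pi), [/\ nr xi = 1,
    forall x, I1 x -> pi x.2 xi = xi & forall p, I0 p -> pi p.2 xi = 0].
Proof.
move=> sepA [x0 Ix0] /(pure_in_face sepA)[f [pf [sf f1 f0]]].
have [Ax0 sx0 x01] := I1P Ix0.
have [pi [xi [irr xi1 piE]]] : exists (pi : representation A) (xi : rep_space pi),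
    [/\ irreducible pi, nr xi = 1 & forall a, inner (pi a xi) xi = f a].
  exists (gns pf.1), (gns_vector pf.1).
  split; [exact: (@gns_irreducible _ _ f pf x0 Ax0 sx0 x01 (f1 _ Ix0))|exact: gns_vector_nr|exact: gns_state].
have E x : inA x -> inner (pi x.2 xi) xi = ext f x by move=> Ax; rewrite piE ext_inA.
exists (Irrep irr), xi; split=> // [x Ix|p Ip] /=.
  have [Ax sx x1] := I1P Ix; apply/eqP; rewrite -subr_eq0; apply/eqP/nr0_eq0/eqP.
  rewrite -sqrf_eq0 eq_le sqr_ge0 andbT -lecR -ip_nr ipBl !ipBr E// f1//.
  have -> : inner xi (pi x.2 xi) = 1 by rewrite ipC E// f1// conjC1.
  rewrite !ip_nr xi1 expr1n rmorph1 subrr subr0 rmorph0 subr_le0.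
  rewrite -[leRHS]/(1%:C%C) lecR expr_le1 ?nr_ge0// -urep_inA// (le_trans (urep_le _ _))//.
  by rewrite xi1 mulr1.
have [Ap sp pp] := I0P Ip; apply/nr0_eq0/eqP; rewrite -sqrf_eq0.
rewrite -(inj_eq (@complexI R)) -ip_nr -!urep_inA// urep_star sp -urepM pp ipC urep_inA// E//.
by rewrite f0// conjC0.
Qed.

End pure_states.

(** * Algebras with discrete spectrum *)

(** Cantor's diagonal argument: [D] differs at its own code from the sequence with that code. *)
Lemma no_countable_code (T : countType) (g : (nat -> bool) -> T) : ~ injective g.
Proof.
move=> gI; pose D n := ~~ `[< exists b, pickle (g b) = n /\ b n >].
have := erefl (D (pickle (g D))); rewrite {1}/D.
case: asboolP => [[b [/(pcan_inj pickleK)/gI -> Dn]]|H].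
  by rewrite Dn.
by move=> /esym Dn; apply: H; exists D.
Qed.

Section atomic_of_discrete.
Context {R : realType} {A : cStarAlgType R}.
Local Notation U := (unitization A).
Implicit Types (a b c x y p e : U) (f g : dual A).
Hypotheses (sepA : separable_space A) (disc : spectrum_discrete A).

Lemma minproj_node p : minproj p -> node p.
Proof. by move=> [Ap sp pp p0 _]; split=> //; [exact: proj_un|exists p]. Qed.

Lemma irrep_of_unit c : node c -> exists (pi : irrep A) (xi : rep_space pi),
  nr xi = 1 /\ pi c.2 xi = xi.
Proof.
move=> nc; have [Ac sc c1 _] := nc; have [f [sf fc]] := node_state nc.
have [|//|||pi [xi [xi1 H _]]] := @irrep_of_face _ A [set c] set0 _ _ sepA.
- by move=> _ ->.
- by exists c.
- by exists f; split=> // _ ->.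
- by exists pi, xi; split=> //; exact: H.
Qed.

Section scattered_case.
Variables (a : U) (p : nat -> U).
Hypotheses (scA : @scattered R A) (Aa : inA a) (sa : usa a) (a1 : un a <= 1).
Hypotheses (mp : forall n, minproj (p n)) (ap : forall n, a * p n = p n).
Hypothesis pp : forall m n, m != n -> p m * p n = 0.

Let partial_proj n : let q := \sum_(i < n) p i in
  [/\ usa q, q * q = q & forall j, (n <= j)%N -> q * p j = 0 /\ p j * q = 0].
Proof.
elim: n => [|n [sq qq qp]] /=.
  rewrite big_ord0; split; [exact: ustar0|exact: mul0r|] => j _.
  by rewrite mul0r mulr0.
have [_ sp ppn _ _] := mp n; have [q1 q2] := qp n (leqnn _).
rewrite big_ord_recr /=; split; first exact: usaD.
  by rewrite mulrDl !mulrDr qq ppn q1 q2 addr0 add0r.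
move=> j nj; have [h1 h2] := qp j (ltnW nj).
by rewrite mulrDl mulrDr h1 h2 !pp ?addr0// neq_ltn nj ?orbT.
Qed.

Let state_proj_small g (e : R) : state g -> 0 < e -> exists M, forall n, (M <= n)%N ->
  nr (ext g (p n)) <= e.
Proof.
move=> sg e0; pose r n := nr (ext g (p n)).
have rE n : ext g (p n) = (r n)%:C%C.
  have [_ sp ppn _ _] := mp n; rewrite -nrE ger0_norm//.
  by have := sg (p n); rewrite sp ppn.
have bd n : \sum_(i < n) r i <= 1.
  have [sq qq _] := partial_proj n.
  have := le_trans (state_le sg _) (proj_un sq qq); rewrite ext_sum.
  under eq_bigr do rewrite rE.
  by rewrite -rmorph_sum nrR ger0_norm// sumr_ge0// => i _; exact: nr_ge0.
have cr : cvgn (series r).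
  apply: nondecreasing_is_cvgn.
    by apply/nondecreasing_seqP => n; rewrite /series /= big_nat_recr//= lerDl nr_ge0.
  by exists 1 => _ [n _ <-]; rewrite /series /= big_mkord.
have /cvgrPdist_le/(_ e e0)[M _ HM] := cvg_series_cvg_0 cr.
by exists M => n /HM; rewrite sub0r normrN ger0_norm ?nr_ge0.
Qed.

(** An ultralimit of states concentrated on the [p n]. If [p n * e * p n = l p n] and
    [e * p n * e = m e], then [l] is zero or [m]; here [l] is the value of the [n]-th state at [e],
    and [m] that at [p n] of a state concentrated on [e]. The latter values are summable, the [p n]
    being orthogonal. *)
Lemma limit_state : exists f, [/\ state f, ext f a = 1 & forall e, minproj e -> ext f e = 0].
Proof.
have /choice[psi Hpsi] := fun n => node_state (minproj_node (mp n)).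
have [F [FU Ffree]] := free_ultrafilter; have FF : ProperFilter F by exact: ultra_proper.
have [f [sf lim]] := state_ulim FU (fun n => (Hpsi n).1).
exists f; split=> //.
  apply: (ulim_eq FF (lim _)); apply: filterS filterT => n _ /=.
  have [sp psip] := Hpsi n; have [_ sn n1 _] := minproj_node (mp n).
  by have [<- _] := state_unit sp a sn n1 psip; rewrite ap.
move=> e me; have [Ae se ee e0 mine] := me.
have [g [sg ge]] := node_state (minproj_node me).
apply: (ulim_uniq FF (lim e)) => d d0.
have [M HM] := state_proj_small sg d0; apply: filterS (Ffree M) => n /= Mn.
rewrite subr0 (le_trans _ (HM n Mn))//.
have [sp psip] := Hpsi n; have [Ap sn pn p0 minp] := mp n.
have [_ _ n1 _] := minproj_node (mp n); have [_ _ e1 _] := minproj_node me.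
have [l Hl] := minp e Ae; have [m Hm] := mine _ Ap.
have -> : ext (psi n) e = l.
  have [_ <-] := state_unit sp e sn n1 psip.
  by have [<- _] := state_unit sp (p n * e) sn n1 psip; rewrite Hl extZ psip mulr1.
have -> : ext g (p n) = m.
  have [_ <-] := state_unit sg (p n) se e1 ge.
  by have [<- _] := state_unit sg (e * p n) se e1 ge; rewrite Hm extZ ge mulr1.
(* Compare [p (e p e) p] with [(p e p)^2]. *)
have : p n * (e * p n * e) * p n = (p n * e * p n) * (p n * e * p n).
  by rewrite !mulrA -(mulrA _ (p n) (p n)) pn.
rewrite Hl Hm scale_mull !scale_mulr scale_mull pn Hl scalerA scalerA => /eqP.
rewrite -subr_eq0 -scalerBl -mulrBl scaler_eq0 (negPf p0) orbF mulf_eq0.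
by move=> /orP[|/eqP->]; rewrite ?nr0 ?nr_ge0// subr_eq0 => /eqP->.
Qed.

(** For [w = ustar (uin b) * e], the range projection [e'] of [w] is minimal and kills [xi], so
    [e * uin b = ustar w * e'] kills it too; the vectors [sigma b xi] are dense. *)
Lemma minproj_killed (sigma : irrep A) (xi : rep_space sigma) : nr xi = 1 ->
  (forall e, minproj e -> sigma e.2 xi = 0) -> forall e, minproj e -> rep_ker sigma e.2.
Proof.
move=> xi1 H e me v; have [Ae se _ _ _] := me.
have xi0 : xi != 0.
  by apply/eqP => x0; move: xi1; rewrite x0 nr0 => /esym/eqP; rewrite oner_eq0.
have dxi := irreducible_dense (irrepP sigma) xi0.
have Hb (b : A) : sigma e.2 (sigma b xi) = 0.
  have -> : sigma e.2 (sigma b xi) = urep (e * uin b) xi by rewrite urepM !urep_inA.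
  pose w := ustar (uin b) * e.
  have -> : e * uin b = ustar w by rewrite /w ustarM ustarK se.
  have [->|w0] := eqVneq w 0; first by rewrite ustar0 urep_inA// rep_0l.
  have [e' [me' ew _]] := minproj_range me w0; have [Ae' se' _ _ _] := me'.
  by rewrite -/w in ew; rewrite -ew ustarM se' urepM (urep_inA _ Ae') H// /urep rep0 scaler0 addr0.
apply: nr_small => d d0; pose K := nr e.2 + 1; have K0 : 0 < K by rewrite ltr_wpDl ?nr_ge0.
have [b vb] := dxi v _ (divr_gt0 d0 K0).
rewrite -[sigma _ v]subr0 -(Hb b) -repB (le_trans (rep_le _ _))//.
rewrite (@le_trans _ _ (K * nr (v - sigma b xi)))//.
  by rewrite ler_wpM2r ?nr_ge0// lerDl.
by rewrite mulrC -ler_pdivlMr.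
Qed.

(** Let [sigma] kill all minimal projections and let [b] isolate its class. A minimal projection [q]
    below the square of [b] lives in some [tau] that does not kill [b], so [tau] is equivalent to
    [sigma], which kills [q]. *)
Lemma scattered_not_atomic_false : False.
Proof.
have [f [sf fa f0]] := limit_state.
have [||||sigma [xi [xi1 _ xi0]]] := @irrep_of_face _ A [set a] (@minproj R A) _ _ sepA.
- by move=> _ ->.
- by move=> e [].
- by exists a.
- by exists f; split=> // _ ->.
have kill := minproj_killed xi1 xi0.
have [b [nb Hb]] := discrete_isolated sigma disc.
pose k := ustar (uin b) * uin b.
have k0 : k != 0.
  apply/eqP => /ustar_sq0 /(congr1 snd) /= b0; apply: nb => v; rewrite b0.
  exact: rep_0l.
have [c [nc _ cq]] := node_below (inAMl _ (inA_uin b)) (upos_starM (uin b)) k0.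
have [q [mq cqq]] := scA nc; have [Aq sq qq q0 minq] := mq.
have [tau [eta [eta1 qeta]]] := irrep_of_unit (minproj_node mq).
have eta0 : eta != 0.
  by apply/eqP => x0; move: eta1; rewrite x0 nr0 => /esym/eqP; rewrite oner_eq0.
have taub : ~ rep_ker tau b.
  move=> tb; have [l Hl] := minq k (inAMl _ (inA_uin b)).
  have [l0|l0] := eqVneq l 0.
    by move: q0; rewrite (cq q)// ?eqxx// Hl l0 scale0r.
  have : urep (q * k * q) eta = l *: eta by rewrite Hl urepZ urep_inA// qeta.
  rewrite /k !urepM (urep_inA _ (inA_uin b)) /= tb /urep !rep0 !scaler0 !addr0.
  by rewrite !scaler0 rep0 addr0 => /esym/eqP; rewrite scaler_eq0 (negPf l0) (negPf eta0).
have := kill q mq; rewrite (rep_ker_unitary (Hb tau taub)) => /(_ eta).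
by rewrite qeta => /eqP; apply/negP.
Qed.

End scattered_case.

Section bad_case.
Variables (a0 : U) (f : U -> U * U).
Hypothesis bad0 : bad a0.
Hypothesis Hf : forall a, bad a ->
  [/\ bad (f a).1, bad (f a).2, a * (f a).1 = (f a).1, a * (f a).2 = (f a).2
    & (f a).1 * (f a).2 = 0].
Implicit Types (s t : nat -> bool).

Let T s := fix T n := if n is m.+1 then (if s m then (f (T m)).1 else (f (T m)).2) else a0.

Let TS s n : T s n.+1 = if s n then (f (T s n)).1 else (f (T s n)).2. Proof. by []. Qed.

Let T_bad s n : bad (T s n).
Proof.
elim: n => // n /Hf[b1 b2 _ _ _]; rewrite TS; by case: (s n).
Qed.

Let T_node s n : node (T s n). Proof. by case: (T_bad s n). Qed.

Let T_sa s n : usa (T s n). Proof. by case: (T_node s n). Qed.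

Let T_inA s n : inA (T s n). Proof. by case: (T_node s n). Qed.

Let T_mul s m n : (m < n)%N -> T s m * T s n = T s n.
Proof.
have H k : T s k * T s k.+1 = T s k.+1.
  by have [_ _ h1 h2 _] := Hf (T_bad s k); rewrite TS; case: (s k).
elim: n => // n IH; rewrite ltnS leq_eqVlt => /predU1P[->//|/IH E].
have K : T s n.+1 * T s n = T s n.+1 by have := congr1 ustar (H n); rewrite ustarM !T_sa.
have E' : T s n * T s m = T s n by have := congr1 ustar E; rewrite ustarM !T_sa.
have : T s n.+1 * T s m = T s n.+1 by rewrite -K -mulrA E'.
by move=> /(congr1 ustar); rewrite ustarM !T_sa.
Qed.

Let T_split s t : s != t -> exists n, T s n * T t n = 0.
Proof.
move=> st; have [n0 Hn0] : exists n, s n != t n.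
  apply: contrapT => /forallNP H; move/eqP: st; apply; apply/funext => n.
  by apply/eqP/negPn/negP; exact: H.
pose n := ex_minn (ex_intro (fun n => s n != t n) n0 Hn0).
have [Hn min] : s n != t n /\ forall m, s m != t m -> (n <= m)%N by rewrite /n; case: ex_minnP.
exists n.+1; have E : T s n = T t n.
  have : forall m, (m <= n)%N -> T s m = T t m.
    elim=> // m IH mn; rewrite !TS IH ?(ltnW mn)//.
    suff -> : s m = t m by [].
    by apply/eqP/negPn/negP => /min; rewrite leqNgt mn.
  exact.
have [_ _ _ _ h] := Hf (T_bad s n); rewrite !TS -E.
have h' : (f (T s n)).2 * (f (T s n)).1 = 0.
  have [[[_ s1 _ _] _] [[_ s2 _ _] _] _ _ _] := Hf (T_bad s n).
  by have := congr1 ustar h; rewrite ustarM s1 s2 ustar0.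
by case: (s n) (t n) Hn => [] [].
Qed.

Let eig s (pi : irrep A) (v : rep_space pi) := nr v = 1 /\ forall n, pi (T s n).2 v = v.

Let eig_orth s t (pi : irrep A) (u v : rep_space pi) : s != t -> eig s u -> eig t v ->
  inner u v = 0.
Proof.
move=> /T_split[n st] [_ su] [_ tv]; rewrite -(su n) -urep_inA// urep_star T_sa.
by rewrite -(tv n) -(urep_inA v)// -urepM st urep_inA// rep_0l ip0r.
Qed.

Let branch s : exists (pi : irrep A) (v : rep_space pi), eig s v.
Proof.
have /choice[psi Hpsi] := fun n => node_state (T_node s n).
have [F [FU Ffree]] := free_ultrafilter; have FF : ProperFilter F by exact: ultra_proper.
have [g [sg lim]] := state_ulim FU (fun n => (Hpsi n).1).
have [||||pi [xi [xi1 H _]]] := @irrep_of_face _ A (range (T s)) set0 _ _ sepA.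
- by move=> _ [n _ <-]; have [] := T_node s n.
- by [].
- by exists (T s 0); exists 0%N.
- exists g; split=> // _ [m _ <-].
  apply: (ulim_eq FF (lim _)); apply: filterS (Ffree m.+1) => n /= mn.
  have [sp psip] := Hpsi n; have [_ sn n1 _] := T_node s n.
  by have [<- _] := state_unit sp (T s m) sn n1 psip; rewrite T_mul.
by exists pi, xi; split=> // n; apply: H; exists n.
Qed.

(** The isolating element is scaled so that it preserves the norm of some nonzero vector; every
    element at distance less than one from it is then nonzero in [pi]. *)
Let isolated (pi : irrep A) : exists x : A, exists v : rep_space pi, [/\ v != 0, nr (pi x v) = nr v &
  forall sigma : irrep A, ~ rep_ker sigma x -> unitarily_equivalent pi sigma].
Proof.
have [x [/rep_kerN[v xv] Hx]] := discrete_isolated pi disc.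
have v0 : v != 0 by apply: contra_neq xv => ->; rewrite rep0.
have n0 : nr (pi x v) != 0 by apply: contra_neq xv => /nr0_eq0.
exists ((nr v / nr (pi x v))%:C%C *: x), v; split=> //.
  by rewrite rep_Zl nrZR ger0_norm ?divr_ge0 ?nr_ge0// divfK.
move=> sigma H; apply: Hx => K; apply: H => w; rewrite rep_Zl K.
exact: scaler0.
Qed.

(* Distinct branches of the tree have orthogonal eigenvectors. By separability the
   branches fall into countably many equivalence classes of irreducible representations,
   and each class accommodates countably many orthonormal vectors. *)
Lemma bad_false : False.
Proof.
have [d dd] := dense_seq sepA.
have /choice[P HP] : forall s, exists P : {sigma : irrep A & rep_space sigma}, eig s (projT2 P).
  by move=> s; have [pi [v Hv]] := branch s; exists (existT _ pi v).
pose pi s := projT1 (P s); pose xi s : rep_space (pi s) := projT2 (P s).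
have /choice[x Hx] := fun s => isolated (pi s).
have e3 : 0 < 3^-1 :> R by [].
have /choice[N HN] := fun s => dd (x s) 3^-1 e3.
(* Sharing an approximant up to [1 / 3] puts [x s] and [x t] at distance at most [2 / 3], so [pi s]
   does not kill [x t], which isolates the class of [pi t]. *)
have equiv s t : N s = N t -> unitarily_equivalent (pi s) (pi t).
  move=> st; apply: unitarily_equivalent_sym; have [w [_ _]] := Hx t; apply.
  have [v [v0 xv _]] := Hx s => /(_ v) H.
  have v_gt0 : 0 < nr v by rewrite lt_def nr_ge0 andbT; apply: contra_neq v0 => /nr0_eq0.
  have : nr (x s - x t) <= 2 / 3.
    rewrite (le_trans (nr_tri (d (N s)) _ _))// (_ : 2 / 3 = 3^-1 + 3^-1 :> R); last by field.
    by rewrite lerD// st nr_sub.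
  have := @rep_le _ _ (pi s) (x s - x t) v; rewrite rep_Bl H subr0 xv.
  by move: (nr _) (nr v) v_gt0 => q r; nra.
have /choice[ref Href] : forall n, exists r, forall s, N s = n -> N r = n.
  move=> n; have [[s Hs]|H] := pselect (exists s, N s = n); first by exists s.
  by exists xpredT => s Hs; case: H; exists s.
have half0 : 0 < 4^-1 :> R by [].
(* The code of a branch: [n] names its equivalence class, with representative [pi (ref n)], and [m]
   a vector within [1 / 2] of an eigenvector of the branch transported there. Branches with equal
   codes would have orthonormal eigenvectors at distance at most one, less than the square root of
   two. *)
pose near s n m := N s = n /\ exists2 u : rep_space (pi (ref n)), eig s u &
  nr (u - pi (ref n) (d m) (xi (ref n))) <= 2^-1.
have /choice[g Hg] : forall s, exists nm : nat * nat, near s nm.1 nm.2.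
  move=> s; have [W [lW _ iW WE]] := equiv s (ref (N s)) (esym (Href _ _ erefl)).
  have [xi1 xiT] := HP s.
  have Wnr u : nr (W u) = nr u.
    apply/eqP; rewrite -(@eqrXn2 _ 2) ?nr_ge0// -(inj_eq (@complexI R)) -!ip_nr.
    by rewrite iW.
  have [r1 _] := HP (ref (N s)).
  have r0 : xi (ref (N s)) != 0.
    by apply/eqP => x0; move: r1; rewrite -/(xi _) x0 nr0 => /esym/eqP; rewrite oner_eq0.
  have [b Hb] := irreducible_dense (irrepP (pi (ref (N s)))) r0 (W (xi s)) half0.
  have [m Hm] := dd b _ half0; exists (N s, m); split=> //; exists (W (xi s)).
    by split=> [|n]; rewrite ?Wnr// -WE xiT.
  rewrite (le_trans (nr_tri (pi (ref (N s)) b (xi (ref (N s)))) _ _))//.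
  rewrite (_ : 2^-1 = 4^-1 + 4^-1 :> R); last by field.
  rewrite lerD// -rep_Bl (le_trans (rep_le _ _))// (le_trans _ Hm)//.
  by rewrite [X in _ * X]r1 mulr1.
apply: (@no_countable_code _ g) => s t st; apply/eqP/negPn/negP => nst.
have [_ [u us um]] := Hg s; have [_] := Hg t; rewrite -st => -[v vt vm].
have uv : nr (u - v) <= 1.
  rewrite (le_trans (nr_tri (pi (ref (g s).1) (d (g s).2) (xi (ref (g s).1))) _ _))//.
  by rewrite (splitr 1) lerD// ?mul1r// nr_sub.
have : nr (u - v) ^+ 2 = 2.
  rewrite nrD_ortho ?nrN ?us.1 ?vt.1 ?expr1n//.
  by rewrite -scaleN1r ipZr (eig_orth nst us vt) mulr0.
have := nr_ge0 (u - v); move: (nr (u - v)) uv => r; nra.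
Qed.

End bad_case.

Theorem atomic_of_discrete : @atomic R A.
Proof.
apply: contrapT => nA; have [sc|nsc] := pselect (@scattered R A).
  have [a [p [[Aa sa a1] mp ap pp]]] := minproj_seq sc nA.
  exact: scattered_not_atomic_false sc Aa sa a1 mp ap pp.
have [a /not_implyP[Na nb]] := (existsNP _).2 nsc.
have [f Hf] := @bad_split R A.
by apply: (@bad_false a f); first split.
Qed.

End atomic_of_discrete.

Theorem theorem2p3 (R : realType) (A : cStarAlgType R) (sepA : separable_space A) :
  [<-> spectrum_discrete A; weak_star_fpp A; weak_star_fpp_left_reversible A].
Proof.
tfae=> [disc|fpp|fpp].
- exact/fpp_of_left_reversible/left_reversible_of_atomic/(atomic_of_discrete sepA disc).
- exact/left_reversible_of_atomic/(atomic_of_fpp sepA fpp).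
- exact/discrete_of_atomic/(atomic_of_fpp sepA)/fpp_of_left_reversible.
Qed.
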